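(* Let $\mathcal{M}$ be a matroid with set of bases $\mathcal{B}$, and let $K$ be an algebraically closed field with nontrivial valuation $\mathrm{val}_K$ and residue field $k$. Then $$\mathrm{Gr}_{\mathcal{M}}\subset\{v\in\mathbb{R}^{\mathcal{B}} : \text{all cells of }\Delta_v\text{ are matroid polytopes of matroids which are realizable over }k\}\subset\mathrm{Dr}_{\mathcal{M}}.$$ If $\mathrm{Gr}_{\mathcal{M}}=\mathrm{Dr}_{\mathcal{M}}$, then no regular matroid subdivision of the matroid polytope $P_{\mathcal{M}}$ contains a cell which is the matroid polytope of a matroid not realizable over $k$, and all initial matroids of $\mathcal{M}$ are realizable over $k$. Moreover, both inclusions can be strict: there exist $\mathcal{M}$ and $K$ for which the first inclusion is strict, and there exist $\mathcal{M}$ and $K$ for which the second inclusion is strict.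
   Context: Let $\mathcal{M}$ be a matroid of rank $d$ on $[n]$ with bases $\mathcal{B}$. Let $G_{\mathcal{M}}\subset K[p_\sigma^{\pm1} : \sigma\in\mathcal{B}]$ be the set of polynomials obtained from the three-term Plücker relations $p_{Sij}p_{Skl}-p_{Sik}p_{Sjl}+p_{Sil}p_{Sjk}$ ($S\in\binom{[n]}{d-2}$, $i,j,k,l$ distinct in $[n]\setminus S$, $Sij=S\cup\{i,j\}$) by replacing $p_\sigma$ by $0$ whenever $\sigma$ is not a basis of $\mathcal{M}$. Let $I_{\mathcal{M}}$ be the ideal generated by $G_{\mathcal{M}}$. For a Laurent polynomial $f=\sum_u c_u p^u$, $\mathrm{trop}(V(f))\subset\mathbb{R}^{\mathcal{B}}$ is the set of $w$ at which $\min_{u:\,c_u\ne0}(\mathrm{val}_K(c_u)+u\cdot w)$ is attained at least twice (everything if $f=0$, empty if $f$ is a monomial). The tropical Grassmannian of $\mathcal{M}$ is $\mathrm{Gr}_{\mathcal{M}}=\bigcap_{f\in I_{\mathcal{M}}}\mathrm{trop}(V(f))$, and the Dressian is $\mathrm{Dr}_{\mathcal{M}}=\bigcap_{f\in G_{\mathcal{M}}}\mathrm{trop}(V(f))$. The matroid polytope is $P_{\mathcal{M}}=\mathrm{conv}\{e_\sigma:\sigma\in\mathcal{B}\}$ with $e_\sigma=\sum_{i\in\sigma}e_i\in\mathbb{R}^n$. For $v\in\mathbb{R}^{\mathcal{B}}$, $\Delta_v$ denotes the regular subdivision of $P_{\mathcal{M}}$ induced by $v$: its cells are the projections of the lower faces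 of $\mathrm{conv}\{(e_\sigma,v_\sigma):\sigma\in\mathcal{B}\}\subset\mathbb{R}^{n+1}$. A subdivision of $P_{\mathcal{M}}$ is a matroid subdivision if every cell is the matroid polytope of a matroid. A matroid of rank $d$ on $[n]$ is realizable over a field $F$ if there are vectors $v_1,\dots,v_n\in F^d$ such that $\sigma$ is a basis of the matroid iff $\{v_i\}_{i\in\sigma}$ is a basis of $F^d$. For $v\in\mathrm{Dr}_{\mathcal{M}}$ the initial matroid $\mathcal{M}_v$ is the matroid with bases $\{\sigma\in\mathcal{B}: v_\sigma\text{ is minimal}\}$; the initial matroids of $\mathcal{M}$ are the $\mathcal{M}_v$ for $v\in\mathrm{Dr}_{\mathcal{M}}$. *)

(* Defs.v *)
From HB Require Import structures.
From mathcomp Require Import all_boot all_order all_algebra finmap.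
From mathcomp Require Import generic_quotient ring_quotient monalg.
From mathcomp Require Import boolp classical_sets reals constructive_ereal.

Set Implicit Arguments.
Unset Strict Implicit.
Unset Printing Implicit Defensive.
Set Warnings "-notation-overridden".

Import Order.TTheory GRing.Theory Num.Theory.

Local Open Scope classical_set_scope.
Local Open Scope ring_scope.

Record matroid (n : nat) := Matroid {
  rank : nat;
  bases : {set {set 'I_n}};
  bases_neq0 : bases != finset.set0;
  bases_card : forall s, s \in bases -> #|s| = rank;
  bases_exchange : forall s t, s \in bases -> t \in bases ->
    forall x, x \in s :\: t -> exists2 y, y \in t :\: s & y |: (s :\ x) \in bases
}.

Definition matroid_basis (n : nat) (M : matroid n) := {s : {set 'I_n} | s \in bases M}.

(* [v] lists the vectors with their indices, so that equal vectors at distinct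
   indices of [s] are dependent. *)
Definition realizable (n : nat) (M : matroid n) (F : fieldType) : Prop :=
  exists v : 'I_n -> 'rV[F]_(rank M), forall s : {set 'I_n},
    s \in bases M <-> basis_of fullv [seq v i | i <- enum s].

Record valuation (R : realType) (K : fieldType) := Valuation {
  val_fun :> K -> \bar R;
  valuation_gtNy : forall x, (-oo < val_fun x)%E;
  valuation_eqy : forall x, val_fun x = +oo%E <-> x = 0;
  valuationM : forall x y, val_fun (x * y) = (val_fun x + val_fun y)%E;
  valuationD : forall x y,
    (Order.min (val_fun x) (val_fun y) <= val_fun (x + y))%E
}.

Definition nontrivial_valuation (R : realType) (K : fieldType)
  (v : valuation R K) : Prop := exists2 x, x != 0 & v x <> 0%E.

Section ResidueField.
Variables (R : realType) (K : fieldType) (v : valuation R K).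

Lemma valuation0 : v 0 = +oo%E.
Proof. exact/valuation_eqy. Qed.

Lemma valuation_fin x : x != 0 -> exists r : R, v x = r%:E.
Proof.
move=> x0; have := valuation_gtNy v x; case E : (v x) => [r| |] //; first by exists r.
by move/valuation_eqy: E x0 => ->; rewrite eqxx.
Qed.

Lemma valuation1 : v 1 = 0%E.
Proof.
have [r vr] := valuation_fin (oner_neq0 K).
have := valuationM v 1 1; rewrite mulr1 vr => -[] /eqP.
by rewrite -subr_eq0 opprD addrA subrr add0r oppr_eq0 => /eqP ->.
Qed.

Lemma valuationN x : v (- x) = v x.
Proof.
suff vN1 : v (-1) = 0%E by rewrite -mulN1r valuationM vN1 add0e.
have [|r vr] := @valuation_fin (-1); first by rewrite oppr_eq0 oner_neq0.
have := valuationM v (-1) (-1); rewrite mulrNN mulr1 valuation1 vr => -[] /esym/eqP.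
by rewrite -mulr2n mulrn_eq0 /= => /eqP ->.
Qed.

Lemma valuationV x : x != 0 -> v x = 0%E -> v x^-1 = 0%E.
Proof.
by move=> x0 vx; have := valuationM v x x^-1; rewrite mulfV // valuation1 vx add0e.
Qed.

Definition valring_pred : {pred K} := fun x => (0 <= v x)%E.

Lemma valring_subring : subring_closed valring_pred.
Proof.
rewrite /valring_pred; split=> [|x y|x y]; rewrite !unfold_in.
- by rewrite valuation1.
- move=> vx vy; apply: le_trans (valuationD v _ _).
  by rewrite le_min vx valuationN vy.
- by move=> vx vy; rewrite valuationM adde_ge0.
Qed.

HB.instance Definition _ := GRing.isSubringClosed.Build K valring_pred
  valring_subring.

Record valring := ValRing { valring_val : K; _ : valring_val \in valring_pred }.

HB.instance Definition _ := [isSub for valring_val].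
HB.instance Definition _ := [Choice of valring by <:].
HB.instance Definition _ := [SubChoice_isSubComNzRing of valring by <:].

Definition valring_max : {pred valring} := fun x => (0 < v (valring_val x))%E.

Let valringM (x y : valring) : valring_val (x * y) = valring_val x * valring_val y.
Proof. exact: (rmorphM (\val : valring -> K)). Qed.

Let valring0 : valring_val 0 = 0.
Proof. exact: (rmorph0 (\val : valring -> K)). Qed.

Let valring1 : valring_val 1 = 1.
Proof. exact: (rmorph1 (\val : valring -> K)). Qed.

Lemma valring_max_ideal : idealr_closed valring_max.
Proof.
rewrite /valring_max; split; rewrite ?unfold_in.
- by rewrite valring0 valuation0 ltry.
- by rewrite valring1 valuation1 ltxx.
move=> a x y; rewrite !unfold_in => vx vy.
have -> : valring_val (a * x + y) =
    valring_val a * valring_val x + valring_val y.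
  by rewrite -valringM; exact: (rmorphD (\val : valring -> K)).
apply: lt_le_trans (valuationD v _ _); rewrite lt_min vy andbT valuationM.
by case: a => a /= va; apply: lt_le_trans vx _; rewrite leeDr.
Qed.

HB.instance Definition _ := isIdealr.Build valring valring_max
  valring_max_ideal.

Definition residue_field : Type := {ideal_quot valring_max}.

HB.instance Definition _ := GRing.ComNzRing.on residue_field.

Lemma residue_unit (x : residue_field) : x != 0 -> exists y, y * x == 1.
Proof.
rewrite -[x]reprK; set a : valring := repr x => xn0.
have vnpos : ~~ (0 < v (valring_val a))%E.
  apply: contra xn0 => va.
  rewrite -[0](rmorph0 \pi_({ideal_quot valring_max})%qT).
  by rewrite -Quotient.idealrBE subr0.
have va : v (valring_val a) = 0%E.
  apply/eqP; rewrite eq_le; case: (a) vnpos => b vb /=.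
  by rewrite -leNgt => ->.
have an0 : valring_val a != 0.
  by apply/eqP => a0; move: va; rewrite a0 valuation0.
have vb : (valring_val a)^-1 \in valring_pred.
  by rewrite unfold_in /= valuationV.
exists (\pi_({ideal_quot valring_max})%qT (ValRing vb)).
rewrite -rmorphM -(rmorph1 \pi_({ideal_quot valring_max})%qT).
apply/eqP; congr (\pi_({ideal_quot valring_max})%qT _); apply/val_inj => /=.
by rewrite [LHS](valringM (ValRing vb) a) [RHS]valring1 /= mulVf.
Qed.

Definition residue_inv (x : residue_field) : residue_field :=
  if pselect (exists y, y * x == 1) is left h then xchoose h else 0.

Lemma residue_mulVf (x : residue_field) : x != 0 -> residue_inv x * x = 1.
Proof.
move=> x0; rewrite /residue_inv.
by case: pselect => [h|/(_ (residue_unit x0))] //; exact/eqP/(xchooseP h).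
Qed.

Lemma residue_inv0 : residue_inv 0 = 0.
Proof. by rewrite /residue_inv; case: pselect => // h; exfalso; case: h => y;
   rewrite mulr0 eq_sym oner_eq0. Qed.

HB.instance Definition _ := GRing.ComNzRing_isField.Build residue_field
  residue_mulVf residue_inv0.

End ResidueField.

(* Finitely supported functions u |-> c_u on Z^I, i.e. f = \sum_u c_u p^u. *)
Definition laurent (I : finType) (K : fieldType) : Type :=
  {malg K[{ffun I -> int}]}.

Section LaurentRing.
Variables (I : finType) (K : fieldType).

HB.instance Definition _ := GRing.Lmodule.on (laurent I K).

Implicit Types (f g h : laurent I K) (u : {ffun I -> int}).

Definition laurent_one : laurent I K := << 0 >>.

Definition laurent_mul f g : laurent I K :=
  \sum_(u <- msupp f) \sum_(w <- msupp g) << f@_u * g@_w *g u + w >>.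

Let mulw (d1 d2 : {fset {ffun I -> int}}) f g :
    (msupp f `<=` d1)%fset -> (msupp g `<=` d2)%fset ->
  laurent_mul f g =
    \sum_(u <- d1) \sum_(w <- d2) << f@_u * g@_w *g u + w >>.
Proof.
move=> le1 le2; rewrite /laurent_mul (big_fset_incl _ le1) /=; last first.
  move=> u _ /mcoeff_outdom fu.
  by rewrite big1 // => w _; rewrite fu mul0r monalgU0.
apply: eq_bigr => u _; apply/big_fset_incl => // w _ /mcoeff_outdom ->.
by rewrite mulr0 monalgU0.
Qed.

Let mulUU (a b : K) u w :
  laurent_mul << a *g u >> << b *g w >> = << a * b *g u + w >>.
Proof. by rewrite (mulw msuppU_le msuppU_le) !big_seq_fset1 !mcoeffUU. Qed.

Let mulC : commutative laurent_mul.
Proof.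
move=> f g; rewrite /laurent_mul exchange_big /=.
apply: eq_bigr => w _; apply: eq_bigr => u _.
by rewrite mulrC addrC.
Qed.

Let mulDl : left_distributive laurent_mul +%R.
Proof.
move=> f g h.
rewrite [in RHS](mulw (fsubsetUl _ (msupp g)) (fsubset_refl _)).
rewrite [in RHS](mulw (fsubsetUr (msupp f) _) (fsubset_refl _)).
rewrite (mulw (msuppD_le _ _) (fsubset_refl _)).
rewrite -big_split /=; apply/eq_bigr=> u _.
rewrite -big_split /=; apply/eq_bigr=> w _.
by rewrite mcoeffD mulrDl monalgUD.
Qed.

Let mul0 : left_zero 0 laurent_mul.
Proof. by move=> f; rewrite /laurent_mul msupp0 big_seq_fset0. Qed.

Let mulDr : right_distributive laurent_mul +%R.
Proof. by move=> f g h; rewrite mulC mulDl !(mulC f). Qed.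

Let mulr0 : right_zero 0 laurent_mul.
Proof. by move=> f; rewrite mulC mul0. Qed.

Let mul1 : left_id laurent_one laurent_mul.
Proof.
move=> f; rewrite (mulw msuppU_le (fsubset_refl _)) big_seq_fset1.
rewrite [RHS]monalgE; apply: eq_bigr => u _.
by rewrite mcoeffUU mul1r add0r.
Qed.

Let mulA : associative laurent_mul.
Proof.
move=> f g h; move: laurent_mul mulDl mulDr mul0 mulr0 mulUU => m mDl mDr m0 mr0 mUU.
have suml J (r : seq J) (F : J -> laurent I K) k :
    m (\sum_(i <- r) F i) k = \sum_(i <- r) m (F i) k.
  exact: (big_morph (m^~ k) (fun _ _ => mDl _ _ _) (m0 k)).
have sumr J (r : seq J) (F : J -> laurent I K) k :
    m k (\sum_(i <- r) F i) = \sum_(i <- r) m k (F i).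
  exact: (big_morph (m k) (fun _ _ => mDr _ _ _) (mr0 k)).
rewrite (monalgE f) !suml; apply: eq_bigr => u _.
rewrite (monalgE g) suml !sumr suml; apply: eq_bigr => w _.
rewrite (monalgE h) !sumr; apply: eq_bigr => t _.
by rewrite !mUU mulrA addrA.
Qed.

Let one_neq0 : laurent_one != 0.
Proof.
apply/eqP => /malgP /(_ 0) /eqP.
by rewrite mcoeffUU mcoeff0 oner_eq0.
Qed.

HB.instance Definition _ := GRing.Zmodule_isComNzRing.Build (laurent I K)
  mulA mulC mul1 mulDl one_neq0.

Definition lvar (i : I) : laurent I K :=
  << [ffun j => (j == i)%:R] >>.

End LaurentRing.

Definition ideal_generated (A : comNzRingType) (G : set A) : set A :=
  [set f | exists (m : nat) (h g : 'I_m -> A),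
     (forall i, G (g i)) /\ f = \sum_(i < m) h i * g i].

(* The weight val(c_u) + u . w of the term c_u p^u at w. *)
Definition term_weight (R : realType) (I : finType) (K : fieldType)
    (v : valuation R K) (f : laurent I K) (w : {ffun I -> R})
    (u : {ffun I -> int}) : \bar R :=
  (v (f@_u) + (\sum_(i : I) (u i)%:~R * w i)%:E)%E.

Definition trop (R : realType) (I : finType) (K : fieldType)
    (v : valuation R K) (f : laurent I K) : set {ffun I -> R} :=
  [set w | f = 0 \/
    exists u1 u2, [/\ u1 \in msupp f, u2 \in msupp f, u1 != u2,
      term_weight v f w u1 = term_weight v f w u2
      & forall u, u \in msupp f ->
          (term_weight v f w u1 <= term_weight v f w u)%E]].

Section Dressian.
Variables (n : nat) (M : matroid n) (K : fieldType).

(* p_s, replaced by 0 when s is not a basis. *)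
Definition pluecker_coord (s : {set 'I_n}) : laurent (matroid_basis M) K :=
  if @insub _ (fun s => s \in bases M) (matroid_basis M) s is Some b
  then lvar K b else 0.

Definition three_term (S : {set 'I_n}) (i j k l : 'I_n) :
    laurent (matroid_basis M) K :=
  let p a b := pluecker_coord (S :|: [set a; b]%SET) in
  p i j * p k l - p i k * p j l + p i l * p j k.

(* As the variables are indexed by sets, the signs of the Pluecker relation are
   the displayed ones for i < j < k < l; with alternating coordinates
   p_(S,a,b) every other order of i, j, k, l gives the same relation up to
   sign.  Without the ordering, adding two of these expressions would put the
   spurious element 2 p_Sij p_Skl into the ideal.  The condition on #|S| is
   written additively since subtraction on nat is truncated. *)
Definition relations : set (laurent (matroid_basis M) K) :=
  [set f | exists (S : {set 'I_n}) (i j k l : 'I_n),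
    [/\ (#|S| + 2 = rank M)%N, (i < j < k)%N && (k < l)%N,
        [&& i \notin S, j \notin S, k \notin S & l \notin S]
      & f = three_term S i j k l]].

Definition relation_ideal : set (laurent (matroid_basis M) K) :=
  ideal_generated relations.

Variables (R : realType) (v : valuation R K).

Definition Gr : set {ffun matroid_basis M -> R} :=
  \bigcap_(f in relation_ideal) trop v f.

Definition Dr : set {ffun matroid_basis M -> R} :=
  \bigcap_(f in relations) trop v f.

End Dressian.

Definition convex_hull (R : realType) (I : finType) (m : nat)
    (x : I -> 'rV[R]_m) : set 'rV[R]_m :=
  [set y | exists t : I -> R,
    [/\ forall i, 0 <= t i, \sum_i t i = 1 & y = \sum_i t i *: x i]].

Section Subdivision.
Variables (R : realType) (n : nat).

Definition evec (s : {set 'I_n}) : 'rV[R]_n := \sum_(i in s) delta_mx 0 i.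

Definition matroid_polytope (M : matroid n) : set 'rV[R]_n :=
  convex_hull (fun s : matroid_basis M => evec (\val s)).

Definition lifted_polytope (M : matroid n) (w : {ffun matroid_basis M -> R}) :
    set 'rV[R]_(n + 1) :=
  convex_hull (fun s : matroid_basis M => row_mx (evec (\val s)) (w s)%:M).

Definition dot (m : nat) (x y : 'rV[R]_m) : R := \sum_i x 0 i * y 0 i.

(* Lower faces are the sets of minimizers over Q of a linear functional whose
   last coefficient is positive. *)
Definition lower_face (Q F : set 'rV[R]_(n + 1)) : Prop :=
  exists a : 'rV[R]_(n + 1), 0 < a 0 (rshift n ord0) /\
    F = [set q | Q q /\ forall q', Q q' -> dot a q <= dot a q'].

Definition regular_subdivision (M : matroid n) (w : {ffun matroid_basis M -> R}) :
    set (set 'rV[R]_n) :=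
  [set C | exists2 F, lower_face (lifted_polytope w) F & C = lsubmx @` F].

Definition matroid_subdivision (D : set (set 'rV[R]_n)) : Prop :=
  forall C, D C -> exists N : matroid n, C = matroid_polytope N.

Definition realizable_cells (M : matroid n) (F : fieldType) :
    set {ffun matroid_basis M -> R} :=
  [set w | forall C, regular_subdivision w C ->
     exists2 N : matroid n, C = matroid_polytope N & realizable N F].

Definition is_initial_matroid (M : matroid n) (w : {ffun matroid_basis M -> R})
    (N : matroid n) : Prop :=
  forall s : {set 'I_n}, s \in bases N <->
    exists2 b : matroid_basis M, \val b = s & forall b', w b <= w b'.

End Subdivision.

Arguments relations {n} M K.
Arguments relation_ideal {n} M K.
Arguments Gr {n} M {K R} v.
Arguments Dr {n} M {K R} v.
Arguments matroid_polytope R {n} M.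
Arguments lifted_polytope {R n} M w.
Arguments regular_subdivision {R n} M w.
Arguments realizable_cells R {n} M F.
Arguments is_initial_matroid {R n} M w N.

(* Main.v *)
Require Import Defs.
From HB Require Import structures.
From mathcomp Require Import all_boot all_order all_algebra all_field finmap.
From mathcomp Require Import generic_quotient ring_quotient monalg.
From mathcomp Require Import zify ring lra.
From mathcomp Require Import boolp classical_sets reals constructive_ereal.

Set Implicit Arguments.
Unset Strict Implicit.
Unset Printing Implicit Defensive.

Import Order.TTheory GRing.Theory Num.Theory.

Local Open Scope classical_set_scope.
Local Open Scope ring_scope.

(* Let w be in Gr(M), with k the residue field. If the initial forms at w of the
   three-term relations generated the unit ideal of the Laurent ring over k, then,
   after picking homogeneous components, the relation 1 = \sum h_i in_w(g_i) would
   lift to an element of I_M whose minimum at w is attained only at the constant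
   term. Hence, by the Nullstellensatz, these initial forms vanish at a point a of
   the torus over k. Such a point forces the local exchange inequality on w, so
   that the minimizers of any tilt w + l form a matroid N, and the restriction of a
   to N satisfies the three-term Pluecker relations. Reading off vectors from a
   basis B0, these relations say precisely that the coordinates with respect to
   two adjacent bases differ by a pivot, so the vectors realize N over k.
   Conversely, if the local exchange fails at S, i, j, k, l, a suitable tilt cuts
   out a cell whose vertices violate basis exchange.

   Both inclusions are strict over the algebraic numbers with a 2-adic valuation,
   at w = 0: for the Fano matroid, realizable over k but not over K (so that its
   tropical Grassmannian is empty), and for the non-Fano matroid, not realizable
   over k. *)

(** * Nullstellensatz *)

(** The Laurent ring is not presented as a quotient of a polynomial ring, so the Nullstellensatz is
    proved one variable at a time for iterated polynomial rings over the field. It is applied to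
    such a ring mapping to the Laurent ring with the variables in its image, which is enough because
    the relations are polynomials in the variables. It is used twice: over k for initial forms, and
    over K to exclude the Fano matroid.

    Weights live on bases only, a non-basis standing for height +oo. Three-term relations therefore
    control only bases at distance two, whereas a matroid cell needs exchange between arbitrary
    minimizers; an induction on the distance with an auxiliary potential closes this gap.

    The valuation comes from a subring of the algebraic numbers maximal among those omitting 1/2. It
    is real-valued because a vanishing rational polynomial in x must have two terms of equal value,
    so a positive power of x is a power of 2 up to a unit. As 2 is nonzero in K but zero in k, one
    valued field serves both examples. *)

Record prime_ideal (A : comNzRingType) (I : A -> Prop) : Prop := PrimeIdeal {
  prime0 : I 0;
  primeD : forall x y, I x -> I y -> I (x + y);
  primeMl : forall a x, I x -> I (a * x);
  prime1 : ~ I 1;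
  primeM : forall x y, I (x * y) -> I x \/ I y }.

Lemma primeB (A : comNzRingType) (I : A -> Prop) x y :
  prime_ideal I -> I x -> I y -> I (x - y).
Proof.
move=> pI Ix Iy; apply: (primeD pI) => //.
by rewrite -mulN1r; apply: (primeMl pI).
Qed.

Lemma primeX (A : comNzRingType) (I : A -> Prop) x n :
  prime_ideal I -> I (x ^+ n) -> I x.
Proof.
move=> pI; elim: n => [|n IHn]; first by rewrite expr0 => /(prime1 pI).
by rewrite exprS => /(primeM pI) [].
Qed.

Lemma prime_preim (A B : comNzRingType) (e : {rmorphism A -> B}) (I : B -> Prop) :
  prime_ideal I -> prime_ideal (fun a => I (e a)).
Proof.
move=> pI; split.
- by rewrite rmorph0; apply: prime0.
- by move=> x y; rewrite rmorphD; apply: primeD.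
- by move=> a x; rewrite rmorphM; apply: primeMl.
- by rewrite rmorph1; apply: prime1.
- by move=> x y; rewrite rmorphM; apply: primeM.
Qed.

(** The element [h] makes the property inductive: leading coefficients that must survive
    specialization are put into it when passing from [A] to [{poly A}]. *)
Definition has_points (k : fieldType) (A : comNzRingType) : Prop :=
  forall (I : A -> Prop) h, prime_ideal I -> ~ I h ->
  exists phi : {rmorphism A -> k}, (forall a, I a -> phi a = 0) /\ phi h != 0.

Lemma field_has_points (k : fieldType) : has_points k k.
Proof.
move=> I h pI Ih; exists idfun; split => [a Ia|].
  apply/eqP; apply: contraPT (prime1 pI) => a0 /=.
  by apply; rewrite -(mulVf a0); apply: primeMl.
by apply/eqP => /= h0; apply: Ih; rewrite h0; apply: prime0.
Qed.

Lemma min_size (A : nzRingType) (P : {poly A} -> Prop) :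
  (exists p, P p) -> exists p, P p /\ forall q, P q -> (size p <= size q)%N.
Proof.
move=> [p0 Pp0].
have ex : exists n, `[< exists p, P p /\ size p = n >].
  by exists (size p0); apply/asboolP; exists p0.
case: (ex_minnP ex) => n /asboolP[p [Pp sp]] mn; exists p; split=> // q Pq.
by rewrite sp; apply: mn; apply/asboolP; exists q.
Qed.

Lemma poly_tail_size (A : nzRingType) (p : {poly A}) :
  p != 0 -> (size (p - lead_coef p *: 'X^((size p).-1))%R < size p)%N.
Proof.
rewrite -size_poly_gt0 => p0.
rewrite -[X in (_ < X)%N](prednK p0) ltnS; apply/leq_sizeP => j.
rewrite leq_eqVlt => /orP[/eqP<-|pj].
  by rewrite coefB coefZ coefXn eqxx mulr1 subrr.
rewrite coefB coefZ coefXn gtn_eqF // mulr0 subr0 nth_default //.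
by rewrite -(prednK p0).
Qed.

(** Without inverses each reduction step costs a factor [lead_coef r]. The bound on [size q] serves
    to place a quotient below a minimal degree in [extend_point]. *)
Lemma pseudo_division (A : comNzRingType) (p r : {poly A}) : r != 0 ->
  exists N q s, [/\ lead_coef r ^+ N *: p = q * r + s, (size s < size r)%N &
     (size q <= size p - (size r).-1)%N].
Proof.
move=> r0; have sr : (0 < size r)%N by rewrite size_poly_gt0.
have [n] := ubnP (size p); elim: n p => // n IHn p.
rewrite ltnS => pn; have [pr|rp] := ltnP (size p) (size r).
  by exists 0%N, 0, p; rewrite expr0 scale1r mul0r add0r size_poly0.
have p0 : p != 0 by rewrite -size_poly_gt0 (leq_trans sr).
set b := lead_coef r; set c := lead_coef p.
pose d := (size p - size r)%N.
pose p1 := b *: p - (c *: 'X^d) * r.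
have sp1 : (size p1 < size p)%N.
  rewrite -(prednK (leq_trans sr rp)) ltnS; apply/leq_sizeP => j.
  have dE : (size p).-1 = (d + (size r).-1)%N.
    by rewrite /d; lia.
  rewrite leq_eqVlt => /orP[/eqP<-|pj].
    rewrite coefB coefZ -scalerAl coefZ coefXnM dE ltnNge leq_addr /= addKn -dE.
    by rewrite -/(lead_coef p) -/(lead_coef r) mulrC subrr.
  rewrite coefB coefZ -scalerAl coefZ coefXnM nth_default; last first.
    by rewrite -(prednK (leq_trans sr rp)).
  rewrite mulr0 sub0r [X in if _ then _ else X]nth_default ?if_same ?mulr0 ?oppr0 //.
  rewrite leq_subRL; last by rewrite (leq_trans _ (ltnW pj)) // dE leq_addr.
  by rewrite /d subnK // -(prednK (leq_trans sr rp)).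
have [|N [q [s [eq ss sq]]]] := IHn p1; first exact: leq_trans sp1 pn.
exists N.+1, (q + b ^+ N *: (c *: 'X^d)), s; split => //.
  have -> : b ^+ N.+1 *: p = b ^+ N *: p1 + b ^+ N *: (c *: 'X^d * r).
    by rewrite -scalerDr /p1 subrK scalerA -exprSr.
  by rewrite eq mulrDl scalerAl addrAC.
apply: (leq_trans (size_polyD _ _)); rewrite geq_max; apply/andP; split.
  by apply: leq_trans sq _; apply: leq_sub2r; apply: ltnW.
rewrite scalerA; apply: leq_trans (size_scale_leq _ _) _; rewrite size_polyXn /d.
by lia.
Qed.

Section ExtendPoint.
Variables (k : fieldType) (A : comNzRingType).
Hypothesis kC : GRing.closed_field_axiom k.
Variables (I : {poly A} -> Prop) (pI : prime_ideal I).
Let I' (a : A) := I a%:P.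

Let pI' : prime_ideal I'.
Proof. exact: (prime_preim (@polyC A) pI). Qed.

Lemma closed_root (p : {poly k}) : (1 < size p)%N -> exists x, root p x.
Proof.
move=> sp; have lp : lead_coef p != 0 by rewrite lead_coef_eq0 -size_poly_gt0 ltnW.
have [|x xE] := kC (n := (size p).-1) (fun i => - p`_i / lead_coef p).
  by rewrite -ltnS (prednK (ltnW sp)).
exists x; apply/rootP; rewrite horner_coef.
rewrite -(prednK (ltnW sp)) big_ord_recr /= xE mulr_sumr -big_split /=.
apply: big1 => i _; rewrite -/(lead_coef p) !mulNr mulrN mulrA mulrCA mulfV // mulr1.
by rewrite subrr.
Qed.

Let Isize_tail (P : {poly A} -> Prop) p :
  (forall q i, I i -> P q -> P (q - i)) -> P p ->
  (forall q, P q -> (size p <= size q)%N) -> p != 0 -> ~ I' (lead_coef p).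
Proof.
move=> PB Pp mp p0 Il; have := poly_tail_size p0; rewrite ltnNge => /negP; apply.
by apply: mp; apply: PB => //; rewrite -mul_polyC mulrC; apply: (primeMl pI).
Qed.

Let coefs_in (p : {poly A}) := forall j, I' p`_j.

Let coefs_inI p : coefs_in p -> I p.
Proof.
move=> cp; rewrite -[p]coefK poly_def.
apply: big_ind => [||j _]; [exact: prime0|exact: primeD|].
by rewrite -mul_polyC mulrC; apply: (primeMl pI); apply: cp.
Qed.

(* If all elements of [I] have their coefficients in [I'], every [x] outside the
   roots of [h] works. Otherwise [x] is a root of the image of some [g] in [I] of
   minimal degree with a coefficient outside [I']; an element [r] of [I + (h)]
   outside [I], of minimal degree, is constant, which keeps [h] from vanishing at [x]. *)
Lemma extend_point h : ~ I h -> exists2 h', ~ I' h' &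
  forall phi : {rmorphism A -> k}, (forall a, I' a -> phi a = 0) -> phi h' != 0 ->
  exists x : k, (forall p, I p -> (map_poly phi p).[x] = 0) /\ (map_poly phi h).[x] != 0.
Proof.
move=> Ih.
have [allc|/existsNP[g1 /not_implyP[Ig1 ng1]]] := pselect (forall p, I p -> coefs_in p).
  have /existsNP[j nj] : ~ coefs_in h by move=> /coefs_inI.
  exists h`_j => // phi phi0 hj.
  have : exists x, (map_poly phi h).[x] != 0.
    set P := map_poly phi h.
    have P0 : P != 0 by apply/eqP => /(congr1 (coefp j)) /=; rewrite coef_map coef0; apply/eqP.
    (* A nonroot of [P] is found without counting elements of [k]: a root of [P - 1], or any point
       if [P] is a nonzero constant. *)
    have [sP|sP] := ltnP 1 (size P).
      have [|x] := @closed_root (P - 1).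
        by rewrite size_polyDl // size_polyN size_poly1.
      rewrite /root hornerD hornerN hornerC subr_eq0 => /eqP E.
      by exists x; rewrite E oner_eq0.
    exists 0; rewrite (size1_polyC sP) hornerC -polyC_eq0.
    by rewrite -(size1_polyC sP).
  case=> x hx; exists x; split=> // p /allc cp.
  suff -> : map_poly phi p = 0 by rewrite horner0.
  by apply/polyP => i; rewrite coef_map coef0; apply: phi0.
have [|g [[Ig ng] ming]] := @min_size A (fun p => I p /\ ~ coefs_in p).
  by exists g1.
have g0 : g != 0.
  by apply/eqP => E; apply: ng => j; rewrite E coef0; exact: (prime0 pI').
have cI : ~ I' (lead_coef g).
  move=> Il; have := poly_tail_size g0; rewrite ltnNge => /negP; apply; apply: ming.
  have It : I (lead_coef g *: 'X^((size g).-1)).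
    by rewrite -mul_polyC mulrC; apply: (primeMl pI).
  split; first exact: (primeB pI).
  move=> cg; apply: ng => j; have := cg j; rewrite coefB coefZ coefXn.
  have [->|] := eqVneq j (size g).-1; first by rewrite /lead_coef in Il *.
  by rewrite mulr0 subr0.
have small p : I p -> (size p < size g)%N -> coefs_in p.
  move=> Ip; rewrite ltnNge => /negP sp; apply: contrapT => np; apply: sp.
  exact: ming.
have sg : (1 < size g)%N.
  rewrite ltnNge; apply/negP => sg1; apply: cI.
  by rewrite /I' /lead_coef; move: Ig; rewrite (size1_polyC sg1) size_polyC coefC;
     case: (_ != 0).
pose J p := exists u i, I i /\ p = u * h + i.
have JD p q : J p -> J q -> J (p + q).
  move=> [u [i [Ii ->]]] [u' [i' [Ii' ->]]]; exists (u + u'), (i + i').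
  by split; [apply: primeD | rewrite mulrDl addrACA].
have JM a p : J p -> J (a * p).
  move=> [u [i [Ii ->]]]; exists (a * u), (a * i).
  by split; [apply: (primeMl pI) | rewrite mulrDr mulrA].
have JI i : I i -> J i by exists 0, i; rewrite mul0r add0r.
have [|r [[Jr nIr] minr]] := @min_size A (fun p => J p /\ ~ I p).
  exists h; split => //; exists 1, 0; rewrite mul1r addr0; split => //.
  exact: prime0.
have r0 : r != 0 by apply/eqP => E; apply: nIr; rewrite E; apply: prime0.
have bI : ~ I' (lead_coef r).
  apply: Isize_tail minr r0; last by [].
  move=> q i Ii [Jq nIq]; split.
    by apply: JD => //; apply: JI; rewrite -mulN1r; apply: (primeMl pI).
  by move=> /(primeD pI) /(_ Ii); rewrite subrK.
have scI c N p : ~ I' c -> I (c ^+ N *: p) -> I p.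
  move=> nc; rewrite -mul_polyC => /(primeM pI) [|//].
  by move=> /(primeX pI').
(* The pseudo-remainder of [h] by [g] is in [J], and it is not in [I] because [I] is prime and omits
   both [h] and the powers of [lead_coef g]. *)
have srg : (size r < size g)%N.
  have [N [q [s [eq ss _]]]] := pseudo_division h g0.
  have Eqs : s = (lead_coef g ^+ N)%:P * h + (- q) * g.
    by rewrite mul_polyC eq mulNr addrAC subrr add0r.
  apply: leq_ltn_trans ss; apply: minr; split.
    by exists (lead_coef g ^+ N)%:P, (- q * g); split=> //; apply: (primeMl pI).
  move=> Is; apply: Ih; apply: (scI (lead_coef g) N) => //; rewrite eq.
  by apply: primeD => //; apply: (primeMl pI).
(* Otherwise, dividing [g] by [r] leaves a remainder in [I] by minimality of [r], hence a quotient
   in [I]. Both are shorter than [g], so their coefficients lie in [I'], and so would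
   [lead_coef g]. *)
have sr1 : (size r <= 1)%N.
  rewrite leqNgt; apply/negP => sr.
  have [N [q [s [eq ss sq]]]] := pseudo_division g r0.
  have Is : I s.
    apply: contrapT => nIs; move: ss; rewrite ltnNge => /negP; apply.
    apply: minr; split => //.
    have -> : s = (lead_coef r ^+ N)%:P * g + (- q) * r.
      by rewrite mul_polyC eq mulNr addrAC subrr add0r.
    by apply: JD; apply: JM => //; apply: JI.
  have Iq : I q.
    have : I (q * r).
      have -> : q * r = (lead_coef r ^+ N)%:P * g - s by rewrite mul_polyC eq addrK.
      by apply: primeB => //; apply: (primeMl pI).
    by move=> /(primeM pI) [].
  have cq : coefs_in q.
    apply: small => //; apply: leq_ltn_trans sq _.
    have aux (a b : nat) : (1 < a -> 1 < b -> b - a.-1 < b)%N by lia.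
    exact: aux.
  have cs : coefs_in s by apply: small => //; apply: ltn_trans srg.
  have : I' (lead_coef r ^+ N * lead_coef g).
    rewrite /lead_coef -/(lead_coef r) -coefZ eq coefD; apply: (primeD pI') => //.
    rewrite coefM; apply: big_ind => [||i _]; [exact: (prime0 pI')|exact: (primeD pI')|].
    by rewrite mulrC; apply: (primeMl pI').
  by move=> /(primeM pI') [/(primeX pI')|].
have [u [i [Ii rE]]] := Jr.
pose b := r`_0; have rb : r = b%:P by apply: size1_polyC.
have bI' : ~ I' b by rewrite /I' -rb.
(* The first factor preserves the degree of [g], so that its image has a root, and cancels the power
   in the pseudo-division by [g]; the second is the constant [r = u * h + i], which must stay
   nonzero. *)
exists (lead_coef g * b) => [/(primeM pI') []//|phi phi0].
rewrite rmorphM mulf_eq0 negb_or => /andP[cn bn].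
have sG : size (map_poly phi g) = size g by apply: size_map_poly_id0.
have [|x gx] := @closed_root (map_poly phi g); first by rewrite sG.
exists x.
have Px p : I p -> (map_poly phi p).[x] = 0.
  move=> Ip; have [N [q [s [eq ss _]]]] := pseudo_division p g0.
  have Is : I s.
    have -> : s = (lead_coef g ^+ N)%:P * p + (- q) * g.
      by rewrite mul_polyC eq mulNr addrAC subrr add0r.
    by apply: primeD => //; apply: (primeMl pI).
  have s0 : map_poly phi s = 0.
    by apply/polyP => j; rewrite coef_map coef0; apply/phi0/small.
  have := congr1 (fun p => (map_poly phi p).[x]) eq.
  rewrite /= rmorphD rmorphM /= s0 addr0 hornerM (rootP gx) mulr0 -mul_polyC.
  rewrite rmorphM /= map_polyC hornerM hornerC => E.
  have /eqP : phi (lead_coef g) ^+ N * (map_poly phi p).[x] = 0.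
    by rewrite -[RHS]E; congr (_ * _); apply/esym/rmorphXn.
  by rewrite mulf_eq0 expf_eq0 (negPf cn) andbF /= => /eqP.
split=> //; apply: contraNneq bn => hx.
have := congr1 (fun p => (map_poly phi p).[x]) rE.
by rewrite /= rb map_polyC hornerC rmorphD rmorphM /= hornerD hornerM hx mulr0 Px // addr0 => ->.
Qed.

End ExtendPoint.

Lemma poly_has_points (k : fieldType) (A : comNzRingType) :
  GRing.closed_field_axiom k -> has_points k A -> has_points k {poly A}.
Proof.
move=> kC hA I h pI Ih; have [h' Ih' ext] := extend_point kC pI Ih.
have [phi [phi0 phih]] := hA _ _ (prime_preim (@polyC A) pI) Ih'.
have [x [x0 xh]] := ext phi phi0 phih.
have cx : commr_rmorph phi x by move=> a; apply: mulrC.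
by exists (horner_morph cx).
Qed.

(** Only finitely many elements of [L] ever matter, so [L] can be replaced by a polynomial ring with
    one variable for each of them. *)
Lemma has_points_cover (k : fieldType) (L : comNzRingType)
    (f : {rmorphism k -> L}) (xs : seq L) : GRing.closed_field_axiom k ->
  exists (A : comNzRingType) (e : {rmorphism A -> L}),
    has_points k A /\ forall x, x \in xs -> exists a, e a = x.
Proof.
move=> kC; elim: xs => [|x xs [A [e [hA eA]]]].
  by exists k, f; split=> //; apply: field_has_points.
have cx : commr_rmorph e x by move=> a; apply: mulrC.
exists {poly A}, (horner_morph cx); split; first exact: poly_has_points.
move=> y; rewrite inE => /orP[/eqP->|/eA [a <-]].
  by exists 'X; rewrite /= horner_morphX.
by exists a%:P; rewrite /= horner_morphC.
Qed.

Record strict_ideal (A : comNzRingType) (I : A -> Prop) : Prop := ProperIdeal {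
  ideal0 : I 0;
  idealD : forall x y, I x -> I y -> I (x + y);
  idealMl : forall a x, I x -> I (a * x);
  ideal1 : ~ I 1 }.

Lemma strict_ideal_sub_prime (A : comNzRingType) (I : A -> Prop) :
  strict_ideal I -> exists2 Q, prime_ideal Q & forall x, I x -> Q x.
Proof.
move=> pI.
pose P := [set S : set A | S = set0 \/ (strict_ideal S /\ I `<=` S)].
have [F FP Ftot|Q [PQ maxQ]] := @Zorn_bigcup A P.
  have [[S0 [FS0 S0n0]]|all0] := pselect (exists S, F S /\ S <> set0); last first.
    left; rewrite -subset0 => x [S FS Sx]; apply: all0; exists S; split=> //.
    by move=> S0; rewrite S0 in Sx.
  have Fp S x : F S -> S x -> strict_ideal S.
    by move=> /FP [->//|[]].
  have [E|[pS0 IS0]] := FP _ FS0; first by [].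
  right; split; last by move=> x /IS0 S0x; exists S0.
  split.
  - by exists S0 => //; apply: ideal0.
  - move=> x y [S FS Sx] [T FT Ty].
    have [ST|TS] := Ftot _ _ FS FT.
      by exists T => //; apply: (idealD (Fp _ _ FT Ty) _ Ty); apply: ST.
    by exists S => //; apply: (idealD (Fp _ _ FS Sx) Sx); apply: TS.
  - by move=> a x [S FS Sx]; exists S => //; apply: (idealMl (Fp _ _ FS Sx)).
  - by move=> [S FS S1]; apply: (ideal1 (Fp _ _ FS S1)).
have [Q0|[pQ IQ]] := PQ.
  case: (maxQ I); last by right; split.
  by rewrite Q0; split=> // /(_ 0 (ideal0 pI)).
exists Q => //; split; [exact: ideal0|exact: idealD|exact: idealMl|exact: ideal1|].
move=> x y Qxy; apply: contrapT => /not_orP[nx ny].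
pose Q' z := exists q r, Q q /\ z = q + r * x.
case: (maxQ Q').
  split; first by move=> z Qz; exists z, 0; rewrite mul0r addr0.
  move=> /(_ x) xQ; apply/nx/xQ; exists 0, 1; rewrite mul1r add0r; split=> //.
  exact: ideal0.
right; split; last by move=> z /IQ Qz; exists z, 0; rewrite mul0r addr0.
split.
- by exists 0, 0; rewrite mul0r addr0; split=> //; apply: ideal0.
- move=> _ _ [q [r [Qq ->]]] [q' [r' [Qq' ->]]]; exists (q + q'), (r + r').
  by rewrite mulrDl addrACA; split=> //; apply: idealD.
- move=> a _ [q [r [Qq ->]]]; exists (a * q), (a * r).
  by rewrite mulrDr mulrA; split=> //; apply: idealMl.
move=> [q [r [Qq E]]]; apply: ny; rewrite -[y]mul1r E mulrDl.
apply: idealD => //; first by rewrite mulrC; apply: idealMl.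
by rewrite -mulrA; apply: idealMl.
Qed.

(** Units lie in no prime ideal, so the product of the [y j] avoids the pulled-back prime and a
    point can be chosen at which it does not vanish. *)
Lemma unit_point (k : fieldType) (L : comNzRingType) (f : {rmorphism k -> L})
    (I : L -> Prop) (J : finType) (x : J -> L) :
  GRing.closed_field_axiom k -> strict_ideal I ->
  (forall j, exists y, y * x j = 1) ->
  exists (A : comNzRingType) (e : {rmorphism A -> L}) (phi : {rmorphism A -> k})
    (y : J -> A), [/\ forall j, e (y j) = x j, forall j, phi (y j) != 0 &
      forall z, I (e z) -> phi z = 0].
Proof.
move=> kC pI xu; have [Q pQ IQ] := strict_ideal_sub_prime pI.
have [A [e [hA eA]]] := has_points_cover f (codom x) kC.
have /choice[y yE] : forall j, exists a, e a = x j.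
  by move=> j; apply: eA; apply: codom_f.
have nQ : ~ Q (e (\prod_j y j)).
  rewrite rmorph_prod; apply: (big_ind (fun z => ~ Q z)) => [|a b na nb /(primeM pQ) []//|j _].
    exact: prime1.
  rewrite yE => Qx; apply: (prime1 pQ); have [z <-] := xu j.
  exact: primeMl.
have [phi [phi0 phiy]] := hA _ _ (prime_preim e pQ) nQ.
exists A, e, phi, y; split => // [j|z Iz]; last exact/phi0/IQ.
by move: phiy; rewrite rmorph_prod; apply: contraNneq => yj0; rewrite (bigD1 j) //= yj0 mul0r.
Qed.

(** * Residue map *)

Section Residue.
Variables (R : realType) (K : fieldType) (v : valuation R K).
Notation k := (residue_field v).

(** Extended by 0 outside the valuation ring, so that coefficients can be reduced without carrying
    membership proofs. *)
Definition residue (x : K) : k :=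
  if insub x is Some y then \pi_({ideal_quot (valring_max (v := v))})%qT (y : valring v) else 0.

Lemma residueE (y : valring v) :
  residue (valring_val y) = \pi_({ideal_quot (valring_max (v := v))})%qT y.
Proof. by rewrite /residue valK. Qed.

Lemma residue_lift (x : K) : (0 <= v x)%E -> exists y : valring v, x = valring_val y.
Proof. by move=> vx; exists (@ValRing _ _ v x vx). Qed.

Lemma residueD x y : (0 <= v x)%E -> (0 <= v y)%E ->
  residue (x + y) = residue x + residue y.
Proof.
move=> /residue_lift[x' ->] /residue_lift[y' ->].
rewrite -[valring_val x' + _](rmorphD (\val : valring v -> K) x' y').
by rewrite !residueE rmorphD.
Qed.

Lemma residueM x y : (0 <= v x)%E -> (0 <= v y)%E ->
  residue (x * y) = residue x * residue y.
Proof.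
move=> /residue_lift[x' ->] /residue_lift[y' ->].
rewrite -[valring_val x' * _](rmorphM (\val : valring v -> K) x' y').
by rewrite !residueE rmorphM.
Qed.

Lemma residue1 : residue 1 = 1.
Proof.
rewrite -[X in residue X](rmorph1 (\val : valring v -> K)).
by rewrite [LHS](residueE 1) rmorph1.
Qed.

Lemma residueN x : (0 <= v x)%E -> residue (- x) = - residue x.
Proof.
move=> /residue_lift[x' ->].
rewrite -[- valring_val x'](rmorphN (\val : valring v -> K) x').
by rewrite !residueE rmorphN.
Qed.

Lemma residue_eq0 x : (0 <= v x)%E -> (residue x = 0 <-> (0 < v x)%E).
Proof.
move=> /residue_lift[x' ->]; rewrite residueE.
rewrite -(rmorph0 \pi_({ideal_quot (valring_max (v := v))})%qT).
split => [/eqP|x0]; last apply/eqP.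
  by rewrite -Quotient.idealrBE subr0.
by rewrite -Quotient.idealrBE subr0.
Qed.

Lemma residue_surj (a : k) : exists2 x, (0 <= v x)%E & residue x = a.
Proof.
exists (valring_val (repr a)); last by rewrite residueE reprK.
by case: (repr a).
Qed.

Lemma valuation_ge0D x y : (0 <= v x)%E -> (0 <= v y)%E -> (0 <= v (x + y)%R)%E.
Proof. by move=> vx vy; apply: le_trans (valuationD v _ _); rewrite le_min vx vy. Qed.

Lemma valuation_ge0X x n : (0 <= v x)%E -> (0 <= v (x ^+ n)%R)%E.
Proof.
move=> vx; elim: n => [|n IHn]; first by rewrite expr0 valuation1.
by rewrite exprS valuationM adde_ge0.
Qed.

Lemma residueX x n : (0 <= v x)%E -> residue (x ^+ n) = residue x ^+ n.
Proof.
move=> vx; elim: n => [|n IHn]; first by rewrite !expr0 residue1.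
by rewrite !exprS residueM ?IHn // valuation_ge0X.
Qed.

Lemma valuation_ge0_sum (J : Type) (r : seq J) (P : pred J) (F : J -> K) :
  (forall j, P j -> (0 <= v (F j))%E) -> (0 <= v (\sum_(j <- r | P j) F j)%R)%E.
Proof.
move=> F0; apply: (big_ind (fun x => (0 <= v x)%E)) => //; first by rewrite valuation0 leey.
exact: valuation_ge0D.
Qed.

Lemma residue0 : residue 0 = 0.
Proof. by apply/residue_eq0; rewrite valuation0 ?ltry ?leey. Qed.

Lemma residue_sum (J : Type) (r : seq J) (F : J -> K) :
  (forall j, (0 <= v (F j))%E) ->
  residue (\sum_(j <- r) F j) = \sum_(j <- r) residue (F j).
Proof.
move=> F0; elim: r => [|j r IHr]; first by rewrite !big_nil residue0.
by rewrite !big_cons residueD ?IHr //; apply: valuation_ge0_sum.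
Qed.

(** Valuation rings are integrally closed: if [x] had negative value, dividing by [x ^+ n] would
    write 1 as [x^-1] times an integral element, of positive value. *)
Lemma valuation_integral n (c : nat -> K) x : (0 < n)%N ->
  (forall i, (0 <= v (c i))%E) -> x ^+ n = \sum_(i < n) c i * x ^+ i -> (0 <= v x)%E.
Proof.
move=> n0 c0 xE; rewrite leNgt; apply/negP => vx.
have x0 : x != 0 by apply: contraTneq vx => ->; rewrite valuation0.
have xV0 : (0 < v (x^-1)%R)%E.
  have [r vr] := valuation_fin v x0.
  have xV : x^-1 != 0 by rewrite invr_eq0.
  have [s vs] := valuation_fin v xV.
  have := valuationM v x x^-1; rewrite mulfV // valuation1 vr vs => -[] rs.
  by move: vx; rewrite vr !lte_fin => r0; lra.
have : (0 < v 1%R)%E; last by rewrite valuation1 ltxx.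
have -> : 1 = x^-1 * \sum_(i < n) c i * (x^-1) ^+ (n - i.+1).
  have : x ^- n * x ^+ n = 1 by rewrite mulVf // expf_neq0.
  rewrite {2}xE => <-; rewrite !mulr_sumr; apply: eq_bigr => i _.
  rewrite mulrCA [in RHS]mulrCA; congr (_ * _).
  rewrite -exprS subnSK // exprB ?unitfE ?invr_eq0 // ?(ltnW (ltn_ord i)) //.
  by rewrite !exprVn invrK.
rewrite valuationM; apply: (lt_le_trans xV0); rewrite leeDl //.
apply: valuation_ge0_sum => i _; rewrite valuationM adde_ge0 //.
by apply: valuation_ge0X; apply: ltW.
Qed.

End Residue.

(** A monic equation is lifted to the valuation ring and solved in [K]; the root is integral, hence
    has a residue. *)
Lemma residue_closed (R : realType) (K : closedFieldType) (v : valuation R K) :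
  GRing.closed_field_axiom (residue_field v).
Proof.
move=> n P n0.
have /choice[c cE] : forall i, exists x, (0 <= v x)%E /\ residue v x = P i.
  by move=> i; have [x vx xE] := residue_surj (P i); exists x.
have [x xE] := solve_monicpoly c n0.
have vc i : (0 <= v (c i))%E by case: (cE i).
have vx : (0 <= v x)%E by apply: valuation_integral xE.
exists (residue v x); rewrite -residueX // xE residue_sum; last first.
  by move=> i; rewrite valuationM adde_ge0 // valuation_ge0X.
by apply: eq_bigr => i _; rewrite residueM ?valuation_ge0X // residueX //; case: (cE i) => _ ->.
Qed.

(** * Initial forms of Laurent polynomials *)

Section LaurentFacts.
Variables (I : finType) (F : fieldType).

Lemma laurentMU (f : laurent I F) (x u : {ffun I -> int}) :
  (f * (<< x >> : laurent I F))@_u = f@_(u - x).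
Proof.
rewrite [f * _]/GRing.mul /= /laurent_mul.
under eq_bigr => y _ do rewrite msuppU oner_eq0 big_seq_fset1 mcoeffUU mulr1.
rewrite raddf_sum /= [in RHS](monalgE f) raddf_sum /=.
apply: eq_bigr => y _; rewrite !mcoeffU; congr (_ *+ nat_of_bool _).
by apply/eqP/eqP => [<-|->]; rewrite ?addrK ?subrK.
Qed.

Lemma laurentUU (x y : {ffun I -> int}) :
  (<< x >> : laurent I F) * << y >> = << x + y >>.
Proof.
apply/malgP => u; rewrite laurentMU !mcoeffU; congr (_ *+ nat_of_bool _).
by apply/eqP/eqP => [->|<-]; rewrite ?addrK ?subrK.
Qed.

Lemma lvar_unit (i : I) : exists y : laurent I F, y * lvar F i = 1.
Proof.
by exists << - [ffun j => (j == i)%:R] >>; rewrite laurentUU addNr.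
Qed.

Definition laurentC (a : F) : laurent I F := << a *g 0 >>.

Let laurentC_zmod : zmod_morphism laurentC.
Proof. by move=> a b; rewrite /laurentC monalgUB. Qed.

Let laurentC_monoid : monoid_morphism laurentC.
Proof.
split => // a b; rewrite /laurentC [in RHS]/GRing.mul /= /laurent_mul !msuppU.
have [->|a0] := eqVneq a 0; first by rewrite mul0r monalgU0 big_seq_fset0.
rewrite big_seq_fset1; have [->|b0] := eqVneq b 0.
  by rewrite mulr0 monalgU0 big_seq_fset0.
by rewrite big_seq_fset1 !mcoeffUU addr0.
Qed.

HB.instance Definition _ := GRing.isZmodMorphism.Build F (laurent I F) laurentC laurentC_zmod.
HB.instance Definition _ := GRing.isMonoidMorphism.Build F (laurent I F) laurentC laurentC_monoid.

End LaurentFacts.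

Lemma ideal_generated_proper (A : comNzRingType) (G : set A) :
  ~ ideal_generated G 1 -> strict_ideal (ideal_generated G).
Proof.
move=> G1; split => //.
- by exists 0%N, (fun _ => 0), (fun _ => 0); split=> [[]//|]; rewrite big_ord0.
- move=> _ _ [m [h [g [Gg ->]]]] [m' [h' [g' [Gg' ->]]]].
  pose cat (a : 'I_m -> A) (b : 'I_m' -> A) i :=
    match split i with inl j => a j | inr j => b j end.
  exists (m + m')%N, (cat h h'), (cat g g'); split=> [i|].
    by rewrite /cat; case: split.
  rewrite big_split_ord /=; congr (_ + _); apply: eq_bigr => i _; rewrite /cat.
    by rewrite (unsplitK (inl _ i)).
  by rewrite (unsplitK (inr _ i)).
- move=> a _ [m [h [g [Gg ->]]]]; exists m, (fun i => a * h i), g; split=> //.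
  by rewrite mulr_sumr; apply: eq_bigr => i _; rewrite mulrA.
Qed.

Lemma laurent_point (F : fieldType) (I : finType) (G : set (laurent I F)) :
  GRing.closed_field_axiom F -> ~ ideal_generated G 1 ->
  exists (A : comNzRingType) (e : {rmorphism A -> laurent I F})
    (phi : {rmorphism A -> F}) (y : I -> A),
  [/\ forall i, e (y i) = lvar F i, forall i, phi (y i) != 0 &
    forall z, G (e z) -> phi z = 0].
Proof.
move=> FC /ideal_generated_proper pG.
have [A [e [phi [y [ye y0 z0]]]]] := unit_point (@laurentC I F) FC pG (@lvar_unit I F).
exists A, e, phi, y; split => // z Gz; apply: z0.
exists 1%N, (fun _ => 1), (fun _ => e z); split=> //.
by rewrite big_ord1 mul1r.
Qed.

Section LiftRelation.
Variables (R : realType) (I : finType) (K : fieldType) (v : valuation R K).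
Variable w : {ffun I -> R}.
Notation k := (residue_field v).

Definition exp_weight (u : {ffun I -> int}) : R := \sum_i (u i)%:~R * w i.

Lemma exp_weightD u x : exp_weight (u + x) = exp_weight u + exp_weight x.
Proof.
by rewrite /exp_weight -big_split; apply: eq_bigr => i _; rewrite ffunE rmorphD mulrDl.
Qed.

Lemma exp_weightN u : exp_weight (- u) = - exp_weight u.
Proof.
by rewrite /exp_weight -sumrN; apply: eq_bigr => i _; rewrite ffunE rmorphN mulNr.
Qed.

Lemma exp_weight_delta i : exp_weight [ffun j => (j == i)%:R] = w i.
Proof.
rewrite /exp_weight (bigD1 i) //= ffunE eqxx mul1r big1 ?addr0 // => j /negPf ji.
by rewrite ffunE ji mul0r.
Qed.

(* [h] is only constrained in weight [c]: its other coefficients are irrelevant. *)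
Definition reduces_to (c : R) (f : laurent I K) (h : laurent I k) : Prop :=
  forall u, [/\ exp_weight u < c -> f@_u = 0, (0 <= v (f@_u))%E &
    exp_weight u = c -> residue v f@_u = h@_u].

Lemma reduces_to0 c : reduces_to c 0 0.
Proof. by move=> u; rewrite !mcoeff0 valuation0 residue0 leey. Qed.

Lemma reduces_toD c f h f' h' :
  reduces_to c f h -> reduces_to c f' h' -> reduces_to c (f + f') (h + h').
Proof.
move=> fh fh' u; have [f0 vf rf] := fh u; have [f0' vf' rf'] := fh' u.
rewrite !mcoeffD; split=> [uc||uc].
- by rewrite f0 // f0' // addr0.
- exact: valuation_ge0D.
- by rewrite residueD // rf // rf'.
Qed.

Lemma reduces_toN c f h : reduces_to c f h -> reduces_to c (- f) (- h).
Proof.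
move=> fh u; have [f0 vf rf] := fh u; rewrite !mcoeffN; split=> [uc||uc].
- by rewrite f0 // oppr0.
- by rewrite valuationN.
- by rewrite residueN // rf.
Qed.

Lemma reduces_toM c f h x : reduces_to c f h ->
  reduces_to (c + exp_weight x) (f * << x >>) (h * << x >>).
Proof.
move=> fh u; have [f0 vf rf] := fh (u - x); rewrite !laurentMU.
rewrite exp_weightD exp_weightN in f0 rf; split=> [uc||uc] //.
- by rewrite f0 // ltrBlDr.
- by rewrite rf // uc addrK.
Qed.

(** Nothing of [f] lies below weight [c]. This is how the nonminimal products of a relation drop out
    of its initial form. *)
Lemma reduces_to_lt c c' f h : reduces_to c f h -> c' < c -> reduces_to c' f 0.
Proof.
move=> fh cc u; have [f0 vf rf] := fh u; split=> [uc||uc] //.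
- by rewrite f0 // (lt_trans uc).
- by rewrite f0 ?uc // residue0 mcoeff0.
Qed.

Lemma reduces_to_lift c (h : laurent I k) : exists f, reduces_to c f h.
Proof.
rewrite [h]monalgE; elim: (X in \sum_(_ <- X) _) => [|u s [f IHf]].
  by rewrite big_nil; exists 0; apply: reduces_to0.
rewrite big_cons.
suff [g gu] : exists g, reduces_to c g << h@_u *g u >>.
  by exists (g + f); apply: reduces_toD.
(* Monomials of any other weight are lifted to 0: this is the passage to a homogeneous component. *)
have [uc|uc] := eqVneq (exp_weight u) c; last first.
  exists 0 => x; rewrite mcoeff0 valuation0 leey; split=> // xc.
  rewrite residue0 mcoeffU; case: eqP => // ux.
  by rewrite ux xc eqxx in uc.
have [a va ra] := residue_surj (v := v) (h@_u).
exists << a *g u >> => x; rewrite !mcoeffU; case: eqP => [<-|_].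
  by rewrite uc ltxx !mulr1n.
by rewrite !mulr0n valuation0 residue0 leey.
Qed.

(** The constant term has weight 0. Any other term has either a positive exponent weight and an
    integral coefficient, or exponent weight 0 and a coefficient of positive valuation; the minimum
    is attained once. *)
Lemma reduces_to1_notin_trop f : reduces_to 0 f 1 -> ~ trop v f w.
Proof.
move=> fr; have wt0 : exp_weight 0 = 0.
  by apply/eqP; rewrite -(inj_eq (addrI (exp_weight 0))) -exp_weightD !addr0.
have coef1 u : (1 : laurent I k)@_u = (0 == u)%:R by rewrite [LHS]mcoeffU.
have v0 : v f@_0 = 0%E.
  have [_ vf] := fr 0; rewrite wt0 coef1 eqxx => /(_ erefl) r1.
  apply/eqP; rewrite eq_le vf andbT leNgt; apply/negP.
  by rewrite -(residue_eq0 vf) r1 => /eqP; rewrite oner_eq0.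
have tw0 : term_weight v f w 0 = 0%E.
  by rewrite /term_weight v0 -/(exp_weight 0) wt0 adde0.
have f0 : f@_0 != 0 by apply: contra_eq_neq v0 => ->; rewrite valuation0.
have twp u : u \in msupp f -> u != 0 -> (0 < term_weight v f w u)%E.
  rewrite -mcoeff_neq0 => fu un0; rewrite /term_weight -/(exp_weight u).
  have [fl vf re] := fr u; have [uc|uc|uc] := ltgtP (exp_weight u) 0.
  - by rewrite fl // eqxx in fu.
  - by apply: (@lt_le_trans _ _ (exp_weight u)%:E); rewrite ?lte_fin // leeDr.
  - rewrite uc adde0; apply/residue_eq0 => //.
    by rewrite re // coef1 eq_sym (negPf un0).
case=> [E|[u1 [u2 [f1 f2 u12 e12 min1]]]].
  by rewrite E mcoeff0 eqxx in f0.
have := min1 0; rewrite tw0 -mcoeff_neq0 => /(_ f0); rewrite leNgt => /negP min0.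
have u10 : u1 = 0 by apply/eqP; apply: contraT => /(twp _ f1)/min0.
have u20 : u2 = 0 by apply/eqP; apply: contraT => /(twp _ f2); rewrite -e12 => /min0.
by rewrite u10 u20 eqxx in u12.
Qed.

End LiftRelation.

(** * Torus points *)

Section Coordinates.
Variables (n : nat) (M : matroid n).
Implicit Types (s t S : {set 'I_n}).

(** For torus points 0 is the intended value off the bases. For weights it is a mere default where
    +oo would be meant, so inequalities between weights are guarded by membership in [bases M]. *)
Definition coord_ext (A : nmodType) (x : matroid_basis M -> A) s : A :=
  if insub s is Some b then x b else 0.

Lemma coord_ext_val (A : nmodType) (x : matroid_basis M -> A) b :
  coord_ext x (val b) = x b.
Proof. by rewrite /coord_ext valK. Qed.

Lemma coord_ext_out (A : nmodType) (x : matroid_basis M -> A) s :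
  s \notin bases M -> coord_ext x s = 0.
Proof. by move=> sM; rewrite /coord_ext insubF //; apply/negbTE. Qed.

Lemma coord_ext_in (A : nmodType) (x : matroid_basis M -> A) s (sM : s \in bases M) :
  coord_ext x s = x (exist _ s sM).
Proof. exact: (coord_ext_val x (exist _ s sM)). Qed.

(** The mask selects the products that are kept: a constant [true] gives the relation itself,
    [weight_mask] its initial form. *)
Definition three_term_mask (A : comNzRingType) (x : {set 'I_n} -> A)
    (m : {set 'I_n} -> {set 'I_n} -> bool) S i j k l : A :=
  let T a b c d := x (S :|: [set a; b]%SET) * x (S :|: [set c; d]%SET)
    *+ m (S :|: [set a; b]%SET) (S :|: [set c; d]%SET) in
  T i j k l - T i k j l + T i l j k.

Definition sorted_quad S (i j k l : 'I_n) : bool :=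
  [&& (#|S| + 2 == rank M)%N, (i < j < k)%N && (k < l)%N &
    [&& i \notin S, j \notin S, k \notin S & l \notin S]].

Variables (R : realType).
Implicit Types (f : {set 'I_n} -> R).

Definition weight_ge f (c : R) s t :=
  s \in bases M -> t \in bases M -> c <= f s + f t.

(** Here [c] is a lower bound, not necessarily the minimum: if no pair of bases attains it, the
    masked relation is 0 and imposes nothing. *)
Definition three_term_ge f (c : R) S i j k l :=
  let P a b d e := weight_ge f c (S :|: [set a; b]%SET) (S :|: [set d; e]%SET) in
  [/\ P i j k l, P i k j l & P i l j k].

Definition weight_mask f (c : R) s t := f s + f t == c.

Lemma three_term_mask_rmorph (A B : comNzRingType) (e : {rmorphism A -> B})
    (x : matroid_basis M -> A) (y : matroid_basis M -> B) m S i j k l :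
  (forall b, e (x b) = y b) ->
  e (three_term_mask (coord_ext x) m S i j k l) =
  three_term_mask (coord_ext y) m S i j k l.
Proof.
move=> xy; have ext s : e (coord_ext x s) = coord_ext y s.
  by rewrite /coord_ext; case: insub => [b|]; rewrite ?xy ?rmorph0.
by rewrite /three_term_mask rmorphD rmorphB !rmorphMn !rmorphM !ext.
Qed.

(* A point of the torus at which the initial forms with respect to [f] of all
   three-term relations vanish. *)
Definition initial_point (k : fieldType) f (a : matroid_basis M -> k) : Prop :=
  (forall b, a b != 0) /\
  forall S i j k l c, sorted_quad S i j k l -> three_term_ge f c S i j k l ->
    three_term_mask (coord_ext a) (weight_mask f c) S i j k l = 0.

Lemma Gr_initial_point (K : closedFieldType) (v : valuation R K) w :
  Gr M v w -> exists a : matroid_basis M -> residue_field v,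
    initial_point (coord_ext w) a.
Proof.
move=> wGr; pose f := coord_ext w.
pose G : set (laurent (matroid_basis M) (residue_field v)) :=
  [set g | exists S i j k l c, [/\ sorted_quad S i j k l,
    three_term_ge f c S i j k l &
    g = three_term_mask (coord_ext (lvar _)) (weight_mask f c) S i j k l]].
suff G1 : ~ ideal_generated G 1.
  have [A [e [phi [y [ye y0 yG]]]]] := laurent_point (@residue_closed R K v) G1.
  exists (fun b => phi (y b)); split=> // S i j k l c qS cS.
  rewrite -(three_term_mask_rmorph (e := phi) (x := y)) //; apply: yG.
  by exists S, i, j, k, l, c; split=> //; apply: three_term_mask_rmorph.
case=> m [h [g [Gg hg]]].
(* The multiplier starts in weight [- c] and products of bases have weight at least [c], so
   everything lands in weight at least 0; products heavier than [c] leave no trace in weight 0. *)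
have term (c : R) H (hh : laurent (matroid_basis M) (residue_field v)) s t :
    reduces_to w (- c) H hh -> weight_ge f c s t ->
    reduces_to w 0 (H * (pluecker_coord M K s * pluecker_coord M K t))
      (hh * (coord_ext (lvar (residue_field v)) s * coord_ext (lvar _) t
        *+ weight_mask f c s t)).
  move=> Hh; rewrite /weight_ge /weight_mask /f /pluecker_coord /coord_ext.
  case: insubP => [b sM <-|_]; last first.
    by rewrite !mul0r mul0rn !mulr0 => _; apply: reduces_to0.
  case: insubP => [b' tM <-|_]; last first.
    by rewrite !mulr0 mul0rn !mulr0 => _; apply: reduces_to0.
  move=> /(_ (valP _) (valP _)) cw.
  rewrite [lvar K b * _]laurentUU [lvar _ b * _]laurentUU.
  have /= := reduces_toM ([ffun j => (j == b)%:R] + [ffun j => (j == b')%:R]) Hh.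
  rewrite exp_weightD !exp_weight_delta addrC => HM.
  have [cE|cN] := eqVneq (w b + w b') c.
    by rewrite cE subrr in HM; rewrite mulr1n.
  rewrite mulr0n mulr0; apply: reduces_to_lt HM _.
  by rewrite subr_gt0 lt_neqAle eq_sym cN.
have /choice[T TE] : forall r, exists T : laurent (matroid_basis M) K * laurent (matroid_basis M) K,
    relations M K T.2 /\ reduces_to w 0 (T.1 * T.2) (h r * g r).
  move=> r; have [S [i [j [k [l [c [qS [c1 c2 c3] ->]]]]]]] := Gg r.
  have [H Hh] := reduces_to_lift (v := v) w (- c) (h r).
  exists (H, three_term M K S i j k l); split=> /=.
    by case/and3P: qS => /eqP *; exists S, i, j, k, l.
  rewrite /three_term_mask /three_term !mulrDr !mulrN.
  by apply: reduces_toD; [apply: reduces_toD; last apply: reduces_toN|]; apply: term.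
apply: (reduces_to1_notin_trop (v := v) (w := w) (f := \sum_r (T r).1 * (T r).2)).
  rewrite hg; elim: (index_enum _) => [|r rs IHrs].
    by rewrite !big_nil; apply: reduces_to0.
  by rewrite !big_cons; apply: reduces_toD => //; case: (TE r).
apply: wGr; exists m, (fun r => (T r).1), (fun r => (T r).2); split=> // r.
by case: (TE r).
Qed.

(** The same argument over [K] without initial forms: 1 is a monomial, so its presence in the
    relation ideal would empty [Gr]. This is what ties [Gr] to realizability over [K]. *)
Lemma Gr_torus_point (K : closedFieldType) (v : valuation R K) w :
  Gr M v w -> exists a : matroid_basis M -> K, (forall b, a b != 0) /\
    forall S i j k l, sorted_quad S i j k l ->
      three_term_mask (coord_ext a) (fun _ _ => true) S i j k l = 0.
Proof.
move=> wGr; have I1 : ~ ideal_generated (relations M K) 1.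
  move=> /wGr[/eqP|[u1 [u2 []]]]; first by rewrite oner_eq0.
  by rewrite !msuppU oner_eq0 !inE => /eqP -> /eqP ->; rewrite eqxx.
have KC : GRing.closed_field_axiom K by move=> m P m0; apply: solve_monicpoly.
have [A [e [phi [y [ye y0 yG]]]]] := laurent_point KC I1.
exists (fun b => phi (y b)); split=> // S i j k l /and3P[/eqP cS qS nS].
rewrite -(three_term_mask_rmorph (e := phi) (x := y)) //; apply: yG.
by exists S, i, j, k, l; split=> //; apply: (three_term_mask_rmorph (y := lvar K)).
Qed.

End Coordinates.

(** * Local and global exchange *)

Section Exchange.
Variables (n : nat) (M : matroid n).
Implicit Types (s t S : {set 'I_n}).

Definition swap s (x y : 'I_n) : {set 'I_n} := y |: (s :\ x).

Lemma in_swap s x y z : (z \in swap s x y) = (z == y) || (z != x) && (z \in s).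
Proof. by rewrite !inE. Qed.

Lemma basis_card_eq s t : s \in bases M -> t \in bases M -> #|s :\: t| = #|t :\: s|.
Proof.
move=> sM tM; have := cardsID t s; have := cardsID s t.
by rewrite (finset.setIC t s) (bases_card sM) (bases_card tM); lia.
Qed.

(** Here the entering element is prescribed instead of the leaving one. Replace some [v] of [t] by
    [u] from [s], apply induction to bring in [x] at the expense of some [v1], then exchange [u]
    back against [t]: what returns is [v] or [v1], and the other one is the element sought. *)
Lemma bases_coexchange s t x : s \in bases M -> t \in bases M ->
  x \in s :\: t -> exists2 y, y \in t :\: s & swap t y x \in bases M.
Proof.
move=> sM; have [m] := ubnP #|t :\: s|; elim: m t => // m IHm t.
rewrite ltnS => tm tM; rewrite inE => /andP[xt xs].
have [v vt] : exists v, v \in t :\: s.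
  apply/set0Pn; rewrite -card_gt0 -basis_card_eq // card_gt0; apply/set0Pn.
  by exists x; rewrite inE xt.
have [u us] := bases_exchange tM sM vt; rewrite -/(swap t v u) => t1M.
have [<-|xu] := eqVneq u x; first by exists v.
move: vt us; rewrite !inE => /andP[vs vt] /andP[ut us].
have [||v1] := IHm (swap t v u) _ t1M.
- apply: leq_trans tm; apply: proper_card; apply/properP; split.
    apply/fintype.subsetP => z; rewrite inE in_swap inE => /andP[zs /orP[/eqP zu|/andP[_ ->]]] //.
      by rewrite zu us in zs.
    by rewrite zs.
  by exists v; rewrite ?inE ?vs // eqxx /= orbF; apply: contraNneq vs => ->.
- by rewrite inE in_swap negb_or eq_sym xu negb_and xt orbT.
rewrite inE in_swap => /andP[v1s /orP[/eqP E|/andP[v1v v1t]]].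
  by rewrite E us in v1s.
move=> t2M; set t2 := swap _ v1 x in t2M.
have uv1 : u != v1 by apply: contraNneq v1s => <-.
have ut2 : u \in t2 :\: t by rewrite inE ut /t2 in_swap uv1 in_swap eqxx orbT.
have [y yt] := bases_exchange t2M tM ut2; rewrite -/(swap t2 u y) => t3M.
have ux : x != u by rewrite eq_sym.
have vv1 : v != v1 by rewrite eq_sym.
have xv : x != v by apply: contraNneq xt => ->.
have xv1 : x != v1 by apply: contraNneq xt => ->.
have : (y == v) || (y == v1).
  move: yt; rewrite inE in_swap negb_or negb_and negbK.
  move=> /andP[/andP[_ /orP[->|]]]; first by rewrite orbT.
  rewrite in_swap negb_or negb_and negbK => /andP[_ /orP[->//|/negP]].
  by [].
case/orP=> /eqP yE.
  exists v1; first by rewrite inE v1s.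
  suff -> : swap t v1 x = swap t2 u y by [].
  apply/setP => z; rewrite yE /t2 !in_swap.
  have [->|] := eqVneq z x; first by rewrite ux orbT.
  have [->|] := eqVneq z v; first by rewrite vt vv1.
  by have [->|] := eqVneq z u; rewrite ?(negPf ut) ?andbF.
exists v; first by rewrite inE vs.
suff -> : swap t v x = swap t2 u y by [].
apply/setP => z; rewrite yE /t2 !in_swap.
have [->|] := eqVneq z x; first by rewrite ux orbT.
have [->|] := eqVneq z v1; first by rewrite v1t v1v.
by have [->|] := eqVneq z u; rewrite ?(negPf ut) ?andbF.
Qed.

Variable R : realType.
Implicit Types (f : {set 'I_n} -> R) (p : 'I_n -> R).

(** Over the three pairings of [i], [j], [k], [l] together, this says that the least sum over pairs
    of bases is attained at least twice, or that no pairing consists of bases. *)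
Definition exchange_at f S i j k l : Prop :=
  let B a b := S :|: [set a; b]%SET in
  B i j \in bases M -> B k l \in bases M ->
  [/\ B i k \in bases M, B j l \in bases M & f (B i k) + f (B j l) <= f (B i j) + f (B k l)] \/
  [/\ B i l \in bases M, B j k \in bases M & f (B i l) + f (B j k) <= f (B i j) + f (B k l)].

Definition local_exchange f : Prop := forall S i j k l, uniq [:: i; j; k; l] ->
  [&& i \notin S, j \notin S, k \notin S & l \notin S] -> exchange_at f S i j k l.

Lemma exchange_at_swapl f S i j k l : exchange_at f S i j k l -> exchange_at f S j i k l.
Proof.
rewrite /exchange_at (finset.setUC [set j] [set i]) => E ij kl.
case: (E ij kl) => [] [? ? ?]; [right|left]; split=> //;
by rewrite [X in X <= _]addrC.
Qed.

Lemma exchange_at_swapr f S i j k l : exchange_at f S i j k l -> exchange_at f S i j l k.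
Proof.
rewrite /exchange_at (finset.setUC [set l] [set k]) => E ij kl.
by case: (E ij kl) => [] [? ? ?]; [right|left].
Qed.

Lemma exchange_at_swaplr f S i j k l : exchange_at f S i j k l -> exchange_at f S k l i j.
Proof.
have BC a b : S :|: [set a; b]%SET = S :|: [set b; a]%SET by rewrite (finset.setUC [set a]).
rewrite /exchange_at => E kl ij; rewrite [f (_ :|: [set k; l]%SET) + _]addrC.
rewrite (BC k i) (BC l j) (BC k j) (BC l i).
case: (E ij kl) => [] [? ? ?]; [left|right]; split=> //.
by rewrite [X in X <= _]addrC.
Qed.

(** Relations exist for increasing indices only; the symmetries of [exchange_at] reduce every order
    to one of the three pairings of a sorted quadruple. *)
Lemma exchange_at_sort f S :
  (forall i j k l : 'I_n, (i < j < k)%N -> (k < l)%N ->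
     [&& i \notin S, j \notin S, k \notin S & l \notin S] ->
     [/\ exchange_at f S i j k l, exchange_at f S i k j l & exchange_at f S i l j k]) ->
  forall i j k l, uniq [:: i; j; k; l] ->
     [&& i \notin S, j \notin S, k \notin S & l \notin S] -> exchange_at f S i j k l.
Proof.
move=> sorted i j k l; wlog ij : i j / (i < j)%N => [hw|].
  move=> u nS; have [ij|] := ltnP i j; first exact: hw.
  rewrite leq_eqVlt => /orP[/eqP/val_inj E|ji]; first by rewrite E /= inE eqxx in u.
  apply/exchange_at_swapl/hw => //; first by move: u; rewrite /= !inE !negb_or -!val_eqE /=; lia.
  by case/and4P: nS => -> -> -> ->.
wlog kl : k l / (k < l)%N => [hw|].
  move=> u nS; have [kl|] := ltnP k l; first exact: hw.
  rewrite leq_eqVlt => /orP[/eqP/val_inj E|lk]; first by move: u; rewrite E /= !inE eqxx !andbF.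
  apply/exchange_at_swapr/hw => //; first by move: u; rewrite /= !inE !negb_or -!val_eqE /=; lia.
  by case/and4P: nS => -> -> -> ->.
wlog ik : i j k l ij kl / (i < k)%N => [hw|].
  move=> u nS; have [ik|] := ltnP i k; first exact: hw.
  rewrite leq_eqVlt => /orP[/eqP/val_inj E|ki]; first by move: u; rewrite E /= !inE eqxx !orbT.
  apply/exchange_at_swaplr/hw => //; first by move: u; rewrite /= !inE !negb_or -!val_eqE /=; lia.
  by case/and4P: nS => -> -> -> ->.
move=> u /and4P[iS jS kS lS].
have [jk|kj|jk] := ltngtP j k; last by move: u; rewrite (val_inj jk) /= !inE eqxx !andbF.
  by have := sorted i j k l; rewrite ij jk kl iS jS kS lS => /(_ erefl erefl erefl) [].
have [jl|lj|jl] := ltngtP j l; last by move: u; rewrite (val_inj jl) /= !inE eqxx !orbT !andbF.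
  by have := sorted i k j l; rewrite ik kj jl iS jS kS lS => /(_ erefl erefl erefl) [].
by have := sorted i k l j; rewrite ik kl lj iS jS kS lS => /(_ erefl erefl erefl) [].
Qed.

Section Valuated.
Variable f : {set 'I_n} -> R.
Hypothesis fLE : local_exchange f.

(** All three sums change by the same amount, twice the total of [p] on [S] plus its values at [i],
    [j], [k], [l]. *)
Lemma local_exchange_twist p : local_exchange (fun s => f s + \sum_(i in s) p i).
Proof.
move=> S i j k l u /and4P[iS jS kS lS].
have sumE a b : a \notin S -> b \notin S -> a != b ->
    \sum_(x in S :|: [set a; b]%SET) p x = \sum_(x in S) p x + (p a + p b).
  move=> aS bS ab; rewrite finset.setUA finset.setUC big_setU1 /=; last first.
    by rewrite !inE negb_or bS eq_sym.
  by rewrite finset.setUC big_setU1 //=; lra.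
move: (u); rewrite /= !inE !negb_or -!andbA => /and5P[ij ik il jk /and3P[jl kl _]].
rewrite /exchange_at => ijM klM.
rewrite !sumE //.
have [|[? ? ?]|[? ? ?]] := fLE u _ ijM klM; first by rewrite iS jS kS lS.
  by left; split=> //; lra.
by right; split=> //; lra.
Qed.

Lemma sum_swap p s x y : x \in s -> y \notin s ->
  \sum_(i in swap s x y) p i = \sum_(i in s) p i - p x + p y.
Proof.
move=> xs ys; rewrite big_setU1 /=; last by rewrite !inE negb_and ys orbT.
by rewrite (big_setD1 x xs) /=; lra.
Qed.

(* Murota, Matrices and Matroids for Systems Analysis, Theorem 5.2.25: in a
   counterexample at minimal distance, the potential [p] makes all exchanges
   with [u] strictly increase the value at [B2], and moving [B2] one step towards
   [B1] gives a closer counterexample. *)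
Lemma valuated_exchange B1 B2 u : B1 \in bases M -> B2 \in bases M ->
  u \in B1 :\: B2 -> exists v, [/\ v \in B2 :\: B1, swap B1 u v \in bases M,
    swap B2 v u \in bases M & f (swap B1 u v) + f (swap B2 v u) <= f B1 + f B2].
Proof.
have [m] := ubnP #|B2 :\: B1|; elim: m B2 => // m IHm B2.
rewrite ltnS => B2m B1M B2M uB; apply: contrapT => nex.
have fail v : v \in B2 :\: B1 -> swap B1 u v \in bases M -> swap B2 v u \in bases M ->
    f B1 + f B2 < f (swap B1 u v) + f (swap B2 v u).
  by move=> vB m1 m2; rewrite ltNge; apply/negP => le; apply: nex; exists v.
move: (uB); rewrite inE => /andP[uB2 uB1].
(* If [u] were the only element of [B1 :\: B2], exchanging it would just interchange the two
   bases. *)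
have [u0 u0B u0u] : exists2 u0, u0 \in B1 :\: B2 & u0 != u.
  apply: contrapT => nu0; have B12 : B1 :\: B2 = [set u]%SET.
    apply/setP => z; rewrite [RHS]inE; apply/idP/eqP => [zB|->//].
    by apply: contrapT => /eqP zu; apply: nu0; exists z.
  have /eqP/cards1P[v B21] : #|B2 :\: B1| = 1%N by rewrite -basis_card_eq // B12 cards1.
  have vB : v \in B2 :\: B1 by rewrite B21 inE.
  have vuB : (v \in B2) && (v \notin B1) by move: vB; rewrite inE andbC.
  have B12E z : (z \in B1) && (z \notin B2) = (z == u).
    by have /setP/(_ z) := B12; rewrite !inE andbC.
  have B21E z : (z \in B2) && (z \notin B1) = (z == v).
    by have /setP/(_ z) := B21; rewrite !inE andbC.
  apply: nex; exists v; have -> : swap B1 u v = B2.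
    apply/setP => z; rewrite in_swap -B12E -B21E.
    by case: (z \in B1); case: (z \in B2).
  have -> : swap B2 v u = B1.
    apply/setP => z; rewrite in_swap -B12E -B21E.
    by case: (z \in B1); case: (z \in B2).
  by split=> //; rewrite addrC.
(* The first value makes [swap B1 u v] tie with [B1] under [g]; the second, chosen when that set is
   no basis, puts [swap B2 v u] exactly 1 above [B2]. *)
pose p v := if v \in B2 :\: B1 then
    if swap B1 u v \in bases M then f B1 - f (swap B1 u v)
    else f (swap B2 v u) - f B2 - 1 else 0.
pose g s := f s + \sum_(i in s) p i.
have gLE : local_exchange g := local_exchange_twist p.
have p0 v : v \in B1 -> p v = 0 by rewrite /p inE => ->.
have gB1 v : v \in B2 :\: B1 -> swap B1 u v \in bases M -> g (swap B1 u v) = g B1.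
  move=> vB vM; have [vB1 _] : v \notin B1 /\ v \in B2 by move: vB; rewrite inE => /andP.
  have pv : p v = f B1 - f (swap B1 u v) by rewrite /p vB vM.
  by rewrite /g sum_swap // (p0 u) // pv; lra.
have gB2 v : v \in B2 :\: B1 -> swap B2 v u \in bases M -> g B2 < g (swap B2 v u).
  move=> vB vM; have [_ vB2] : v \notin B1 /\ v \in B2 by move: vB; rewrite inE => /andP.
  have pv : p v = if swap B1 u v \in bases M then f B1 - f (swap B1 u v)
    else f (swap B2 v u) - f B2 - 1 by rewrite /p vB.
  rewrite /g sum_swap // (p0 u) // pv.
  by case: ifP => [v1M|_]; first have := fail v vB v1M vM; lra.
have [v1 v1B v1M] := bases_coexchange B1M B2M u0B.
pose P v := (v \in B2 :\: B1) && (swap B2 v u0 \in bases M).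
have Pv1 : P v1 by rewrite /P v1B.
(* Among the steps of [B2] towards [B1] that bring in [u0], one of least [g] is taken; this
   minimality is needed in the final comparison. *)
have [v0 /andP[v0B v0M] v0min] := Order.TotalTheory.arg_minP (fun v => g (swap B2 v u0)) Pv1.
move: (u0B) (v0B); rewrite !inE => /andP[u0B2 u0B1] /andP[v0B1 v0B2].
have uB3 : u \in B1 :\: swap B2 v0 u0.
  by rewrite inE uB1 in_swap eq_sym (negPf u0u) (negPf uB2) andbF.
have [|v [vB3 v1M' TM le]] := IHm (swap B2 v0 u0) _ B1M v0M uB3.
  apply: leq_trans B2m; apply: proper_card; apply/properP; split.
    apply/fintype.subsetP => z; rewrite inE in_swap inE.
    case/andP=> zB1 /orP[/eqP zu0|/andP[_ ->]]; last by rewrite zB1.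
    by rewrite zu0 u0B1 in zB1.
  exists v0 => //; rewrite inE negb_and in_swap eqxx /= orbF; apply/orP; right.
  by apply: contraNneq v0B1 => ->.
have [vB1 vB2 vv0] : [/\ v \notin B1, v \in B2 & v != v0].
  move: vB3; rewrite inE in_swap => /andP[vB1 /orP[/eqP E|/andP[vv0 vB2]]] //.
  by rewrite E u0B1 in vB1.
have vB : v \in B2 :\: B1 by rewrite inE vB1.
have vu0 : v != u0 by apply: contraNneq vB1 => ->.
have gT : g (swap (swap B2 v0 u0) v u) <= g (swap B2 v0 u0).
  have vB3' : v \in swap B2 v0 u0 by rewrite in_swap vB2 vv0 orbT.
  have uB3' : u \notin swap B2 v0 u0.
    by rewrite in_swap eq_sym (negPf u0u) (negPf uB2) andbF.
  have := gB1 v vB v1M'.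
  rewrite /g (sum_swap _ uB1 vB1) (sum_swap _ vB3' uB3') (sum_swap _ v0B2 u0B2).
  by move: le; lra.
pose S := B2 :\ v0 :\ v.
have v0u0 : v0 != u0 by apply: contraNneq v0B1 => ->.
have v0u : v0 != u by apply: contraNneq v0B1 => ->.
have vu : v != u by apply: contraNneq vB1 => ->.
have uq : uniq [:: v0; v; u0; u].
  by rewrite /= !inE !negb_or (eq_sym v0 v) vv0 vu0 u0u v0u0 v0u vu.
have nS : [&& v0 \notin S, v \notin S, u0 \notin S & u \notin S].
  by rewrite /S !inE !eqxx (negPf u0B2) (negPf uB2) /= !andbF.
have D := (negPf vv0, negPf u0u, negPf vu0, negPf v0u0, negPf v0u, negPf vu,
  etrans (eq_sym _ _) (negPf vv0), etrans (eq_sym _ _) (negPf u0u),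
  etrans (eq_sym _ _) (negPf vu0), etrans (eq_sym _ _) (negPf v0u0),
  etrans (eq_sym _ _) (negPf v0u), etrans (eq_sym _ _) (negPf vu),
  v0B2, vB2, negPf u0B2, negPf uB2).
have setE (A B : {set 'I_n}) : (v0 \in A) = (v0 \in B) -> (v \in A) = (v \in B) ->
    (u0 \in A) = (u0 \in B) -> (u \in A) = (u \in B) ->
    (forall z, z != v0 -> z != v -> z != u0 -> z != u -> (z \in A) = (z \in B)) -> A = B.
  move=> e1 e2 e3 e4 e5; apply/setP => z.
  have [->//|z1] := eqVneq z v0; have [->//|z2] := eqVneq z v.
  by have [->//|z3] := eqVneq z u0; have [->//|z4] := eqVneq z u; apply: e5.
(* The base pair is [B2] and the double exchange. Each alternative pairs a basis [B2] with [u]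
   brought in, strictly above [B2], with one having [u0] brought in, at least as high as the double
   exchange by [v0min] and [gT]. Both are impossible. *)
have := gLE _ _ _ _ _ uq nS; rewrite /exchange_at.
have -> : S :|: [set v0; v]%SET = B2.
  by apply: setE => [||||z /negPf z1 /negPf z2 /negPf z3 /negPf z4];
    rewrite !(inE, in_swap) ?eqxx ?D ?z1 ?z2 ?z3 ?z4 /= ?orbF.
have -> : S :|: [set u0; u]%SET = swap (swap B2 v0 u0) v u.
  by apply: setE => [||||z /negPf z1 /negPf z2 /negPf z3 /negPf z4];
    rewrite !(inE, in_swap) ?eqxx ?D ?z1 ?z2 ?z3 ?z4 /= ?orbF.
have -> : S :|: [set v0; u0]%SET = swap B2 v u0.
  by apply: setE => [||||z /negPf z1 /negPf z2 /negPf z3 /negPf z4];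
    rewrite !(inE, in_swap) ?eqxx ?D ?z1 ?z2 ?z3 ?z4 /= ?orbF.
have -> : S :|: [set v; u]%SET = swap B2 v0 u.
  by apply: setE => [||||z /negPf z1 /negPf z2 /negPf z3 /negPf z4];
    rewrite !(inE, in_swap) ?eqxx ?D ?z1 ?z2 ?z3 ?z4 /= ?orbF.
have -> : S :|: [set v0; u]%SET = swap B2 v u.
  by apply: setE => [||||z /negPf z1 /negPf z2 /negPf z3 /negPf z4];
    rewrite !(inE, in_swap) ?eqxx ?D ?z1 ?z2 ?z3 ?z4 /= ?orbF.
have -> : S :|: [set v; u0]%SET = swap B2 v0 u0.
  by apply: setE => [||||z /negPf z1 /negPf z2 /negPf z3 /negPf z4];
    rewrite !(inE, in_swap) ?eqxx ?D ?z1 ?z2 ?z3 ?z4 /= ?orbF.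
case=> // [] [m1 m2 le2].
  have := gB2 v0 v0B m2; have := v0min v; rewrite /P vB m1 => /(_ erefl).
  by move: le2 gT; lra.
by have := gB2 v vB m1; move: le2 gT; lra.
Qed.

Definition argmin_bases f' : {set {set 'I_n}} :=
  [set s in bases M | [forall t in bases M, f' s <= f' t]]%SET.

Lemma argmin_basesP f' s : reflect (s \in bases M /\ forall t, t \in bases M -> f' s <= f' t)
  (s \in argmin_bases f').
Proof.
rewrite inE; apply: (iffP andP) => -[sM]; last by move=> mi; split=> //; apply/forall_inP.
by move/forall_inP.
Qed.

(** Exchange between two minimizers does not raise the sum of the values, so both resulting bases
    are minimizers again. *)
Lemma argmin_matroid : exists N : matroid n, rank N = rank M /\ bases N = argmin_bases f.
Proof.
have [s0 s0M] : exists s, s \in bases M by apply/set0Pn; exact: bases_neq0.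
have neq0 : argmin_bases f != finset.set0.
  have [s sM smin] := Order.TotalTheory.arg_minP f s0M.
  by apply/set0Pn; exists s; apply/argmin_basesP.
have card s : s \in argmin_bases f -> #|s| = rank M.
  by move=> /argmin_basesP[/bases_card].
have exch s t : s \in argmin_bases f -> t \in argmin_bases f ->
    forall x, x \in s :\: t -> exists2 y, y \in t :\: s & y |: (s :\ x) \in argmin_bases f.
  move=> /argmin_basesP[sM smin] /argmin_basesP[tM tmin] x xs.
  have [y [yt sxy tyx le]] := valuated_exchange sM tM xs.
  exists y => //; apply/argmin_basesP; split=> // r rM.
  by have := smin r rM; have := tmin _ tyx; move: le; rewrite /swap; lra.
by exists (Matroid neq0 card exch).
Qed.

End Valuated.
End Exchange.

(** * Cells of regular subdivisions *)

Section Hulls.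
Variables (R : realType) (n : nat).
Implicit Types (T : {set {set 'I_n}}) (s : {set 'I_n}).

(** Weights range over all subsets and vanish off [T], so that hulls for different matroids can be
    compared without changing the index type. *)
Definition hull T : set 'rV[R]_n := [set y | exists t : {set 'I_n} -> R,
  [/\ forall s, 0 <= t s, forall s, s \notin T -> t s = 0, \sum_s t s = 1 &
      y = \sum_s t s *: evec R s]].

Lemma evecE s i : evec R s 0 i = (i \in s)%:R.
Proof.
rewrite /evec summxE; under eq_bigr => j _ do rewrite mxE eqxx /= eq_sym.
have [si|si] := boolP (i \in s).
  by rewrite (bigD1 i) //= eqxx big1 ?addr0 // => j /andP[_ /negPf ->].
by rewrite big1 // => j js; case: eqP => // E; move: si; rewrite -E js.
Qed.

Lemma sum_ge0_eq0 (I : finType) (F : I -> R) :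
  (forall i, 0 <= F i) -> \sum_i F i <= 0 -> forall i, F i = 0.
Proof.
move=> F0 sF i; apply/eqP; rewrite eq_le F0 andbT; apply: le_trans sF.
by rewrite (bigD1 i) //= lerDl sumr_ge0.
Qed.

(** A coordinate equal to 0 or 1 is extremal on the cube, so all sets of nonzero weight in a
    combination giving [evec R s] agree with [s] at every [i]. Hence a cell determines its
    matroid. *)
Lemma evec_hull T s : evec R s \in hull T <-> s \in T.
Proof.
rewrite inE; split=> [[t [t0 tT t1 sE]]|sT]; last first.
  exists (fun r => (r == s)%:R); split.
  - by move=> r; rewrite ler0n.
  - by move=> r rT; case: eqP => // E; rewrite -E (negPf rT) in sT.
  - by rewrite (bigD1 s) //= eqxx big1 ?addr0 // => r /negPf ->.
  - by rewrite (bigD1 s) //= eqxx big1 ?addr0 ?scale1r // => r /negPf ->; rewrite scale0r.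
have [r tr] : exists r, t r != 0.
  apply: contrapT => nt; suff : \sum_s t s = 0 by rewrite t1 => /eqP; rewrite oner_eq0.
  by apply: big1 => r _; apply/eqP; apply: contrapT => /negP tr; apply: nt; exists r.
have rT : r \in T by apply: contraNT tr => /tT ->.
suff -> : s = r by [].
apply/setP => i; have := congr1 (fun y : 'rV_n => y 0 i) sE; rewrite /= evecE summxE.
under eq_bigr => r' _ do rewrite mxE evecE.
have [si|si] := boolP (i \in s) => /esym E.
  have le0 : \sum_r' t r' * (1 - (i \in r')%:R) <= 0.
    by under eq_bigr => r' _ do rewrite mulrBr mulr1; rewrite sumrB t1 E subrr.
  have ge0 r' : 0 <= t r' * (1 - (i \in r')%:R).
    by rewrite mulr_ge0 // subr_ge0 lern1 leq_b1.
  have /eqP := sum_ge0_eq0 ge0 le0 r.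
  by rewrite mulf_eq0 (negPf tr) /= subr_eq0; case: (i \in r); rewrite // oner_eq0.
have le0 : \sum_r' t r' * (i \in r')%:R <= 0 by rewrite E.
have ge0 r' : 0 <= t r' * (i \in r')%:R by rewrite mulr_ge0.
have /eqP := sum_ge0_eq0 ge0 le0 r.
by rewrite mulf_eq0 (negPf tr) /=; case: (i \in r); rewrite // oner_eq0.
Qed.

Lemma hull_inj T T' : hull T = hull T' -> T = T'.
Proof.
by move=> E; apply/setP => s; apply/idP/idP => /evec_hull; [rewrite E|rewrite -E] => /evec_hull.
Qed.

Section Cells.
Variable M : matroid n.

Lemma sum_bases (V : zmodType) (F : {set 'I_n} -> V) :
  (forall s, s \notin bases M -> F s = 0) ->
  \sum_s F s = \sum_(b : matroid_basis M) F (val b).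
Proof.
move=> F0; rewrite -big_sub (bigID (mem (bases M))) /= [X in _ + X]big1 ?addr0 //.
Qed.

Lemma hull_basis T y : T \subset bases M ->
  hull T y <-> exists t : matroid_basis M -> R, [/\ forall b, 0 <= t b,
    forall b, val b \notin T -> t b = 0, \sum_b t b = 1 & y = \sum_b t b *: evec R (val b)].
Proof.
move=> TM; have out s : s \notin bases M -> s \notin T.
  by apply: contraNN; move/fintype.subsetP: TM; apply.
split=> [[t [t0 tT t1 ->]]|[t [t0 tT t1 ->]]].
  exists (fun b => t (val b)); split=> //.
  - by move=> b /tT.
  - by rewrite -t1 sum_bases // => s /out/tT.
  - by rewrite sum_bases // => s /out/tT ->; rewrite scale0r.
have tout s : s \notin bases M -> coord_ext t s = 0 by apply: coord_ext_out.
exists (coord_ext t); split=> //.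
- by move=> s; rewrite /coord_ext; case: insub.
- move=> s; have [sM|/tout //] := boolP (s \in bases M).
  by move=> sT; rewrite coord_ext_in tT.
- by rewrite sum_bases // -t1; apply: eq_bigr => b _; rewrite coord_ext_val.
- rewrite sum_bases; last by move=> s /tout ->; rewrite scale0r.
  by apply: eq_bigr => b _; rewrite coord_ext_val.
Qed.

Lemma matroid_polytope_hull : matroid_polytope R M = hull (bases M).
Proof.
apply/seteqP; split=> y; rewrite hull_basis //.
  by case=> t [t0 t1 yE]; exists t; split=> // b; rewrite (valP b).
by case=> t [t0 _ t1 yE]; exists t.
Qed.

Variable w : {ffun matroid_basis M -> R}.

Definition tilt (l : 'I_n -> R) (s : {set 'I_n}) : R := coord_ext w s + \sum_(i in s) l i.

Lemma dot_comb m (a : 'rV[R]_m) (J : finType) (t : J -> R) (x : J -> 'rV[R]_m) :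
  dot a (\sum_j t j *: x j) = \sum_j t j * dot a (x j).
Proof.
rewrite /dot; under eq_bigr => i _ do rewrite summxE mulr_sumr.
rewrite exchange_big /=; apply: eq_bigr => j _; rewrite mulr_sumr.
by apply: eq_bigr => i _; rewrite mxE mulrCA.
Qed.

Lemma dot_lift (a : 'rV[R]_(n + 1)) (b : matroid_basis M) :
  dot a (row_mx (evec R (val b)) (w b)%:M) =
  \sum_(i in val b) a 0 (lshift 1 i) + a 0 (rshift n ord0) * w b.
Proof.
rewrite /dot big_split_ord big_ord1 /= row_mxEr mxE eqxx mulr1n; congr (_ + _).
rewrite [RHS]big_mkcond; apply: eq_bigr => i _; rewrite row_mxEl evecE.
by case: ifP => _; rewrite ?mulr1 ?mulr0.
Qed.

(** On lifted vertices the functional is [c] times the tilt. The excesses over the minimum are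
    nonnegative, so a convex combination is minimal exactly when its weights vanish off the
    minimizing vertices. *)
Lemma lower_face_cell (a : 'rV[R]_(n + 1)) (l : 'I_n -> R) (c : R) :
  0 < c -> a 0 (rshift n ord0) = c -> (forall i, a 0 (lshift 1 i) = c * l i) ->
  lsubmx @` [set q | lifted_polytope M w q /\
     forall q', lifted_polytope M w q' -> dot a q <= dot a q'] =
  hull (argmin_bases M (tilt l)).
Proof.
move=> c0 ac al.
have TM : argmin_bases M (tilt l) \subset bases M.
  by apply/fintype.subsetP => s /argmin_basesP[].
pose X (b : matroid_basis M) := row_mx (evec R (val b)) ((w b)%:M : 'M_1).
have dotX b : dot a (X b) = c * tilt l (val b).
  rewrite dot_lift /tilt coord_ext_val ac mulrDr addrC mulr_sumr.
  by congr (_ + _); apply: eq_bigr => i _; rewrite al.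
have subX t : lsubmx (\sum_b t b *: X b) = \sum_b t b *: evec R (val b).
  rewrite raddf_sum; apply: eq_bigr => b _.
  by rewrite /X scale_row_mx [LHS]row_mxKl.
have [s0 s0M] : exists s, s \in bases M by apply/set0Pn; exact: bases_neq0.
have [s sM smin] := arg_minP (tilt l) s0M.
pose b0 : matroid_basis M := exist _ s sM.
have X0 : lifted_polytope M w (X b0).
  exists (fun b => (b == b0)%:R); split.
  - by move=> b; rewrite ler0n.
  - by rewrite (bigD1 b0) //= eqxx big1 ?addr0 // => b /negPf ->.
  - by rewrite (bigD1 b0) //= eqxx big1 ?addr0 ?scale1r // => b /negPf ->; rewrite scale0r.
have bmin b : dot a (X b0) <= dot a (X b).
  by rewrite !dotX ler_pM2l //; apply: smin; apply: valP.
have lower q : lifted_polytope M w q -> dot a (X b0) <= dot a q.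
  case=> t [t0 t1 ->]; rewrite dot_comb -[X in X <= _]mul1r -t1 mulr_suml.
  by apply: ler_sum => b _; exact: (ler_wpM2l (t0 b) (bmin b)).
apply/seteqP; split=> y; rewrite (hull_basis _ TM).
  case=> q [[t [t0 t1 ->]] qmin] <-; exists t; split=> //.
  have ge0 b : 0 <= t b * (dot a (X b) - dot a (X b0)).
    by rewrite mulr_ge0 // subr_ge0.
  have /(sum_ge0_eq0 ge0) H : \sum_b t b * (dot a (X b) - dot a (X b0)) <= 0.
    under eq_bigr => b _ do rewrite mulrBr.
    rewrite sumrB -mulr_suml t1 mul1r -dot_comb subr_le0.
    exact: qmin X0.
  move=> b bT; have /eqP := H b.
  rewrite mulf_eq0 => /orP[/eqP//|]; rewrite subr_eq0 => /eqP E.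
  case/argmin_basesP: bT; split; first exact: valP.
  move=> r rM; apply: le_trans (smin r rM).
  by move: E; rewrite !dotX => /(mulfI (lt0r_neq0 c0)) ->.
case=> t [t0 tT t1 ->]; exists (\sum_b t b *: X b); last exact: subX.
have Q : lifted_polytope M w (\sum_b t b *: X b) by exists t.
split=> // q' /lower; apply: le_trans.
rewrite dot_comb -[X in _ <= X]mul1r -t1 mulr_suml; apply: ler_sum => b _.
have [bT|/tT ->] := boolP (val b \in argmin_bases M (tilt l)); last by rewrite !mul0r.
apply: ler_wpM2l => //; rewrite !dotX ler_pM2l //.
by case/argmin_basesP: bT => _; apply.
Qed.

Lemma regular_subdivisionP C : regular_subdivision M w C <->
  exists l, C = hull (argmin_bases M (tilt l)).
Proof.
split=> [[F [a [a0 ->]] ->]|[l ->]].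
  exists (fun i => a 0 (lshift 1 i) / a 0 (rshift n ord0)).
  apply: (lower_face_cell a0) => // i.
  by rewrite mulrC divfK // lt0r_neq0.
pose a : 'rV[R]_(n + 1) := row_mx (\row_i l i) 1%:M.
have aE : a 0 (rshift n ord0) = 1 by rewrite row_mxEr mxE eqxx.
eexists; last first.
  by rewrite -(lower_face_cell (a := a) ltr01 aE) // => i; rewrite row_mxEl mxE mul1r.
by exists a; rewrite aE; split.
Qed.

End Cells.
End Hulls.

(** * From three-term relations to realizations *)

Lemma map_nth_index (T : eqType) (A : Type) (x0 : A) (s : seq T) (t : seq A) :
  uniq s -> size t = size s -> [seq nth x0 t (index i s) | i <- s] = t.
Proof.
move=> us st; apply: (@eq_from_nth _ x0); first by rewrite size_map.
move=> m; rewrite size_map; case: s us st => // i0 s' us st ms.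
by rewrite (nth_map i0) // index_uniq.
Qed.

Section PlueckerRealizable.
Variables (n : nat) (N : matroid n) (F : fieldType) (p : {set 'I_n} -> F).
Hypothesis p_supp : forall s, (p s != 0) = (s \in bases N).
Hypothesis p_three_term : forall S i j k l, sorted_quad N S i j k l ->
  three_term_mask p (fun _ _ => true) S i j k l = 0.
Implicit Types (S T B : {set 'I_n}) (a b i j x y : 'I_n).

Let p_card T : #|T| != rank N -> p T = 0.
Proof.
by apply: contraNeq; rewrite p_supp => /bases_card ->.
Qed.

(** The sign of sorting [x] into [T] from the front; it turns the set-indexed [p] into the
    alternating coordinate [q]. *)
Let sg T x : F := (-1) ^+ #|[set t in T | (t < x)%N]%SET|.

Let q T x := sg T x * p (x |: T).

Let sg_neq0 T x : sg T x != 0.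
Proof. by rewrite signr_eq0. Qed.

Let sgU T a x : a \notin T -> sg (a |: T) x = sg T x * (-1) ^+ (a < x)%N.
Proof.
move=> aT; rewrite /sg -exprD; congr (_ ^+ _).
have [ax|ax] := boolP (a < x)%N.
  rewrite addn1; transitivity #|a |: [set t in T | (t < x)%N]%SET|.
    apply: eq_card => z; rewrite !inE.
    by have [->|] := eqVneq z a; rewrite ?ax.
  by rewrite cardsU1 inE (negPf aT).
rewrite addn0; apply: eq_card => z; rewrite !inE.
by have [->|_] := eqVneq z a; rewrite ?(negPf aT) ?(negPf ax) ?andbF ?orbF ?if_same ?ltnn /=.
Qed.

(* The alternating Pluecker coordinate of [S, a, x], up to a sign depending only on [S]. *)
Let P S a x := sg S a * q (a |: S) x.

Let PE S a x : a \notin S ->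
  P S a x = sg S a * sg S x * (-1) ^+ (a < x)%N * p (S :|: [set a; x]%SET).
Proof.
move=> aS; rewrite /P /q sgU // !mulrA; congr (_ * p _).
by apply/setP => z; rewrite !inE; case: (z \in S); case: (z == a); case: (z == x).
Qed.

Let P_in S a x : (#|S| + 2 = rank N)%N -> a \notin S -> x \in a |: S -> P S a x = 0.
Proof.
move=> cS aS xS; rewrite /P /q p_card ?mulr0 //.
rewrite (finset.setUidPr _) ?finset.sub1set // cardsU1 aS -cS.
by lia.
Qed.

Let P_anti S a x : (#|S| + 2 = rank N)%N -> a \notin S -> x \notin S -> P S x a = - P S a x.
Proof.
move=> cS aS xS; have [->|ax] := eqVneq a x.
  by rewrite P_in ?oppr0 // finset.setU11.
rewrite !PE // (finset.setUC [set x]%SET) (mulrC (sg S x)).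
have -> : (a < x)%N = ~~ (x < a)%N.
  by move: ax; rewrite -val_eqE /=; lia.
by case: (x < a)%N; rewrite ?expr0 ?expr1 !(mulrN1, mulr1, mulNr, opprK).
Qed.

(** In alternating coordinates the relation holds in every order and with repetitions, as the pivot
    computation requires. The sorted case is the hypothesis times a product of signs; [P_anti] gives
    the others. *)
Let P3 S a b i j : (#|S| + 2 = rank N)%N -> a \notin S -> b \notin S -> i \notin S -> j \notin S ->
  P S a b * P S i j - P S a i * P S b j + P S a j * P S b i = 0.
Proof.
move=> cS; move: a b i j.
have Ps a b i j : a \notin S -> b \notin S -> i \notin S -> j \notin S ->
    (a < b)%N -> (b < i)%N -> (i < j)%N ->
    P S a b * P S i j - P S a i * P S b j + P S a j * P S b i = 0.
  move=> aS bS iS jS ab bi ij; have := @p_three_term S a b i j.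
  rewrite /sorted_quad cS eqxx ab bi ij aS bS iS jS => /(_ erefl).
  rewrite /three_term_mask !PE // ab ij (ltn_trans ab bi) (ltn_trans bi ij) bi.
  rewrite (ltn_trans (ltn_trans ab bi) ij) expr1 !mulr1n => E.
  have {}E := congr1 (fun z => sg S a * sg S b * sg S i * sg S j * z) E.
  by rewrite mulr0 in E; rewrite -[RHS]E; ring.
have Paa a : a \notin S -> P S a a = 0 by move=> aS; rewrite P_in // finset.setU11.
move=> a b i j; wlog ab : a b / (a < b)%N => [hw|].
  move=> aS bS iS jS; have [ab|] := ltnP a b; first exact: hw.
  rewrite leq_eqVlt => /orP[/eqP/val_inj <-|ba]; first by rewrite Paa //; ring.
  have := hw b a ba bS aS iS jS; rewrite (P_anti (a := a) (x := b)) // => E.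
  by rewrite -[LHS]opprK -[RHS]oppr0; congr (- _); rewrite -[RHS]E; ring.
wlog ij : i j / (i < j)%N => [hw|].
  move=> aS bS iS jS; have [ij|] := ltnP i j; first exact: hw.
  rewrite leq_eqVlt => /orP[/eqP/val_inj <-|ji]; first by rewrite Paa //; ring.
  have := hw j i ji aS bS jS iS; rewrite (P_anti (a := i) (x := j)) // => E.
  by rewrite -[LHS]opprK -[RHS]oppr0; congr (- _); rewrite -[RHS]E; ring.
wlog ai : a b i j ab ij / (a < i)%N => [hw|].
  move=> aS bS iS jS; have [ai|] := ltnP a i; first exact: hw.
  rewrite leq_eqVlt => /orP[/eqP/val_inj E|ia].
    by rewrite E Paa // (P_anti (a := a) (x := b)) // -E; ring.
  have := hw i j a b ij ab ia iS jS aS bS.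
  rewrite (P_anti (a := a) (x := i)) // (P_anti (a := b) (x := j)) //.
  rewrite (P_anti (a := b) (x := i)) // (P_anti (a := a) (x := j)) // => E.
  by rewrite -[RHS]E; ring.
move=> aS bS iS jS; have [bi|ib|bi] := ltngtP b i.
- exact: Ps.
- have [bj|jb|bj] := ltngtP b j.
  + have := Ps a i b j aS iS bS jS ai ib bj.
    rewrite (P_anti (a := b) (x := i)) // => E.
    by rewrite -[LHS]opprK -[RHS]oppr0; congr (- _); rewrite -[RHS]E; ring.
  + have := Ps a i j b aS iS jS bS ai ij jb.
    rewrite (P_anti (a := b) (x := i)) // (P_anti (a := b) (x := j)) // => E.
    by rewrite -[RHS]E; ring.
  + by rewrite -(val_inj bj) Paa // (P_anti (a := b) (x := i)) //; ring.
- by rewrite -(val_inj bi) Paa //; ring.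
Qed.
(** Cramer's rule: the coordinate along [v i] of [v j] in the basis [B], for vectors with Pluecker
    coordinates [p]. *)
Let c B i j := q (B :\ i) j / q (B :\ i) i.

Let q_neq0 B i : B \in bases N -> i \in B -> q (B :\ i) i != 0.
Proof.
by move=> BN iB; rewrite /q finset.setD1K // mulf_neq0 ?sg_neq0 // p_supp.
Qed.

Section Pivot.
Variables (V : lmodType F) (v : 'I_n -> V).

Definition expansion B := forall j, v j = \sum_(i in B) c B i j *: v i.

(** After the expansion of [v b] is substituted, the coefficients of [v i] agree by [P3] for
    [S = B :\ a :\ i] and the indices [a], [b], [i], [j]. *)
Lemma pivot_expansion B a b : B \in bases N -> a \in B -> b \notin B ->
  swap B a b \in bases N -> expansion B -> expansion (swap B a b).
Proof.
move=> BN aB bB B'N vB j; set T := B :\ a.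
have bT : b \notin T by rewrite !inE negb_and bB orbT.
have aT : a \notin T by rewrite !inE eqxx.
have B'b : swap B a b :\ b = T by rewrite /swap finset.setU1K.
have qa : q T a != 0 by apply: q_neq0.
have qb : q T b != 0 by rewrite -B'b; apply: q_neq0 => //; rewrite in_swap eqxx.
have vj := vB j; have vb := vB b.
rewrite (big_setD1 a aB) /= -/T in vj; rewrite (big_setD1 a aB) /= -/T in vb.
rewrite big_setU1 //= -/T {1}vb scalerDr scalerA scaler_sumr -addrA -big_split /= vj.
have -> : c (swap B a b) b j * c B a b = c B a j.
  by rewrite /c B'b -/T; field; rewrite qa qb.
congr (_ + _); apply: eq_bigr => i iT; rewrite scalerA -scalerDl; congr (_ *: _).
pose S := T :\ i; have iS : i \notin S by rewrite !inE eqxx.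
have aS : a \notin S by rewrite !inE eqxx /= !andbF.
have bS : b \notin S by rewrite !inE negb_and (negPf bB) !andbF orbT.
have SiT : i |: S = T by rewrite /S finset.setD1K.
have cS : (#|S| + 2 = rank N)%N.
  by rewrite -(bases_card BN) (cardsD1 a B) aB -/T (cardsD1 i T) iT -/S addn2.
have ai : i != a by apply: contraNneq aT => <-.
have bi : i != b by apply: contraNneq bT => <-.
have iB : i \in B by move: iT; rewrite !inE => /andP[].
have aSi : a |: S = B :\ i.
  apply/setP => z; rewrite !inE; have [->|] := eqVneq z a; first by rewrite eq_sym ai aB.
  by rewrite andbC.
have bSi : b |: S = swap B a b :\ i.
  apply/setP => z; rewrite in_setD1 in_swap !inE.
  have [->|_] := eqVneq z b; first by rewrite eq_sym bi.
  by rewrite !andbA.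
have Pai : P S a i != 0.
  by rewrite /P aSi mulf_neq0 ?sg_neq0 // q_neq0.
have Pbi : P S b i != 0.
  by rewrite /P bSi mulf_neq0 ?sg_neq0 // q_neq0 // in_swap ai iB orbT.
have -> : c B i j = P S a j / P S a i.
  by rewrite /c -aSi /P -mulf_div divff ?sg_neq0 // mul1r.
have -> : c (swap B a b) i j = P S b j / P S b i.
  by rewrite /c -bSi /P -mulf_div divff ?sg_neq0 // mul1r.
have -> : c (swap B a b) b j = P S i j / P S i b.
  by rewrite /c B'b -SiT /P -mulf_div divff ?sg_neq0 // mul1r.
have -> : c B i b = P S a b / P S a i.
  by rewrite /c -aSi /P -mulf_div divff ?sg_neq0 // mul1r.
rewrite (P_anti (a := b) (x := i)) //.
(* [P3] needs [j] outside [S]; for [j] in [S] all coordinates involving [j] vanish. *)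
have [jS|jS] := boolP (j \in S).
  have jU x : j \in x |: S by rewrite finset.in_setU jS orbT.
  by rewrite (P_in cS aS (jU a)) (P_in cS iS (jU i)) (P_in cS bS (jU b)) !mul0r addr0.
have := P3 cS aS bS iS jS => E.
have -> : P S a j = (P S a i * P S b j - P S a b * P S i j) / P S b i.
  by apply: (canRL (mulfK Pbi)); apply/eqP; rewrite -subr_eq0 -[X in _ == X]E; apply/eqP; ring.
by field; rewrite oppr_eq0 Pai Pbi.
Qed.

(** Pivots connect all bases: [B] is moved one exchange closer to [B0], and the inverse pivot leads
    back. *)
Lemma expansion_all B0 B : B0 \in bases N -> B \in bases N -> expansion B0 -> expansion B.
Proof.
move=> B0N + vB0; have [m] := ubnP #|B :\: B0|; elim: m B => // m IHm B Bm BN.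
have [B00|/set0Pn[x xB]] := eqVneq (B :\: B0) finset.set0.
  suff -> : B = B0 by [].
  apply/eqP; rewrite eqEcard -finset.setD_eq0 B00 eqxx /=.
  by rewrite (bases_card BN) (bases_card B0N).
have [y yB B1N] := bases_exchange BN B0N xB; rewrite -/(swap B x y) in B1N.
move: (xB) (yB); rewrite !inE => /andP[xB0 xB'] /andP[yB' yB0].
have xy : x != y by apply: contraNneq xB0 => ->.
have E : B = swap (swap B x y) y x.
  apply/setP => z; rewrite !in_swap; have [->//|] := eqVneq z x.
  by have [->|] := eqVneq z y; rewrite // (negPf yB').
rewrite E; apply: pivot_expansion => //.
- by rewrite in_swap eqxx.
- by rewrite in_swap eqxx orbF.
- by rewrite -E.
apply: IHm => //; rewrite -ltnS; apply: leq_trans Bm; rewrite ltnS.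
apply: proper_card; apply/properP; split.
  apply/fintype.subsetP => z; rewrite inE in_swap inE.
  by case/andP=> zB0 /orP[/eqP zy|/andP[_ ->]]; [rewrite zy yB0 in zB0|rewrite zB0].
by exists x => //; rewrite inE negb_and in_swap negb_or eqxx xy orbT.
Qed.

End Pivot.

Lemma pluecker_realizable : realizable N F.
Proof.
have [B0 B0N] : exists B, B \in bases N by apply/set0Pn; exact: bases_neq0.
pose d := rank N; pose V : vectType F := 'rV[F]_d.
have dimV : \dim {: V} = d by rewrite dimvf /dim /= mul1n.
pose X := vbasis {: V}; pose e i : V := nth 0 X (index i (enum B0)).
have sX : size X = size (enum B0) by rewrite size_tuple dimV -cardE (bases_card B0N).
have eX : [seq e i | i <- enum B0] = X.
  by apply: map_nth_index; rewrite ?enum_uniq.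
pose v j : V := \sum_(i in B0) c B0 i j *: e i.
have ve i : i \in B0 -> v i = e i.
  move=> iB0; rewrite /v (big_setD1 i iB0) /= big1 ?addr0 => [|i'].
    by rewrite /c divff ?scale1r // q_neq0.
  rewrite !inE => /andP[i'i i'B0]; rewrite /c {1}/q p_card ?mulr0 ?mul0r ?scale0r //.
  rewrite (finset.setUidPr _); last by rewrite finset.sub1set !inE eq_sym i'i.
  by rewrite -(bases_card B0N) (cardsD1 i' B0) i'B0 add1n neq_ltn ltnSn.
have vB0 : expansion v B0 by move=> j; apply: eq_bigr => i iB0; rewrite ve.
exists v => s; split=> [sN|bs].
  rewrite basisEdim size_map -cardE (bases_card sN) dimV leqnn andbT.
  rewrite -(span_basis (vbasisP {:V})) -/X -eX; apply/span_subvP => _ /mapP[i iB0 ->].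
  rewrite mem_enum in iB0; rewrite -ve // (expansion_all B0N sN vB0 i).
  apply: memv_suml => j js; apply/memvZ/memv_span/map_f.
  by rewrite mem_enum.
have cs : #|s| = d.
  have := @size_basis F V fullv _ (in_tuple [seq v i | i <- enum s]) bs.
  by rewrite dimV => ->; rewrite size_map cardE.
(* [B] meets [s] as much as possible. For [b] in [s] outside [B], a nonzero coordinate of [v b]
   along some [a] outside [s] would allow a pivot enlarging the intersection; without one, [v b]
   depends on the other vectors of [s]. *)
have [B BN Bmax] := arg_maxnP (fun B => #|B :&: s|) B0N.
have [sB|] := boolP (s \subset B).
  suff -> : s = B by [].
  by apply/eqP; rewrite eqEcard sB cs (bases_card BN) leqnn.
move=> /subsetPn[b bs' bB]; exfalso.
have vb := expansion_all B0N BN vB0 b.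
have [/existsP[a /and3P[aB as' ca]]|/existsPn na] :=
    boolP [exists a, [&& a \in B, a \notin s & c B a b != 0]].
  have B'N : swap B a b \in bases N.
    by rewrite -p_supp; apply: contraNneq ca => p0; rewrite /c {1}/q p0 mulr0 mul0r.
  have : (#|swap B a b :&: s| <= #|B :&: s|)%N := Bmax _ B'N.
  rewrite leqNgt => /negP; apply.
  apply: proper_card; apply/properP; split.
    apply/fintype.subsetP => z; rewrite !inE => /andP[zB zs]; rewrite zs zB andbT.
    by rewrite andbT; apply/orP; right; apply: contraNneq as' => <-.
  by exists b; rewrite !inE ?bs' ?eqxx // (negPf bB).
have fs := basis_free bs.
have : perm_eq [seq v i | i <- enum s] (v b :: [seq v i | i <- enum (s :\ b)]).
  rewrite -map_cons; apply: perm_map; apply: uniq_perm; rewrite ?enum_uniq //=.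
    by rewrite mem_enum !inE eqxx enum_uniq.
  by move=> z; rewrite inE !mem_enum !inE; have [->|] := eqVneq z b.
move=> /perm_free; rewrite fs free_cons => /esym/andP[/negP nb _]; apply: nb.
rewrite vb; apply: memv_suml => i iB.
have [is'|is'] := boolP (i \in s); last first.
  by have := na i; rewrite iB is' /= negbK => /eqP ->; rewrite scale0r mem0v.
apply/memvZ/memv_span/map_f; rewrite mem_enum !inE is' andbT.
by apply: contraNneq bB => <-.
Qed.

End PlueckerRealizable.

(** * Cells attached to a torus point *)

Section InitialPoints.
Variables (R : realType) (n : nat) (M : matroid n).
Implicit Types (S s : {set 'I_n}) (f : {set 'I_n} -> R).

Lemma card_setU_pair S x y : x != y -> x \notin S -> y \notin S ->
  #|S :|: [set x; y]%SET| = (#|S| + 2)%N.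
Proof.
move=> xy xS yS; rewrite finset.setUA (finset.setUC _ [set y]%SET) cardsU1.
rewrite (finset.setUC _ [set x]%SET) cardsU1 xS !inE negb_or eq_sym xy yS.
by rewrite addn2.
Qed.

(** If exchange failed for a pairing, taking its sum as [c] would leave a single product in the
    initial form, and that product is nonzero at a point of the torus. *)
Lemma initial_point_exchange (k : fieldType) f (a : matroid_basis M -> k) :
  initial_point f a -> local_exchange M f.
Proof.
move=> [a0 ainit].
have ext0 s : s \in bases M -> coord_ext a s != 0.
  by move=> sM; rewrite coord_ext_in; apply: a0.
have out s : s \notin bases M -> coord_ext a s = 0 by exact: coord_ext_out.
have term (c : R) s t : ~ [/\ s \in bases M, t \in bases M & f s + f t <= c] ->
    weight_ge M f c s t /\ coord_ext a s * coord_ext a t *+ weight_mask f c s t = 0.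
  move=> nst; split=> [sM tM|].
    by apply/ltW; rewrite ltNge; apply/negP => le; apply: nst.
  have [sM|/out ->] := boolP (s \in bases M); last by rewrite mul0r mul0rn.
  have [tM|/out ->] := boolP (t \in bases M); last by rewrite mulr0 mul0rn.
  rewrite /weight_mask; case: eqP => // E.
  by case: nst; rewrite E.
move=> S i j k' l u nS; apply: exchange_at_sort u nS => {}i {}j {}k' {}l ijk kl nS.
have u : uniq [:: i; j; k'; l].
  by rewrite /= !inE !negb_or -!val_eqE /=; lia.
have qS x y : (x != y) -> x \notin S -> y \notin S ->
    S :|: [set x; y]%SET \in bases M -> sorted_quad M S i j k' l.
  move=> xy xS yS sM; rewrite /sorted_quad ijk kl nS !andbT.
  by rewrite -(bases_card sM) card_setU_pair.
have neq0 (s t : {set 'I_n}) c : s \in bases M -> t \in bases M -> f s + f t = c ->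
    weight_ge M f c s t /\ coord_ext a s * coord_ext a t *+ weight_mask f c s t != 0.
  move=> sM tM E; split=> [_ _|]; first by rewrite E.
  by rewrite /weight_mask E eqxx mulr1n mulf_neq0 ?ext0.
case/and4P: (nS) => iS jS kS lS.
move: (u); rewrite /= !inE !negb_or -!andbA => /and5P[ij ik il jk /and3P[jl kl' _]].
have BC x y : S :|: [set x; y]%SET = S :|: [set y; x]%SET by rewrite (finset.setUC [set x]).
rewrite /exchange_at; split=> m1 m2; apply: contrapT => /not_orP[n1 n2].
- have [w1 t1] := neq0 _ _ _ m1 m2 erefl.
  have [w2 t2] := term _ _ _ n1; have [w3 t3] := term _ _ _ n2.
  have := ainit S i j k' l _ (qS i j ij iS jS m1) (And3 w1 w2 w3).
  by rewrite /three_term_mask t2 t3 subr0 addr0 => /eqP; rewrite (negPf t1).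
- have [w2 t2] := neq0 _ _ _ m1 m2 erefl.
  rewrite (BC k' j) in n2.
  have [w1 t1] := term _ _ _ n1; have [w3 t3] := term _ _ _ n2.
  have := ainit S i j k' l _ (qS i k' ik iS kS m1) (And3 w1 w2 w3).
  by rewrite /three_term_mask t1 t3 sub0r addr0 => /eqP; rewrite oppr_eq0 (negPf t2).
- have [w3 t3] := neq0 _ _ _ m1 m2 erefl.
  rewrite (BC l k') in n1; rewrite (BC l j) in n2.
  have [w1 t1] := term _ _ _ n1; have [w2 t2] := term _ _ _ n2.
  have := ainit S i j k' l _ (qS i l il iS lS m1) (And3 w1 w2 w3).
  by rewrite /three_term_mask t1 t2 subr0 add0r => /eqP; rewrite (negPf t3).
Qed.

Lemma initial_point_realizable_cells (k : fieldType)
    (w : {ffun matroid_basis M -> R}) (a : matroid_basis M -> k) :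
  initial_point (coord_ext w) a -> realizable_cells R M k w.
Proof.
move=> ainit C /regular_subdivisionP[l ->].
have LE := initial_point_exchange ainit.
have [N [rN bN]] := argmin_matroid (local_exchange_twist LE l).
exists N; first by rewrite matroid_polytope_hull bN.
have [a0 aS] := ainit.
set g := tilt w l in bN *.
have [s0 s0M] : exists s, s \in bases M by apply/set0Pn; exact: bases_neq0.
have [s1 s1M smin] := arg_minP g s0M.
have NP s : reflect (s \in bases M /\ g s = g s1) (s \in bases N).
  rewrite bN; apply: (iffP (argmin_basesP M _ _)) => -[sM].
    by move=> sm; split=> //; apply/eqP; rewrite eq_le sm // smin.
  by move=> E; split=> // t tM; rewrite -/(tilt w l s) -/g E smin.
apply: (@pluecker_realizable _ N k (fun s => if s \in bases N then coord_ext a s else 0)).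
  move=> s; case: (NP s) => [[sM _]|_]; last by rewrite eqxx.
  by rewrite coord_ext_in; apply: a0.
move=> S i j k' l' /and3P[/eqP cS ijkl nS].
have qS : sorted_quad M S i j k' l' by rewrite /sorted_quad -rN cS eqxx ijkl nS.
have u : uniq [:: i; j; k'; l'].
  by case/andP: ijkl; rewrite /= !inE !negb_or -!val_eqE /=; lia.
pose L := (\sum_(x in S) l x) *+ 2 + (l i + l j + l k' + l l').
case/and4P: (nS) => iS jS kS lS.
have sumE x y : x \notin S -> y \notin S -> x != y ->
    \sum_(z in S :|: [set x; y]%SET) l z = \sum_(z in S) l z + (l x + l y).
  move=> xS yS xy; rewrite finset.setUA finset.setUC big_setU1 /=; last first.
    by rewrite !inE negb_or yS eq_sym.
  by rewrite finset.setUC big_setU1 //=; lra.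
(* Twice the minimum of the tilt, carried back to [w]. Tilting adds the same [L] to the three
   products, so a product of bases survives the mask exactly when both factors are minimizers. *)
pose c := g s1 + g s1 - L.
have fE s : coord_ext w s = g s - \sum_(z in s) l z by rewrite /g /tilt addrK.
have term (s t : {set 'I_n}) : \sum_(z in s) l z + \sum_(z in t) l z = L ->
    weight_ge M (coord_ext w) c s t /\
    (if s \in bases N then coord_ext a s else 0) * (if t \in bases N then coord_ext a t else 0) =
    coord_ext a s * coord_ext a t *+ weight_mask (coord_ext w) c s t.
  move=> sL; have wE : coord_ext w s + coord_ext w t = g s + g t - L by rewrite !fE -sL; ring.
  split=> [sM tM|].
    by rewrite wE /c; have := smin _ sM; have := smin _ tM; lra.
  have [sM|sM] := boolP (s \in bases M); last first.
    by rewrite coord_ext_out // if_same !mul0r mul0rn.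
  have [tM|tM] := boolP (t \in bases M); last first.
    by rewrite [coord_ext a t]coord_ext_out // if_same !mulr0 mul0rn.
  rewrite /weight_mask wE /c.
  have gs := smin _ sM; have gt := smin _ tM.
  have -> : (g s + g t - L == g s1 + g s1 - L) = (s \in bases N) && (t \in bases N).
    apply/eqP/andP => [E|[/NP[_ ->] /NP[_ ->]]//].
    by split; apply/NP; split=> //; lra.
  by case: (s \in bases N); case: (t \in bases N); rewrite ?mulr0 ?mul0r.
have sumL x y z t : perm_eq [:: x; y; z; t] [:: i; j; k'; l'] ->
    \sum_(r in S :|: [set x; y]%SET) l r + \sum_(r in S :|: [set z; t]%SET) l r = L.
  move=> pe; have uq : uniq [:: x; y; z; t] by rewrite (perm_uniq pe).
  have mem r : r \in [:: x; y; z; t] -> r \notin S.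
    by rewrite (perm_mem pe) !inE => /or4P[] /eqP ->.
  have [xy zt] : x != y /\ z != t.
    by move: uq; rewrite /= !inE !negb_or => /and4P[/and3P[-> _ _] _ -> _].
  rewrite !sumE ?mem ?inE ?eqxx ?orbT //.
  have : \sum_(r <- [:: x; y; z; t]) l r = \sum_(r <- [:: i; j; k'; l']) l r by apply: perm_big.
  by rewrite !big_cons !big_nil /L mulr2n => E; lra.
have [w1 t1] := term _ _ (sumL i j k' l' (perm_refl _)).
have [|w2 t2] := term _ _ (sumL i k' j l' _).
  by rewrite perm_cons (perm_catCA [:: k'] [:: j] [:: l']).
have [|w3 t3] := term _ _ (sumL i l' j k' _).
  by rewrite perm_cons (permEl (perm_rot 2 [:: j; k'; l'])).
have := aS S i j k' l' c qS (And3 w1 w2 w3).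
by rewrite /three_term_mask -t1 -t2 -t3 !mulr1n.
Qed.

End InitialPoints.

(** * Matroid subdivisions and the Dressian *)

Section Pairs.
Variables (n : nat) (M : matroid n).
Implicit Types (S s : {set 'I_n}).

Lemma setU_pairC S (x y : 'I_n) : S :|: [set x; y]%SET = S :|: [set y; x]%SET.
Proof. by rewrite (finset.setUC [set x]%SET). Qed.

Lemma pair_exchange S i j k l : uniq [:: i; j; k; l] ->
  [&& i \notin S, j \notin S, k \notin S & l \notin S] ->
  S :|: [set i; j]%SET \in bases M -> S :|: [set k; l]%SET \in bases M ->
  S :|: [set j; k]%SET \in bases M \/ S :|: [set j; l]%SET \in bases M.
Proof.
move=> + /and4P[iS jS kS lS] ijM klM.
rewrite /= !inE !negb_or -!andbA => /and5P[ij ik il jk /and3P[jl kl _]].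
have iD : i \in (S :|: [set i; j]%SET) :\: (S :|: [set k; l]%SET).
  by rewrite !inE eqxx /= (negPf iS) (negPf ik) (negPf il).
have [y] := bases_exchange ijM klM iD.
have setE z : z |: (S :|: [set i; j]%SET) :\ i = S :|: [set j; z]%SET.
  apply/setP => x; rewrite !inE; have [->|_] := eqVneq x i; last first.
    by case: (x == z); case: (x == j); case: (x \in S).
  by rewrite (negPf iS) (negPf ij) /= orbF.
rewrite setE !inE !negb_or => /andP[/and3P[yS yi yj]].
by rewrite (negPf yS) /= => /orP[] /eqP ->; [left|right].
Qed.

(** Removing each of [i], [j], [k], [l] gives four disjunctions, the edges of a 4-cycle on the pairs
    [ik], [jk], [jl], [il]; a vertex cover of a 4-cycle contains two opposite vertices. *)
Lemma constant_exchange (R : realType) (f : {set 'I_n} -> R) (c : R) :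
  (forall s, f s = c) -> local_exchange M f.
Proof.
move=> fc S i j k l u nS; rewrite /exchange_at => ijM klM; rewrite !fc.
move: (nS) => /and4P[iS jS kS lS].
have f1 := pair_exchange u nS ijM klM.
have f2 : S :|: [set i; k]%SET \in bases M \/ S :|: [set i; l]%SET \in bases M.
  apply: (@pair_exchange S j i k l); rewrite ?(setU_pairC S j i) ?iS ?jS ?kS ?lS //.
  by move: u; rewrite /= !inE !negb_or -!val_eqE /=; lia.
have f3 : S :|: [set i; l]%SET \in bases M \/ S :|: [set j; l]%SET \in bases M.
  rewrite (setU_pairC S i l) (setU_pairC S j l).
  apply: (@pair_exchange S k l i j); rewrite ?iS ?jS ?kS ?lS //.
  by move: u; rewrite /= !inE !negb_or -!val_eqE /=; lia.
have f4 : S :|: [set i; k]%SET \in bases M \/ S :|: [set j; k]%SET \in bases M.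
  rewrite (setU_pairC S i k) (setU_pairC S j k).
  apply: (@pair_exchange S l k i j); rewrite ?(setU_pairC S l k) ?iS ?jS ?kS ?lS //.
  by move: u; rewrite /= !inE !negb_or -!val_eqE /=; lia.
have [ik|ik] := boolP (S :|: [set i; k]%SET \in bases M).
  have [jl|jl] := boolP (S :|: [set j; l]%SET \in bases M); first by left.
  right; split=> //; first by case: f3 => // H; rewrite H in jl.
  by case: f1 => // H; rewrite H in jl.
right; split=> //; first by case: f2 => // H; rewrite H in ik.
by case: f4 => // H; rewrite H in ik.
Qed.

End Pairs.

Section SubdivisionExchange.
Variables (n : nat) (M : matroid n) (R : realType).
Implicit Types (S s : {set 'I_n}).

(** [p + x] and [q - r - x] will be the heights of a competing pair above the first pair. Their sum
    is [p + q - r], so both can be positive unless the pair is an admissible exchange; a non-basis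
    imposes nothing. *)
Lemma separating_pair (P Q : bool) (p q r : R) : ~ (P /\ Q /\ p + q <= r) ->
  exists x, (P -> 0 < p + x) /\ (Q -> 0 < q - r - x).
Proof.
case: P Q => [] [] H.
- exists ((q - r - p) / 2); have {}H : r < p + q.
    by rewrite ltNge; apply/negP => le; apply: H.
  by split=> _; lra.
- by exists (1 - p); split=> // _; lra.
- by exists (q - r - 1); split=> // _; lra.
- by exists 0.
Qed.

(* If the local exchange fails at [S, i, j, k, l], a functional that strongly
   favours the elements of [S] and penalizes those outside [S], [i], [j], [k],
   [l] cuts out a cell containing the first pair of bases but none of the others. *)
Lemma matroid_subdivision_exchange (w : {ffun matroid_basis M -> R}) :
  matroid_subdivision (regular_subdivision M w) -> local_exchange M (coord_ext w).
Proof.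
move=> msub S i j k l u nS; rewrite /exchange_at => ijM klM.
apply: contrapT => /not_orP[n1 n2].
pose f := coord_ext w; pose B a b := S :|: [set a; b]%SET.
have BC a b : B a b = B b a by apply: setU_pairC.
have [x [xik xjl]] : exists x, (B i k \in bases M -> 0 < f (B i k) + x) /\
    (B j l \in bases M -> 0 < f (B j l) - (f (B i j) + f (B k l)) - x).
  by apply: separating_pair => -[a [b c]]; apply: n1; split.
have [y [yil yjk]] : exists y, (B i l \in bases M -> 0 < f (B i l) + y) /\
    (B j k \in bases M -> 0 < f (B j k) - (f (B i j) + f (B k l)) - y).
  by apply: separating_pair => -[a [b c]]; apply: n2; split.
move: (nS) => /and4P[iS jS kS lS].
have [ij ik il [jk jl kl]] : [/\ i != j, i != k, i != l & [/\ j != k, j != l & k != l]].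
  by move: (u); rewrite /= !inE !negb_or -!andbA => /and5P[-> -> -> -> /and3P[-> -> _]].
(* The values of [e] put [B i j] and [B k l] at height 0, [B i k] at [f (B i k) + x] and [B i l] at
   [f (B i l) + y]; [li] is the solution of the equation for [B k l]. *)
pose li := (x + y + f (B k l)) / 2.
pose e z := if z == i then li else if z == j then - f (B i j) - li
  else if z == k then x - li else if z == l then y - li else 0.
pose beta := \sum_z `|e z|.
(* Missing an element of [S], or using one outside [S] and the four indices, costs [C], which
   exceeds by 1 all that [f] and [e] can compensate. *)
pose C := 1 + beta + \sum_s `|f s|.
have C0 : 0 <= C by rewrite !addr_ge0 ?sumr_ge0.
pose r z := if z \in S then 0 else if z \in [:: i; j; k; l] then e z else C.
pose la z := (if z \in S then - C else 0) + r z.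
have ei : e i = li by rewrite /e eqxx.
have ej : e j = - f (B i j) - li by rewrite /e eqxx eq_sym (negPf ij).
have ek : e k = x - li by rewrite /e eqxx eq_sym (negPf ik) eq_sym (negPf jk).
have el : e l = y - li.
  by rewrite /e eqxx eq_sym (negPf il) eq_sym (negPf jl) eq_sym (negPf kl).
have sum_la s : \sum_(z in s) la z = - C * #|s :&: S|%:R + \sum_(z in s) r z.
  rewrite big_split /=; congr (_ + _).
  rewrite -big_mkcondr /= sumr_const mulr_natr; congr (_ *+ _).
  by apply: eq_card => z; rewrite !inE.
have r_ge z : - `|e z| <= r z.
  have en : - `|e z| <= 0 by rewrite oppr_le0.
  rewrite /r; case: ifP => // _; case: ifP => // _; last exact: le_trans en C0.
  by rewrite lerNl -normrN ler_norm.
have beta_ge s : - beta <= \sum_(z in s) r z.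
  apply: (@le_trans _ _ (\sum_(z in s) - `|e z|)); last exact: ler_sum.
  rewrite sumrN lerN2 [beta](bigID (mem s)) /= lerDl sumr_ge0 //.
have f_ge s : - (C - 1 - beta) <= f s.
  rewrite /C lerNl (le_trans (_ : _ <= `|f s|)) //; first by rewrite -normrN ler_norm.
  rewrite (bigD1 s) //=; set t := \sum_(_ | _) _.
  have : 0 <= t by apply: sumr_ge0.
  by lra.
pose m := - C * #|S|%:R.
have rE a b : a \in [:: i; j; k; l] -> b \in [:: i; j; k; l] -> a \notin S -> b \notin S ->
    a != b -> f (B a b) + \sum_(z in B a b) la z = m + (f (B a b) + e a + e b).
  move=> ai bi aS bS ab; rewrite sum_la.
  have -> : B a b :&: S = S by apply/finset.setIidPr; apply: finset.subsetUl.
  have -> : \sum_(z in B a b) r z = e a + e b.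
    rewrite /B finset.setUC -finset.setUA big_setU1 /=; last by rewrite !inE negb_or ab.
    rewrite big_setU1 //= /r (negPf aS) (negPf bS) ai bi big1 ?addr0 // => z zS.
    by rewrite zS.
  by rewrite /m; ring.
have ijE : f (B i j) + e i + e j = 0 by rewrite ei ej; ring.
have klE : f (B k l) + e k + e l = 0 by rewrite ek el /li; field.
have ikE : f (B i k) + e i + e k = f (B i k) + x by rewrite ei ek; ring.
have ilE : f (B i l) + e i + e l = f (B i l) + y by rewrite ei el; ring.
have jkE : f (B j k) + e j + e k = f (B j k) - (f (B i j) + f (B k l)) - y.
  by rewrite ej ek /li; field.
have jlE : f (B j l) + e j + e l = f (B j l) - (f (B i j) + f (B k l)) - x.
  by rewrite ej el /li; field.
pose g := tilt w la.
have gE s : g s = f s + \sum_(z in s) la z by [].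
have mem4 : [/\ i \in [:: i; j; k; l], j \in [:: i; j; k; l], k \in [:: i; j; k; l] &
    l \in [:: i; j; k; l]].
  by split; rewrite !inE eqxx ?orbT.
have {mem4}[mi mj mk ml] := mem4.
have gij : g (B i j) = m by rewrite gE rE // ijE addr0.
have gkl : g (B k l) = m by rewrite gE rE // klE addr0.
have g_ge s : s \in bases M -> m <= g s.
  move=> sM; have cs : #|s| = (#|S| + 2)%N.
    by rewrite (bases_card sM) -(bases_card ijM) card_setU_pair.
  rewrite gE sum_la /m; have [Ss|nSs] := boolP (S \subset s); last first.
    have : (#|s :&: S| < #|S|)%N.
      apply: proper_card; rewrite finset.properEneq finset.subsetIr andbT.
      by apply: contraNneq nSs => <-; apply: finset.subsetIl.
    rewrite -(ler_nat R) -natr1 => cI; have := beta_ge s; have := f_ge s.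
    have := ler_wpM2l C0 cI; lra.
  have -> : s :&: S = S by apply/finset.setIidPr.
  have : #|s :\: S| == 2 by rewrite cardsD (finset.setIidPr Ss) cs addKn.
  move=> /cards2P[a [b [ab sS]]].
  have [aS bS] : a \notin S /\ b \notin S.
    have : a \in s :\: S by rewrite sS !inE eqxx.
    have : b \in s :\: S by rewrite sS !inE eqxx orbT.
    by rewrite !finset.in_setD => /andP[-> _] /andP[-> _].
  have sE : s = B a b by rewrite /B -sS -{1}(finset.setID s S) (finset.setIidPr Ss).
  have big z : z \in s -> z \notin S -> z \notin [:: i; j; k; l] -> C - beta <= \sum_(z in s) r z.
    move=> zs zS zn; rewrite (big_setD1 z zs) /= {1}/r (negPf zS) (negPf zn) lerD2l.
    exact: beta_ge.
  have [ai|an] := boolP (a \in [:: i; j; k; l]); last first.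
    have as' : a \in s by rewrite sE !inE eqxx orbT.
    by have := big a as' aS an; have := f_ge s; lra.
  have [bi|bn] := boolP (b \in [:: i; j; k; l]); last first.
    have bs' : b \in s by rewrite sE !inE eqxx !orbT.
    by have := big b bs' bS bn; have := f_ge s; lra.
  have := rE a b ai bi aS bS ab; rewrite -sE sum_la (finset.setIidPr Ss) /m => ->.
  rewrite lerDl sE; rewrite sE in sM.
  have sym z t : (B z t \in bases M -> 0 <= f (B z t) + e z + e t) ->
      B t z \in bases M -> 0 <= f (B t z) + e t + e z.
    by rewrite (BC t z) [X in _ -> _ -> _ <= X]addrAC.
  have hij : B i j \in bases M -> 0 <= f (B i j) + e i + e j by rewrite ijE.
  have hkl : B k l \in bases M -> 0 <= f (B k l) + e k + e l by rewrite klE.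
  have hik : B i k \in bases M -> 0 <= f (B i k) + e i + e k by rewrite ikE => /xik/ltW.
  have hil : B i l \in bases M -> 0 <= f (B i l) + e i + e l by rewrite ilE => /yil/ltW.
  have hjk : B j k \in bases M -> 0 <= f (B j k) + e j + e k by rewrite jkE => /yjk/ltW.
  have hjl : B j l \in bases M -> 0 <= f (B j l) + e j + e l by rewrite jlE => /xjl/ltW.
  move: ai bi ab sM; rewrite !inE => /or4P[] /eqP -> /or4P[] /eqP ->; rewrite ?eqxx // => _;
    solve [exact: hij|exact: hkl|exact: hik|exact: hil|exact: hjk|exact: hjl
      |exact: (sym _ _ hij)|exact: (sym _ _ hkl)|exact: (sym _ _ hik)|exact: (sym _ _ hil)
      |exact: (sym _ _ hjk)|exact: (sym _ _ hjl)].
have [|N] := msub (@hull R n (argmin_bases M g)).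
  by apply/regular_subdivisionP; exists la.
rewrite matroid_polytope_hull => /hull_inj NE.
have ijN : B i j \in bases N.
  by rewrite -NE; apply/argmin_basesP; split=> // t tM; rewrite gij; apply: g_ge.
have klN : B k l \in bases N.
  by rewrite -NE; apply/argmin_basesP; split=> // t tM; rewrite gkl; apply: g_ge.
have notN a b z : B a b \in bases N -> g (B a b) = m + z -> (B a b \in bases M -> 0 < z) -> False.
  rewrite -NE => /argmin_basesP[abM gmin] gz /(_ abM) z0.
  by have := gmin _ ijM; rewrite -/(B i j) gij gz; lra.
case: (pair_exchange u nS ijN klN) => abN.
  by apply: notN abN _ yjk; rewrite gE rE // jkE.
by apply: notN abN _ xjl; rewrite gE rE // jlE.
Qed.

End SubdivisionExchange.

Section DressianMembership.
Variables (R : realType) (I : finType) (K : fieldType) (v : valuation R K).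
Variable w : {ffun I -> R}.

(** The monomials are distinct with coefficients of valuation 0, so only exponents count; the
    hypothesis applied to a lightest term supplies the second minimum. If [e] is empty, [g] is 0. *)
Lemma trop_signed_sum (J : finType) (e : pred J) (x : J -> {ffun I -> int}) (sgn : J -> bool)
    (g : laurent I K) :
  {in e &, injective x} ->
  g = \sum_(t | e t) (-1) ^+ sgn t *: (<< x t >> : laurent I K) ->
  (forall t, e t -> exists t', [/\ e t', t' != t & exp_weight w (x t') <= exp_weight w (x t)]) ->
  trop v g w.
Proof.
move=> xinj gE attained.
have coef t : e t -> g@_(x t) = (-1) ^+ sgn t.
  move=> et; rewrite gE raddf_sum (bigD1 t) //= mcoeffZ mcoeffUU mulr1 big1 ?addr0 //.
  move=> t' /andP[et' t't]; rewrite mcoeffZ mcoeffU; case: eqP => [/xinj E|]; last by rewrite mulr0.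
  by rewrite E ?eqxx in t't.
have supp u : u \in msupp g -> exists2 t, e t & u = x t.
  rewrite -mcoeff_neq0 gE raddf_sum => sn0.
  apply: contrapT => nt; case/negP: sn0; apply/eqP; apply: big1 => t et.
  rewrite /= mcoeffZ mcoeffU; case: eqP => [E|]; last by rewrite mulr0.
  by case: nt; exists t.
have tw t : e t -> term_weight v g w (x t) = (exp_weight w (x t))%:E.
  move=> et; rewrite /term_weight coef //.
  by case: (sgn t); rewrite ?expr0 ?expr1 ?valuationN valuation1 add0e.
have inS t : e t -> x t \in msupp g.
  by move=> et; rewrite -mcoeff_neq0 coef // signr_eq0.
have [t0 et0|no] := pickP e; last by left; rewrite gE big_pred0.
have [t1 et1 tmin] := arg_minP (fun t => exp_weight w (x t)) et0.
have [t2 [et2 t21 le]] := attained t1 et1.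
right; exists (x t1), (x t2); split; rewrite ?inS ?tw //.
- by apply: contraNneq t21 => /xinj ->.
- by congr (_%:E); apply/eqP; rewrite eq_le le tmin.
- by move=> u /supp[t et ->]; rewrite tw // lee_fin tmin.
Qed.

End DressianMembership.

Lemma sum_ord3 (V : nmodType) (P : pred 'I_3) (F : 'I_3 -> V)
    (o0 := @Ordinal 3 0 isT) (o1 := @Ordinal 3 1 isT) (o2 := @Ordinal 3 2 isT) :
  \sum_(t | P t) F t = (if P o0 then F o0 else 0) + (if P o1 then F o1 else 0)
    + (if P o2 then F o2 else 0).
Proof.
rewrite big_mkcond !big_ord_recl big_ord0 /= addr0 addrA.
by congr (_ + _ + _); congr (if P _ then F _ else 0); apply: val_inj.
Qed.

Section ExchangeDressian.
Variables (R : realType) (n : nat) (M : matroid n) (K : fieldType) (v : valuation R K).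
Implicit Types (S s : {set 'I_n}).

Definition pair_exp s t : {ffun matroid_basis M -> int} :=
  [ffun b => (val b == s)%:R + (val b == t)%:R].

Lemma pluecker_mul s t : pluecker_coord M K s * pluecker_coord M K t =
  if (s \in bases M) && (t \in bases M) then << pair_exp s t >> else 0.
Proof.
rewrite /pluecker_coord; case: insubP => [b _ <-|/negPf ->]; last by rewrite mul0r.
case: insubP => [b' _ <-|/negPf ->]; last by rewrite andbF mulr0.
rewrite (valP b) (valP b') [lvar K b * _]laurentUU; congr (<< _ >>).
by apply/ffunP => b''; rewrite !ffunE.
Qed.

Lemma pair_exp_weight (w : {ffun matroid_basis M -> R}) s t : s \in bases M -> t \in bases M ->
  exp_weight w (pair_exp s t) = coord_ext w s + coord_ext w t.
Proof.
move=> sM tM.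
rewrite -[s]/(val (exist _ s sM : matroid_basis M)) -[t]/(val (exist _ t tM : matroid_basis M)).
rewrite !coord_ext_val; set b := exist _ s _; set b' := exist _ t _.
have -> : pair_exp (val b) (val b') = [ffun j => (j == b)%:R] + [ffun j => (j == b')%:R].
  by apply/ffunP => j; rewrite !ffunE !val_eqE.
by rewrite exp_weightD !exp_weight_delta.
Qed.

Lemma pair_exp_neq s t s' t' : s \in bases M -> s != s' -> s != t' ->
  pair_exp s t <> pair_exp s' t'.
Proof.
move=> sM ss' st' /ffunP/(_ (exist _ s sM)); rewrite !ffunE /= eqxx (negPf ss') (negPf st').
by case: (_ == _).
Qed.

(** The products that survive in a relation are distinct monomials, and local exchange provides for
    each of them another that is no heavier. *)
Lemma exchange_Dr (w : {ffun matroid_basis M -> R}) :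
  local_exchange M (coord_ext w) -> Dr M v w.
Proof.
move=> LE _ [S [i [j [k [l [cS ijkl nS ->]]]]]].
have u : uniq [:: i; j; k; l].
  by case/andP: ijkl; rewrite /= !inE !negb_or -!val_eqE /=; lia.
case/and4P: (nS) => iS jS kS lS.
have [ij ik il [jk jl kl]] : [/\ i != j, i != k, i != l & [/\ j != k, j != l & k != l]].
  by move: (u); rewrite /= !inE !negb_or -!andbA => /and5P[-> -> -> -> /and3P[-> -> _]].
have [B TB] : exists B, forall a b, S :|: [set a; b]%SET = B a b.
  by exists (fun a b => S :|: [set a; b]%SET).
have Bneq a b c d : c \notin S -> c != a -> c != b -> B a b != B c d.
  move=> cS' ca cb; rewrite -!TB; apply/eqP => /setP/(_ c).
  by rewrite !inE (negPf cS') (negPf ca) (negPf cb) eqxx.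
pose s (t : 'I_3) := match val t with 0%N => B i j | 1%N => B i k | _ => B i l end.
pose s' (t : 'I_3) := match val t with 0%N => B k l | 1%N => B j l | _ => B j k end.
pose e t := (s t \in bases M) && (s' t \in bases M).
have BC a b : B a b = B b a by rewrite -!TB setU_pairC.
have [ji ki li [kj lj lk]] : [/\ j != i, k != i, l != i & [/\ k != j, l != j & l != k]].
  by rewrite (eq_sym j i) (eq_sym k i) (eq_sym l i) (eq_sym k j) (eq_sym l j) (eq_sym l k).
have sneq t t' : t != t' -> s t != s t' /\ s t != s' t'.
  case: t t' => [[|[|[|//]]] ?] [[|[|[|//]]] ?]; rewrite /s /s' -val_eqE; move=> /= tt;
    first [discriminate tt|by split; first [exact: Bneq|rewrite [X in _ != X]BC; exact: Bneq]].
have xinj : {in e &, injective (fun t => pair_exp (s t) (s' t))}.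
  move=> t t' /andP[st _] _ /eqP E; apply/eqP; apply: contraTT E => tt'.
  by apply/eqP; apply: pair_exp_neq => //; case: (sneq t t' tt').
apply: (@trop_signed_sum R _ K v w _ e _ (fun t : 'I_3 => val t == 1%N)
  (three_term M K S i j k l) xinj).
  rewrite [RHS]sum_ord3 /three_term !TB !pluecker_mul /e /s /s' -![val (Ordinal _)]/(_ : nat).
  rewrite expr0 expr1 !scale1r scaleN1r.
  by case: ifP => _; case: ifP => _; case: ifP => _; rewrite ?oppr0.
have wE t : e t -> exp_weight w (pair_exp (s t) (s' t)) = coord_ext w (s t) + coord_ext w (s' t).
  by move=> /andP[st st']; apply: pair_exp_weight.
have ex t t' : e t -> t' != t -> [/\ s t' \in bases M, s' t' \in bases M &
    coord_ext w (s t') + coord_ext w (s' t') <= coord_ext w (s t) + coord_ext w (s' t)] ->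
    exists t', [/\ e t', t' != t &
      exp_weight w (pair_exp (s t') (s' t')) <= exp_weight w (pair_exp (s t) (s' t))].
  move=> et tt [m1 m2 le]; have et' : e t' by rewrite /e m1.
  by exists t'; split=> //; rewrite !wE.
have LEat a b c d : perm_eq [:: a; b; c; d] [:: i; j; k; l] ->
    B a b \in bases M -> B c d \in bases M ->
    [/\ B a c \in bases M, B b d \in bases M & coord_ext w (B a c) + coord_ext w (B b d) <=
      coord_ext w (B a b) + coord_ext w (B c d)] \/
    [/\ B a d \in bases M, B b c \in bases M & coord_ext w (B a d) + coord_ext w (B b c) <=
      coord_ext w (B a b) + coord_ext w (B c d)].
  move=> pe; rewrite -!TB; apply: LE; first by rewrite (perm_uniq pe).
  have mem r : r \in [:: a; b; c; d] -> r \notin S.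
    by rewrite (perm_mem pe) !inE => /or4P[] /eqP ->.
  by rewrite !mem ?inE ?eqxx ?orbT.
move=> t et; case/andP: (et) => m1 m2; case: t et m1 m2 => [[|[|[|//]]] t3] et m1 m2.
- case: (LEat i j k l (perm_refl _) m1 m2) => H.
    by apply: (ex _ (Ordinal (isT : 1 < 3)%N)).
  by apply: (ex _ (Ordinal (isT : 2 < 3)%N)).
- have [|H|H] := LEat i k j l _ m1 m2; first by rewrite perm_cons (perm_catCA [:: k] [:: j] [:: l]).
    by apply: (ex _ (Ordinal (isT : 0 < 3)%N)).
  by apply: (ex _ (Ordinal (isT : 2 < 3)%N)) => //; rewrite /s /s' /= (BC j k).
have [|H|H] := LEat i l j k _ m1 m2.
- by rewrite perm_cons (perm_rot 2 [:: j; k; l]).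
- by apply: (ex _ (Ordinal (isT : 0 < 3)%N)) => //; rewrite /s /s' /= (BC k l).
by apply: (ex _ (Ordinal (isT : 1 < 3)%N)) => //; rewrite /s /s' /= (BC j l).
Qed.

End ExchangeDressian.

(** * A 2-adic valuation on the algebraic numbers *)

Section DyadicSubring.
Variable K : fieldType.
Implicit Types (A : set K) (x y z : K).

Record is_subring A : Prop := IsSubring {
  subring1 : A 1;
  subringB : forall x y, A x -> A y -> A (x - y);
  subringM : forall x y, A x -> A y -> A (x * y) }.

Lemma subring0 A : is_subring A -> A 0.
Proof. by move=> rA; rewrite -(subrr 1); apply: subringB => //; apply: subring1. Qed.

Lemma subringN A x : is_subring A -> A x -> A (- x).
Proof. by move=> rA Ax; rewrite -sub0r; apply: subringB => //; apply: subring0. Qed.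

Lemma subringD A x y : is_subring A -> A x -> A y -> A (x + y).
Proof. by move=> rA Ax Ay; rewrite -[y]opprK; apply: subringB => //; apply: subringN. Qed.

Lemma subringX A x n : is_subring A -> A x -> A (x ^+ n).
Proof.
move=> rA Ax; elim: n => [|n IHn]; first by rewrite expr0; apply: subring1.
by rewrite exprS; apply: subringM.
Qed.

Lemma subring_nat A n : is_subring A -> A n%:R.
Proof.
move=> rA; elim: n => [|n IHn]; first exact: subring0.
by rewrite -natr1; apply: subringD => //; apply: subring1.
Qed.

Lemma subring_sum A (J : Type) (r : seq J) (P : pred J) (F : J -> K) :
  is_subring A -> (forall j, P j -> A (F j)) -> A (\sum_(j <- r | P j) F j).
Proof.
move=> rA AF; apply: (big_ind A) => //; first exact: subring0.
by move=> x y; apply: subringD.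
Qed.

Lemma subring_adjoin A x : is_subring A ->
  is_subring [set y | exists2 p : {poly K}, (forall i, A p`_i) & y = p.[x]].
Proof.
move=> rA; split.
- exists 1; last by rewrite hornerC.
  by move=> i; rewrite coef1; apply: subring_nat.
- move=> _ _ [p Ap ->] [q Aq ->]; exists (p - q); last by rewrite !hornerE.
  by move=> i; rewrite coefB; apply: subringB.
- move=> _ _ [p Ap ->] [q Aq ->]; exists (p * q); last by rewrite hornerM.
  by move=> i; rewrite coefM; apply: subring_sum => // j _; apply: subringM.
Qed.

Hypothesis K0 : forall n, n.+1%:R != 0 :> K.

(** Such a subring turns out to be a valuation ring with 2 a nonunit, so Zorn's lemma stands in for
    extending the 2-adic valuation along algebraic extensions. *)
Lemma exists_maximal_subring : exists A, [/\ is_subring A, ~ A 2^-1 &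
  forall B, is_subring B -> ~ B 2^-1 -> A `<=` B -> B `<=` A].
Proof.
pose P := [set A : set K | A = set0 \/ (is_subring A /\ ~ A 2^-1)].
have [F FP Ftot|A [PA maxA]] := @Zorn_bigcup K P.
  have [[S [FS S0]]|all0] := pselect (exists S, F S /\ S <> set0); last first.
    left; rewrite -subset0 => x [S FS Sx]; apply: all0; exists S; split=> //.
    by move=> S0; rewrite S0 in Sx.
  have Fp T x : F T -> T x -> is_subring T /\ ~ T 2^-1.
    by move=> /FP [->//|].
  have [E|[rS nS]] := FP _ FS; first by [].
  have two x y : (\bigcup_(X in F) X) x -> (\bigcup_(X in F) X) y -> exists T, [/\ F T, T x & T y].
    move=> [T FT Tx] [U FU Uy]; have [TU|UT] := Ftot _ _ FT FU.
      by exists U; split=> //; apply: TU.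
    by exists T; split=> //; apply: UT.
  right; split.
    split; first by exists S => //; apply: subring1.
    - move=> x y /two h /h[T [FT Tx Ty]]; exists T => //.
      by have [rT _] := Fp _ _ FT Tx; apply: subringB.
    - move=> x y /two h /h[T [FT Tx Ty]]; exists T => //.
      by have [rT _] := Fp _ _ FT Tx; apply: subringM.
  by case=> T FT T2; case: (Fp _ _ FT T2).
have two0 : 2 != 0 :> K by apply: (K0 1).
have A0 : A <> set0.
  (* The image of the integers is a valid start: [1/2] in it would equate an odd and an even number,
     against characteristic 0. *)
  move=> A0; case: (maxA [set x | exists m n : nat, x = m%:R - n%:R]).
    by rewrite A0; split=> // /(_ 0) H; apply: H; exists 0%N, 0%N; rewrite subrr.
  right; split; first split.
  - by exists 1%N, 0%N; rewrite subr0.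
  - by move=> _ _ [m [n ->]] [m' [n' ->]]; exists (m + n')%N, (n + m')%N; rewrite !natrD; ring.
  - move=> _ _ [m [n ->]] [m' [n' ->]].
    by exists (m * m' + n * n')%N, (m * n' + n * m')%N; rewrite !natrD !natrM; ring.
  move=> [m [n E]].
  have {}E : (n * 2 + 1)%:R = (m * 2)%:R :> K.
    rewrite natrD !natrM; apply/eqP; rewrite -subr_eq0.
    have -> : n%:R * 2 + 1%:R - m%:R * 2 = 1 - (m%:R - n%:R) * 2 :> K by ring.
    by rewrite -E mulVf // subrr.
  have inj (a b : nat) : (a <= b)%N -> a%:R = b%:R :> K -> a = b.
    move=> ab /eqP; rewrite eq_sym -subr_eq0 -natrB //.
    by case E' : (b - a)%N => [|c]; [move: E'; lia | rewrite (negPf (K0 c))].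
  have [le|le] := leqP (n * 2 + 1) (m * 2).
    by have := inj _ _ le E; lia.
  by have := inj _ _ (ltnW le) (esym E); lia.
have [//|[rA nA]] := PA; exists A; split=> // B rB nB AB; apply: contrapT => BA.
by case: (maxA B); [split|right].
Qed.

Variable A : set K.
Hypotheses (rA : is_subring A) (A2 : ~ A 2^-1)
  (maxA : forall B, is_subring B -> ~ B 2^-1 -> A `<=` B -> B `<=` A).

Let two0 : 2 != 0 :> K. Proof. exact: (K0 1). Qed.

Lemma one_add_double_neq0 x : A x -> 1 + 2 * x != 0.
Proof.
move=> Ax; apply/eqP => E; apply: A2.
have -> : 2^-1 = - x by apply: (mulfI two0); rewrite mulfV // mulrN; apply/eqP; rewrite -addr_eq0 E.
exact: subringN.
Qed.

(** Inverting [u] does not create [1/2]: as [u ^+ n = 1 + 2 * c], having [2^-1 * u ^+ n] in [A]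
    would put [2^-1] in [A]. Maximality does the rest. *)
Lemma one_add_double_inv x : A x -> A (1 + 2 * x)^-1.
Proof.
move=> Ax; set u := 1 + 2 * x; have u0 : u != 0 by apply: one_add_double_neq0.
have Au : A u.
  by apply: subringD => //; [apply: subring1|apply: subringM => //; apply: subring_nat].
pose B := [set y | exists n, A (y * u ^+ n)].
have uX n : exists2 c, A c & u ^+ n = 1 + 2 * c.
  elim: n => [|n [c Ac E]]; first by exists 0; [apply: subring0 | rewrite expr0; ring].
  exists (x + c + 2 * x * c); last by rewrite exprS E /u; ring.
  apply: subringD => //; first exact: subringD.
  by apply: subringM => //; apply: subringM => //; apply: subring_nat.
have up m n y : A (y * u ^+ m) -> A (y * u ^+ (m + n)).
  by move=> H; rewrite exprD mulrA; apply: subringM => //; apply: subringX.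
apply: (maxA (B := B)).
- split.
  + by exists 0%N; rewrite mulr1; apply: subring1.
  + move=> y z [m Hy] [n Hz]; exists (m + n)%N; rewrite mulrBl.
    by apply: subringB => //; [apply: up | rewrite addnC; apply: up].
  + move=> y z [m Hy] [n Hz]; exists (m + n)%N.
    by rewrite exprD mulrACA; apply: subringM.
- case=> n; have [c Ac ->] := uX n; rewrite mulrDr mulr1 mulrA mulVf // mul1r => H.
  by apply: A2; rewrite -[2^-1](addrK c); apply: subringB.
- by move=> y Ay; exists 0%N; rewrite mulr1.
- by exists 1%N; rewrite expr1 mulVf //; apply: subring1.
Qed.

(** Membership of [1/2] in [A[x]], with a degree bound, freed of the inverse. *)
Let half_in x n := exists2 c : nat -> K, (forall i, A (c i)) & 1 = 2 * \sum_(i < n) c i * x ^+ i.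

Lemma half_in_adjoin x : ~ A x -> exists n, half_in x n.
Proof.
move=> nAx; pose B := [set y | exists2 p : {poly K}, (forall i, A p`_i) & y = p.[x]].
have AB : A `<=` B.
  move=> y Ay; exists y%:P; last by rewrite hornerC.
  by move=> i; rewrite coefC; case: ifP => // _; apply: subring0.
have [[p Ap E]|nB] := pselect (B 2^-1).
  exists (size p), (fun i => p`_i) => //; rewrite -horner_coef -E mulfV //.
case: nAx; apply: (maxA (B := B)) => //; first exact: subring_adjoin.
exists 'X; last by rewrite hornerX.
by move=> i; rewrite coefX; apply: subring_nat.
Qed.

Lemma half_in_pad x m n : (m <= n)%N -> half_in x m -> half_in x n.
Proof.
move=> mn [c Ac E]; exists (fun i => if (i < m)%N then c i else 0).
  by move=> i; case: ifP => // _; apply: subring0.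
rewrite [LHS]E; congr (_ * _).
rewrite (big_ord_widen n (fun i => c i * x ^+ i) mn) big_mkcond.
by apply: eq_bigr => i _; case: ifP => //; rewrite mul0r.
Qed.

(* Chevalley's argument: leading terms are eliminated simultaneously from an
   expression of 1/2 as a polynomial in [x] and one as a polynomial in [x^-1]. *)
Lemma half_in_descend x n : x != 0 -> half_in x n.+1 -> half_in x^-1 n.+1 -> half_in x n.
Proof.
move=> x0 [c Ac Ec] [b Ab Eb].
have Ab0 : A (- b 0%N) by apply: subringN.
pose u := (1 + 2 * - b 0%N)^-1.
have u0 : 1 + 2 * - b 0%N != 0 by apply: one_add_double_neq0.
have Au : A u by apply: one_add_double_inv.
(* Multiply the expression in [x^-1] by [x ^+ n] and move the term with [b 0] to the left: its
   coefficient [1 - 2 * b 0] is a unit of [A]. *)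
have xn : x ^+ n = 2 * \sum_(i < n) u * b (n - i)%N * x ^+ i.
  apply: (mulfI u0).
  have E : x ^+ n = 2 * \sum_(i < n.+1) b (n - i)%N * x ^+ i.
    rewrite -[LHS]mul1r {1}Eb -mulrA mulr_suml; congr (_ * _).
    rewrite [RHS](reindex_inj rev_ord_inj); apply: eq_bigr => i _ /=.
    rewrite subSS subKn ?leq_ord // -mulrA; congr (_ * _).
    by rewrite exprVn mulrC exprB ?unitfE ?leq_ord.
  rewrite big_ord_recr /= subnn in E.
  rewrite mulrDl mul1r {1}E; set s := \sum_(i < n) _; set t := \sum_(i < n) _.
  have -> : s = (1 + 2 * - b 0%N) * t.
    rewrite mulr_sumr; apply: eq_bigr => i _.
    by rewrite !mulrA [_ * u]mulfV // mul1r.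
  ring.
exists (fun i => c i + 2 * c n * u * b (n - i)%N).
  move=> i; apply: subringD => //; do 3!apply: subringM => //.
  exact: subring_nat.
rewrite [LHS]Ec big_ord_recr /= {1}xn; congr (_ * _).
rewrite mulrA mulr_sumr -big_split; apply: eq_bigr => i _ /=; ring.
Qed.

(** If both [x] and [x^-1] were missing, adjoining either would produce [1/2]; the two expressions,
    padded to a common length, descend together to the empty sum, giving [1 = 0]. *)
Lemma maximal_subring_total x : x != 0 -> A x \/ A x^-1.
Proof.
move=> x0; apply: contrapT => /not_orP[/half_in_adjoin[m hm] /half_in_adjoin[n hn]].
have : half_in x (m + n) /\ half_in x^-1 (m + n).
  by split; [apply: half_in_pad hm; apply: leq_addr|apply: half_in_pad hn; apply: leq_addl].
elim: (m + n)%N => [|r IHr] [h1 h2].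
  by case: h1 => c _; rewrite big_ord0 mulr0 => /eqP; rewrite oner_eq0.
apply: IHr; split; first exact: half_in_descend.
by apply: half_in_descend; rewrite ?invr_eq0 ?invrK.
Qed.

End DyadicSubring.

Section SubringValuation.
Variables (R : realType) (K : fieldType) (A : set K) (t : K).
Hypotheses (rA : is_subring A) (total : forall x, x != 0 -> A x \/ A x^-1).
Hypotheses (t0 : t != 0) (At : A t) (tV : ~ A t^-1).
Implicit Types (x y z : K).

Definition sub_unit x := [/\ x != 0, A x & A x^-1].

Lemma sub_unit1 : sub_unit 1.
Proof. by split; rewrite ?oner_neq0 ?invr1 //; apply: subring1. Qed.

Lemma sub_unitM x y : sub_unit x -> sub_unit y -> sub_unit (x * y).
Proof.
move=> [x0 Ax AxV] [y0 Ay AyV]; split; first by rewrite mulf_neq0.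
  exact: subringM.
by rewrite invfM; apply: subringM.
Qed.

Lemma sub_unitV x : sub_unit x -> sub_unit x^-1.
Proof. by move=> [x0 Ax AxV]; split; rewrite ?invrK ?invr_eq0. Qed.

Lemma sub_unitX x n : sub_unit x -> sub_unit (x ^+ n).
Proof.
move=> ux; elim: n => [|n IHn]; first exact: sub_unit1.
by rewrite exprS; apply: sub_unitM.
Qed.

Lemma sub_unitN x : sub_unit x -> sub_unit (- x).
Proof. by move=> [x0 Ax AxV]; split; rewrite ?oppr_eq0 // ?invrN; apply: subringN. Qed.

(** Equality up to a unit of [A], that is, having the same value. *)
Definition assoc x y := sub_unit (x / y).

Lemma assoc_sym x y : assoc x y -> assoc y x.
Proof. by move=> /sub_unitV; rewrite /assoc invfM invrK mulrC. Qed.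

Lemma assoc_neq0 x y : assoc x y -> x != 0 /\ y != 0.
Proof. by case; rewrite mulf_eq0 invr_eq0 negb_or => /andP. Qed.

Lemma assoc_trans y x z : assoc x y -> assoc y z -> assoc x z.
Proof.
move=> xy yz; have [_ y0] := assoc_neq0 xy.
have -> : assoc x z = sub_unit ((x / y) * (y / z)) by rewrite /assoc mulrA divfK.
exact: sub_unitM.
Qed.

Lemma assocM x y x' y' : assoc x y -> assoc x' y' -> assoc (x * x') (y * y').
Proof. by rewrite /assoc -mulf_div; apply: sub_unitM. Qed.

Lemma assocX x y n : assoc x y -> assoc (x ^+ n) (y ^+ n).
Proof. by rewrite /assoc -expr_div_n; apply: sub_unitX. Qed.

Lemma assocxx x : x != 0 -> assoc x x.
Proof. by move=> x0; rewrite /assoc divff //; apply: sub_unit1. Qed.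

Lemma sub_unit_1D x : A x -> ~ A x^-1 -> sub_unit (1 + x).
Proof.
move=> Ax nx; have x1 : 1 + x != 0.
  by apply/eqP => /eqP; rewrite addrC addr_eq0 => /eqP E; apply: nx; rewrite E invrN invr1 -E.
have [x0|x0] := eqVneq x 0; first by rewrite x0 addr0; apply: sub_unit1.
split=> //; first by apply: subringD => //; apply: subring1.
have [|H|H] := total (x := x / (1 + x)); first by rewrite mulf_neq0 ?invr_eq0.
  have -> : (1 + x)^-1 = 1 - x / (1 + x) by field.
  by apply: subringB => //; apply: subring1.
case: nx; have -> : x^-1 = (x / (1 + x))^-1 - 1 by field; rewrite x1.
by apply: subringB => //; apply: subring1.
Qed.

Lemma assoc_add x y : x != 0 -> y != 0 -> ~ assoc x y ->
  assoc (x + y) x \/ assoc (x + y) y.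
Proof.
move=> x0 y0 nxy; have yx0 : y / x != 0 by rewrite mulf_neq0 ?invr_eq0.
have [H|H] := total yx0; [left|right].
  have -> : assoc (x + y) x = sub_unit (1 + y / x) by rewrite /assoc mulrDl divff.
  apply: sub_unit_1D => // H'; apply: nxy; apply: assoc_sym; split=> //.
have -> : assoc (x + y) y = sub_unit (1 + x / y) by rewrite /assoc mulrDl divff // addrC.
have E : x / y = (y / x)^-1 by rewrite invfM invrK mulrC.
apply: sub_unit_1D; rewrite ?E ?invrK // => H'; apply: nxy.
by rewrite /assoc; split=> //; rewrite E ?invrK ?invr_eq0.
Qed.

(** By the ultrametric property, terms of pairwise distinct values cannot cancel. Its use is the
    converse: a vanishing sum has two terms of equal value. *)
Lemma sum_assoc (J : eqType) (s : seq J) (F : J -> K) : uniq s -> s != [::] ->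
  {in s, forall j, F j != 0} ->
  {in s &, forall i j, i != j -> ~ assoc (F i) (F j)} ->
  exists2 j, j \in s & assoc (\sum_(i <- s) F i) (F j).
Proof.
elim: s => // j s IHs /= /andP[js us] _ F0 Fn; rewrite big_cons.
have Fj : F j != 0 by apply: F0; rewrite mem_head.
have [->|sn] := eqVneq s [::].
  by exists j; rewrite ?mem_head // big_nil addr0; apply: assocxx.
have [||i is' ai] := IHs us sn.
- by move=> i is'; apply: F0; rewrite inE is' orbT.
- by move=> i i' is' i's; apply: Fn; rewrite inE ?is' ?i's orbT.
have ji : ~ assoc (F j) (F i).
  apply: Fn; rewrite ?mem_head // ?inE ?is' ?orbT //.
  by apply: contraNneq js => ->.
have [S0 _] := assoc_neq0 ai.
have [|H|H] := assoc_add Fj S0.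
- by move=> H; apply: ji; apply: assoc_trans ai.
- by exists j; rewrite ?mem_head.
- by exists i; rewrite ?inE ?is' ?orbT //; apply: assoc_trans ai.
Qed.

Lemma sub_unit_exprz (e : int) : sub_unit (t ^ e) -> e = 0.
Proof.
have pos n : sub_unit (t ^+ n) -> n = 0%N.
  case: n => // n [_ _ H]; case: tV.
  have -> : t^-1 = t ^+ n * (t ^+ n.+1)^-1.
    by rewrite exprS invfM mulrCA divff ?mulr1 // expf_neq0.
  by apply: subringM => //; apply: subringX.
case: e => n; first by move=> /pos ->.
by rewrite NegzE -exprnN => /sub_unitV; rewrite invrK => /pos.
Qed.

(** No value group is built: the value, normalized to 1 at [t], is read off from a power of [x]
    associated to a power of [t]. *)
Definition has_value x (r : R) := exists i (e : int), [/\ (0 < i)%N, assoc (x ^+ i) (t ^ e) &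
  r = e%:~R / i%:R].

Lemma assoc_exprz (e f : int) : assoc (t ^ e) (t ^ f) -> e = f.
Proof.
rewrite /assoc => H; apply/eqP; rewrite -subr_eq0; apply/eqP/sub_unit_exprz.
by rewrite expfzDr // -invr_expz.
Qed.

Lemma exprzX (e : int) n : (t ^ e) ^+ n = t ^ (e * n%:Z).
Proof. by rewrite exprnP exprz_exp. Qed.

Lemma has_value_uniq x r s : has_value x r -> has_value x s -> r = s.
Proof.
move=> [i [e [i0 xe ->]]] [j [f [j0 xf ->]]].
have := assocX j xe; have := assocX i xf; rewrite -!exprM !exprzX (mulnC j).
move=> h1 /assoc_sym/assoc_trans/(_ h1)/assoc_exprz E.
have i0' : (i%:R : R) != 0 by rewrite pnatr_eq0 -lt0n.
have j0' : (j%:R : R) != 0 by rewrite pnatr_eq0 -lt0n.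
apply/eqP; rewrite eqr_div //; apply/eqP.
by have := congr1 (fun e : int => e%:~R : R) E; rewrite /= !rmorphM.
Qed.

Lemma has_valueM x y r s : has_value x r -> has_value y s -> has_value (x * y) (r + s).
Proof.
move=> [i [e [i0 xe ->]]] [j [f [j0 yf ->]]]; exists (i * j)%N, (e * j%:Z + f * i%:Z).
split; first by rewrite muln_gt0 i0.
- rewrite exprMn exprM mulnC exprM expfzDr // -!exprzX.
  by apply: assocM; apply: assocX.
- have i0' : (i%:R : R) != 0 by rewrite pnatr_eq0 -lt0n.
  have j0' : (j%:R : R) != 0 by rewrite pnatr_eq0 -lt0n.
  rewrite natrM intrD !intrM; field.
  by rewrite i0' j0'.
Qed.

(** For a nonnegative exponent [x ^+ i] is in [A], and if [x] were not, [x^-1] would be, hence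
    [x = x ^+ i * x^-1 ^+ i.-1] too. For a negative exponent, [x] in [A] would put [t^-1] in [A]. *)
Lemma has_value_ge0 x r : has_value x r -> 0 <= r <-> A x.
Proof.
move=> [i [e [i0 xe ->]]]; have [xi0 _] := assoc_neq0 xe.
have x0 : x != 0 by apply: contraNneq xi0 => ->; rewrite expr0n gtn_eqF.
have [_ xt xtV] := xe.
have -> : 0 <= (e%:~R / i%:R : R) = (0 <= e).
  by rewrite pmulr_lge0 ?invr_gt0 ?ltr0n // ler0z.
split=> [|Ax].
  case: e xe xt xtV => // n xe xt xtV _; apply: contrapT => nAx.
  have AxV : A x^-1 by case: (total x0).
  apply: nAx; have -> : x = x ^+ i * (x^-1) ^+ i.-1.
    by rewrite exprVn -[in x ^+ i](prednK i0) exprSr mulrAC divff ?mul1r // expf_neq0.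
  apply: subringM => //; last exact: subringX.
  rewrite -[x ^+ i](divfK (_ : t ^+ n != 0)) ?expf_neq0 //.
  by apply: subringM => //; apply: subringX.
case: e xe xt xtV => // n xe xt; rewrite NegzE -exprnN invfM !invrK => xtV.
case: tV; have -> : t^-1 = (x ^- i * t ^- n.+1) * (x ^+ i * t ^+ n).
  rewrite exprS invfM; field.
  by rewrite t0 !expf_neq0.
apply: subringM => //; apply: subringM => //; exact: subringX.
Qed.

Lemma has_value_t : has_value t 1.
Proof. by exists 1%N, 1; split=> //; [rewrite expr1z expr1; apply: assocxx|rewrite divr1]. Qed.

Hypothesis valued : forall x, x != 0 -> exists r, has_value x r.

Definition subring_val x : \bar R :=
  if pselect (exists r, has_value x r) is left h then (projT1 (cid h))%:E else +oo%E.

Lemma has_value_neq0 x r : has_value x r -> x != 0.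
Proof.
move=> [i [e [i0 xe _]]]; have [xi0 _] := assoc_neq0 xe.
by apply: contraNneq xi0 => ->; rewrite expr0n gtn_eqF.
Qed.

Lemma subring_valE x r : has_value x r -> subring_val x = r%:E.
Proof.
move=> h; rewrite /subring_val; case: pselect => [h'|[]]; last by exists r.
by congr (_%:E); case: cid => s /= hs; apply: has_value_uniq hs h.
Qed.

Lemma subring_val0 : subring_val 0 = +oo%E.
Proof.
rewrite /subring_val; case: pselect => // h; exfalso; case: h => r.
by move=> /has_value_neq0; rewrite eqxx.
Qed.

Lemma exists_subring_valuation : exists v : valuation R K, v t = 1%:E.
Proof.
have gtNy x : (-oo < subring_val x)%E.
  rewrite /subring_val; case: pselect => [h|_]; last by rewrite ltNye.
  by rewrite ltNyr.
have eqy x : subring_val x = +oo%E <-> x = 0.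
  split=> [E|->]; last exact: subring_val0.
  have [//|x0] := eqVneq x 0; have [r /subring_valE] := valued x0.
  by rewrite E.
have valM x y : subring_val (x * y) = (subring_val x + subring_val y)%E.
  have [->|x0] := eqVneq x 0; first by rewrite mul0r subring_val0 addye // gt_eqF.
  have [->|y0] := eqVneq y 0; first by rewrite mulr0 subring_val0 addey // gt_eqF.
  have [r hr] := valued x0; have [s hs] := valued y0.
  by rewrite (subring_valE hr) (subring_valE hs) (subring_valE (has_valueM hr hs)).
have valDle x y : x != 0 -> y != 0 -> (subring_val x <= subring_val y)%E ->
    (subring_val x <= subring_val (x + y))%E.
  move=> x0 y0; have [r hr] := valued x0; have [s hs] := valued y0.
  have [q hq] : exists q, has_value (y / x) q by apply: valued; rewrite mulf_neq0 ?invr_eq0.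
  have sE : s = q + r by apply: has_value_uniq hs _; have := has_valueM hq hr; rewrite divfK.
  rewrite (subring_valE hr) (subring_valE hs) lee_fin sE lerDr => /(has_value_ge0 hq) Aq.
  have -> : x + y = x * (1 + y / x) by field.
  have [->|n0] := eqVneq (1 + y / x) 0; first by rewrite mulr0 subring_val0 leey.
  have [p hp] := valued n0; rewrite valM (subring_valE hr) (subring_valE hp).
  rewrite lee_fin lerDl; apply/(has_value_ge0 hp).
  by apply: subringD => //; apply: subring1.
have valD x y : (Order.min (subring_val x) (subring_val y) <= subring_val (x + y)%R)%E.
  have [->|x0] := eqVneq x 0; first by rewrite add0r ge_min lexx orbT.
  have [->|y0] := eqVneq y 0; first by rewrite addr0 ge_min lexx.
  rewrite ge_min; have [xy|/ltW yx] := leP (subring_val x) (subring_val y).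
    by rewrite valDle.
  by rewrite addrC [X in _ || X]valDle ?orbT.
exists (Valuation gtNy eqy valM valD) => /=.
exact: subring_valE has_value_t.
Qed.

End SubringValuation.

Section AlgebraicValuation.

Let K0 n : n.+1%:R != 0 :> algC.
Proof. by rewrite pnatr_eq0. Qed.

(** Odd integers have the form [1 + 2 * n], hence are units, so nonzero rationals are associated to
    powers of 2. Two terms of equal value in the minimal polynomial of [x] make [x ^+ (i - j)]
    associated to a rational. *)
Lemma algC_dyadic_valuation (R : realType) : exists v : valuation R algC, v 2 = 1%:E.
Proof.
have [A [rA A2 maxA]] := exists_maximal_subring K0.
have total := maximal_subring_total K0 rA A2 maxA.
have two0 : 2 != 0 :> algC by apply: (K0 1).
apply: (@exists_subring_valuation R _ A 2) => //; first exact: subring_nat.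
have odd_unit n : sub_unit A (1 + 2 * n%:R).
  have An : A n%:R by apply: subring_nat.
  split; [exact: (one_add_double_neq0 K0 rA A2)| |exact: (one_add_double_inv K0 rA A2 maxA)].
  by apply: subringD => //; [apply: subring1|apply: subringM => //; apply: subring_nat].
have nat_assoc n : (0 < n)%N -> exists e : int, assoc A n%:R (2 ^ e).
  have [m] := ubnP n; elim: m n => // m IHm n nm n0.
  have [on|en] := boolP (odd n).
    exists 0; rewrite /assoc expr0z divr1 -(odd_double_half n) on natrD -mul2n natrM.
    exact: odd_unit.
  have nE : n = (2 * n./2)%N by rewrite mul2n -[LHS]odd_double_half (negPf en).
  have [||e he] := IHm n./2; try lia.
  exists (1 + e); rewrite nE natrM expfzDr // expr1z.
  by apply: assocM => //; apply: assocxx.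
have int_assoc (z : int) : z != 0 -> exists e : int, assoc A z%:~R (2 ^ e).
  case: z => n nz; first by apply: nat_assoc; rewrite lt0n.
  have [e he] := nat_assoc n.+1 isT; exists e.
  by rewrite NegzE rmorphN /assoc mulNr; apply: sub_unitN.
have rat_assoc (c : rat) : c != 0 -> exists e : int, assoc A (ratr c) (2 ^ e).
  move=> c0; have [|e he] := int_assoc (numq c); first by rewrite numq_eq0.
  have [|f hf] := int_assoc (denq c); first by rewrite denq_eq0.
  exists (e - f); rewrite /ratr expfzDr // -invr_expz; apply: assocM => //.
  by rewrite /assoc -invfM; apply: sub_unitV.
move=> x x0.
have [p [_ pmon] proot] := minCpolyP x.
have px : root (map_poly ratr p : {poly algC}) x by rewrite proot dvdpp.
pose s := [seq i <- iota 0 (size p) | p`_i != 0].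
pose F i : algC := ratr p`_i * x ^+ i.
have sumF : \sum_(i <- s) F i = 0.
  rewrite big_filter -[RHS](rootP px) horner_coef size_map_poly.
  rewrite -(big_mkord xpredT (fun i => (map_poly ratr p : {poly algC})`_i * x ^+ i)).
  rewrite /index_iota subn0.
  rewrite big_mkcond; apply: eq_bigr => i _; rewrite coef_map /F.
  by case: eqP => //= ->; rewrite rmorph0 mul0r.
have F0 : {in s, forall j, F j != 0}.
  move=> j; rewrite mem_filter => /andP[pj _].
  by rewrite mulf_neq0 ?expf_neq0 // fmorph_eq0.
have [i [j [is' js ij aij]]] : exists i j, [/\ i \in s, j \in s, i != j & assoc A (F i) (F j)].
  apply: contrapT => no.
  have us : uniq s by rewrite filter_uniq ?iota_uniq.
  have sn : s != [::].
    apply/eqP => s0; have : (size p).-1 \in s; last by rewrite s0.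
    have p0 : (0 < size p)%N by rewrite size_poly_gt0 monic_neq0.
    rewrite mem_filter mem_iota add0n leq0n /= prednK // leqnn andbT.
    by rewrite -/(lead_coef p) (monicP pmon) oner_neq0.
  have Fn : {in s &, forall i j, i != j -> ~ assoc A (F i) (F j)}.
    by move=> i j is' js ij aij; apply: no; exists i, j.
  have [j js] := sum_assoc rA total us sn F0 Fn.
  by rewrite sumF => /assoc_neq0[]; rewrite eqxx.
wlog ltji : i j is' js ij aij / (j < i)%N => [hw|].
  have [ji|ij'|E] := ltngtP j i; first exact: (hw i j).
    by apply: (hw j i) => //; [rewrite eq_sym|apply: assoc_sym].
  by rewrite E eqxx in ij.
have [pi0 pj0] : p`_i != 0 /\ p`_j != 0.
  by move: is' js; rewrite !mem_filter => /andP[-> _] /andP[-> _].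
have [e he] := rat_assoc (p`_j / p`_i) (mulf_neq0 pj0 (invr_neq0 pi0)).
exists (e%:~R / (i - j)%:R), (i - j)%N, e; split=> //; first by rewrite subn_gt0.
apply: assoc_trans he => //.
rewrite /assoc; have -> : x ^+ (i - j) / ratr (p`_j / p`_i) = F i / F j :> algC.
  rewrite /F exprB ?unitfE // 1?ltnW // fmorph_div; field.
  by rewrite !fmorph_eq0 pi0 pj0 expf_neq0.
exact: aij.
Qed.

End AlgebraicValuation.

(** * The Fano and non-Fano matroids *)

Section SevenPoints.
Variable L : seq (seq nat).
Implicit Types (s t : {set 'I_7}) (i j k : 'I_7).

Definition collinear (a b c : nat) : bool := has (fun l => [&& a \in l, b \in l & c \in l]) L.

Definition line_span (b c : nat) : seq nat :=
  [seq y <- iota 0 7 | [|| y == b, y == c | collinear y b c]].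

(** What rank 3 exchange needs, over [nat] so that it computes: if no point of a basis [t] completes
    [b], [c] to a basis, then [t] lies in [line_span b c], and this check makes [t] collinear. *)
Definition linear_space : bool :=
  all (fun b => all (fun c => (b != c) ==>
    all (fun x => all (fun y => all (fun z => uniq [:: x; y; z] ==> collinear x y z)
      (line_span b c)) (line_span b c)) (line_span b c)) (iota 0 7)) (iota 0 7).

Definition noncollinear_triples : {set {set 'I_7}} :=
  [set s : {set 'I_7} | (#|s| == 3)%N && ~~ has (fun l => [forall i in s, val i \in l]) L]%SET.

Lemma triple_set s : #|s| = 3 -> exists i j k, uniq [:: i; j; k] /\ s = [set i; j; k]%SET.
Proof.
move=> cs; have /card_gt0P[i si] : (0 < #|s|)%N by rewrite cs.
have /cards2P[j [k [jk sE]]] : #|s :\ i| == 2.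
  by have := cardsD1 i s; rewrite si cs add1n => -[<-].
have sjk z : (z \in s) && (z != i) = (z == j) || (z == k).
  by have /setP/(_ z) := sE; rewrite !inE andbC.
have := sjk i; rewrite eqxx andbF => /esym/negbT; rewrite negb_or => /andP[ij ik].
exists i, j, k; split; first by rewrite /= !inE negb_or ij ik jk.
by rewrite -(finset.setD1K si) sE finset.setUA.
Qed.

Lemma card_triple i j k : uniq [:: i; j; k] -> #|[set i; j; k]%SET| = 3.
Proof.
rewrite /= !inE negb_or => /and3P[/andP[ij ik] jk _].
by rewrite -finset.setUA cardsU1 cards2 !inE negb_or ij ik jk.
Qed.

Lemma in_noncollinear i j k : uniq [:: i; j; k] ->
  ([set i; j; k]%SET \in noncollinear_triples) = ~~ collinear i j k.
Proof.
move=> u; rewrite inE card_triple // eqxx /=; congr (~~ _); apply: eq_has => l.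
apply/forall_inP/and3P => [H|[li lj lk] z].
  by split; apply: H; rewrite !inE eqxx ?orbT.
by rewrite !inE => /orP[/orP[]|] /eqP ->.
Qed.

Lemma seven_iota i : (i : nat) \in iota 0 7.
Proof. by rewrite mem_iota ltn_ord. Qed.

Lemma seven_point_matroid : linear_space -> ~~ collinear 0 1 3 ->
  exists M : matroid 7, rank M = 3 /\ bases M = noncollinear_triples.
Proof.
move=> lin nc.
have neq0 : noncollinear_triples != finset.set0.
  apply/set0Pn; exists [set (@Ordinal 7 0 isT); (@Ordinal 7 1 isT); (@Ordinal 7 3 isT)]%SET.
  by rewrite in_noncollinear.
have card s : s \in noncollinear_triples -> #|s| = 3.
  by rewrite inE => /andP[/eqP].
have exch s t : s \in noncollinear_triples -> t \in noncollinear_triples ->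
    forall x, x \in s :\: t -> exists2 y, y \in t :\: s & y |: (s :\ x) \in noncollinear_triples.
  move=> sB tB x; rewrite inE => /andP[xt xs].
  have /cards2P[b [c [bc sE]]] : #|s :\ x| == 2.
    by have := cardsD1 x s; rewrite xs (card _ sB) add1n => -[<-].
  have [d [e [f [u tE]]]] := triple_set (card _ tB).
  have ncT : ~~ collinear d e f by rewrite -in_noncollinear // -tE.
  have span y : y \in t -> (forall y, y \in t :\: s -> y |: (s :\ x) \notin noncollinear_triples) ->
      (y : nat) \in line_span b c.
    move=> yt no; rewrite mem_filter seven_iota andbT; apply: contraT; rewrite !negb_or.
    rewrite -[(y : nat) == b]/(y == b) -[(y : nat) == c]/(y == c) => /and3P[yb yc ync].
    have yx : y != x by apply: contraNneq xt => <-.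
    have ys : y \notin s.
      have /setP/(_ y) := sE; rewrite !inE yx (negPf yb) (negPf yc) /= => ->.
      by [].
    have := no y; rewrite inE ys yt sE => /(_ isT).
    by rewrite finset.setUA in_noncollinear ?ync // /= !inE negb_or yb yc bc.
  apply: contrapT => nex.
  have no y : y \in t :\: s -> y |: (s :\ x) \notin noncollinear_triples.
    by move=> yt; apply/negP => H; apply: nex; exists y.
  have tS y : y \in [:: d; e; f] -> y \in t by rewrite tE !inE orbA.
  have sp y : y \in [:: d; e; f] -> (y : nat) \in line_span b c by move=> /tS yt; apply: span.
  have := lin => /allP/(_ _ (seven_iota b))/allP/(_ _ (seven_iota c)).
  rewrite -[(b : nat) == c]/(b == c) bc.
  move=> /allP/(_ d (sp d _))/allP/(_ e (sp e _))/allP/(_ f (sp f _)).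
  rewrite !inE !eqxx !orbT => /(_ isT isT isT).
  have -> : uniq [:: (d : nat); (e : nat); (f : nat)] by rewrite -(map_inj_uniq val_inj) in u.
  by rewrite (negPf ncT).
by exists (Matroid neq0 card exch).
Qed.

End SevenPoints.

Section ThreeVectors.
Variable F : fieldType.
Implicit Types (x y z a b c d : 'rV[F]_3).

(** Expanded explicitly, so that [ring] proves the Pluecker and sign identities. *)
Definition det3 x y z : F :=
  let X (i : nat) := x 0 (inord i) in let Y i := y 0 (inord i) in let Z i := z 0 (inord i) in
  X 0%N * (Y 1%N * Z 2%N - Y 2%N * Z 1%N) - X 1%N * (Y 0%N * Z 2%N - Y 2%N * Z 0%N)
  + X 2%N * (Y 0%N * Z 1%N - Y 1%N * Z 0%N).

Lemma det3_pluecker s a b c d : det3 s a b * det3 s c d - det3 s a c * det3 s b d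
  + det3 s a d * det3 s b c = 0.
Proof. by rewrite /det3; ring. Qed.

Lemma det3_swap12 x y z : det3 y x z = - det3 x y z.
Proof. by rewrite /det3; ring. Qed.

Lemma det3_swap23 x y z : det3 x z y = - det3 x y z.
Proof. by rewrite /det3; ring. Qed.

Lemma basis3P x y z : basis_of fullv [:: x; y; z] = (det3 x y z != 0).
Proof.
pose A : 'M[F]_3 := \matrix_(i < 3) [:: x; y; z]`_i.
have detA : \det A = det3 x y z.
  rewrite (expand_det_row _ 0) !big_ord_recl big_ord0 /cofactor.
  rewrite !(expand_det_row _ 0) !big_ord_recl !big_ord0 /cofactor !det_mx11 !mxE /=.
  have ext (u : 'rV[F]_3) : exists U : nat -> F, forall t, u 0 t = U (val t).
    by exists (fun i => u 0 (inord i)) => t; rewrite inord_val.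
  have [[X xE] [Y yE] [Z zE]] := And3 (ext x) (ext y) (ext z).
  by rewrite /det3 !xE !yE !zE /= !inordK //= /bump /=; ring.
have sz : size [:: x; y; z] = 3 by [].
rewrite basisEfree subvf dimvf /dim /= mul1n leqnn andbT -detA.
apply/idP/idP => [fr|/negP dn0].
  apply/negP => /det0P[u un0 uA]; case/negP: un0; apply/eqP/rowP => i; rewrite mxE.
  have /freeP H : free (in_tuple [:: x; y; z]) by [].
  apply: (H (u 0)); rewrite -[RHS]uA mulmx_sum_row; apply: eq_bigr => j _.
  by rewrite rowK.
have -> : free [:: x; y; z] = free (in_tuple [:: x; y; z]) by [].
apply/freeP => c c0 i; apply: contrapT => ci; apply: dn0; apply/det0P.
exists (\row_j c j); first by apply/eqP => /rowP/(_ i); rewrite !mxE.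
by rewrite mulmx_sum_row -[RHS]c0; apply: eq_bigr => j _; rewrite rowK mxE.
Qed.

End ThreeVectors.

(** Points 2, 4, 5 are the diagonal points of the quadrangle 0, 1, 3, 6. They are collinear exactly
    in characteristic 2, and their line is the one left out of [nonfano_lines]. *)
Definition fano_lines : seq (seq nat) :=
  [:: [:: 0; 1; 2]; [:: 0; 3; 4]; [:: 1; 3; 5]; [:: 0; 5; 6]; [:: 1; 4; 6]; [:: 2; 3; 6];
      [:: 2; 4; 5]]%N.

Definition nonfano_lines : seq (seq nat) :=
  [:: [:: 0; 1; 2]; [:: 0; 3; 4]; [:: 1; 3; 5]; [:: 0; 5; 6]; [:: 1; 4; 6]; [:: 2; 3; 6]]%N.

Lemma exists_fano : exists M : matroid 7, rank M = 3 /\ bases M = noncollinear_triples fano_lines.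
Proof. by apply: seven_point_matroid; vm_compute. Qed.

Lemma exists_nonfano :
  exists M : matroid 7, rank M = 3 /\ bases M = noncollinear_triples nonfano_lines.
Proof. by apply: seven_point_matroid; vm_compute. Qed.

(* The product lets [ring] derive [x = y] from [e = 0] whatever the sign of [e]. *)
Lemma eq_of_sub0 (F : fieldType) (x y e : F) : e = 0 -> (x - y - e) * (x - y + e) = 0 -> x = y.
Proof. by move=> ->; rewrite subr0 addr0 => /eqP; rewrite mulf_eq0 orbb subr_eq0 => /eqP. Qed.

(* Writing [p] for the determinants of the points, the six common lines of the Fano
   and non-Fano configurations force [p013^2 * p245 = - 2 * p014 * p035 * p123]. *)
Lemma seven_point_realizable (F : fieldType) (L : seq (seq nat)) (M : matroid 7) :
  rank M = 3 -> bases M = noncollinear_triples L ->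
  (forall a b c, (a < b < c)%N -> (c < 7)%N -> collinear L a b c =
     collinear nonfano_lines a b c || (collinear L 2 4 5 && ((a, b, c) == (2, 4, 5))%N)) ->
  realizable M F -> (2 == 0 :> F) = collinear L 2 4 5.
Proof.
move=> rM bM LE [v vM]; move: v vM; rewrite rM => v vM.
pose P a b c := det3 (v (inord a)) (v (inord b)) (v (inord c)).
have PE a b c : (a < b < c)%N -> (c < 7)%N -> (P a b c == 0) = collinear L a b c.
  move=> abc c7; apply/negb_inj.
  have u : uniq [:: inord a; inord b; inord c : 'I_7].
    by rewrite /= !inE -!val_eqE /= !inordK; lia.
  have := vM [set inord a; inord b; inord c]%SET.
  rewrite bM in_noncollinear // !inordK; try lia.
  suff -> : basis_of fullv [seq v i | i <- enum [set inord a; inord b; inord c : 'I_7]%SET] =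
      (P a b c != 0).
    by move=> H; apply/idP/idP => /H.
  rewrite -basis3P; apply: perm_basis.
  rewrite -[X in perm_eq _ X]/(map v [:: inord a; inord b; inord c]); apply: perm_map.
  apply: uniq_perm => //; first exact: enum_uniq.
  by move=> z; rewrite mem_enum !inE orbA.
have P0 a b c : (a < b < c)%N -> (c < 7)%N -> collinear nonfano_lines a b c -> P a b c = 0.
  by move=> abc c7 H; apply/eqP; rewrite PE // LE // H.
have Pn a b c : (a < b < c)%N -> (c < 7)%N -> ~~ collinear nonfano_lines a b c ->
    (a, b, c) != (2, 4, 5)%N -> P a b c != 0.
  by move=> abc c7 H1 H2; rewrite PE // LE // (negPf H1) (negPf H2) andbF.
have [z012 [z034 [z135 [z056 [z146 z236]]]]] : P 0%N 1%N 2%N = 0 /\ P 0%N 3%N 4%N = 0 /\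
    P 1%N 3%N 5%N = 0 /\ P 0%N 5%N 6%N = 0 /\ P 1%N 4%N 6%N = 0 /\ P 2%N 3%N 6%N = 0.
  by do !split; apply: P0.
have n013 : P 0%N 1%N 3%N != 0 by apply: Pn.
have n014 : P 0%N 1%N 4%N != 0 by apply: Pn.
have n023 : P 0%N 2%N 3%N != 0 by apply: Pn.
have n035 : P 0%N 3%N 5%N != 0 by apply: Pn.
have n123 : P 1%N 2%N 3%N != 0 by apply: Pn.
have n136 : P 1%N 3%N 6%N != 0 by apply: Pn.
have n036 : P 0%N 3%N 6%N != 0 by apply: Pn.
have pl s a b c d : P s a b * P s c d - P s a c * P s b d + P s a d * P s b c = 0.
  exact: det3_pluecker.
have s12 a b c : P b a c = - P a b c by apply: det3_swap12.
have s23 a b c : P a c b = - P a b c by apply: det3_swap23.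
(* Each of [r1] to [r8] is a three-term Pluecker relation; in all but [r4] one product vanishes by a
   collinearity. *)
have r1 : P 0%N 1%N 5%N * P 0%N 3%N 6%N = P 0%N 1%N 6%N * P 0%N 3%N 5%N.
  have := pl 0%N 1%N 3%N 5%N 6%N.
  rewrite z056 => E.
  apply: (eq_of_sub0 E). ring.
have r2 : P 0%N 1%N 4%N * P 1%N 3%N 6%N = P 0%N 1%N 6%N * P 1%N 3%N 4%N.
  have := pl 1%N 0%N 3%N 4%N 6%N.
  rewrite (s12 0%N 1%N 3%N) (s12 0%N 1%N 4%N) (s12 0%N 1%N 6%N) z146 => E.
  apply: (eq_of_sub0 E). ring.
have r3 : P 0%N 2%N 3%N * P 1%N 3%N 6%N = P 0%N 3%N 6%N * P 1%N 2%N 3%N.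
  have := pl 3%N 0%N 1%N 2%N 6%N.
  rewrite (s12 0%N 3%N 1%N) (s23 0%N 1%N 3%N) (s12 2%N 3%N 6%N) (s12 0%N 3%N 2%N)
    (s23 0%N 2%N 3%N) (s12 1%N 3%N 6%N) (s12 0%N 3%N 6%N) (s12 1%N 3%N 2%N)
    (s23 1%N 2%N 3%N) z236 => E.
  apply: (eq_of_sub0 E). ring.
have r4 : P 0%N 2%N 3%N * P 2%N 4%N 5%N =
    P 0%N 2%N 4%N * P 2%N 3%N 5%N - P 0%N 2%N 5%N * P 2%N 3%N 4%N.
  have := pl 2%N 0%N 3%N 4%N 5%N.
  rewrite (s12 0%N 2%N 3%N) (s12 0%N 2%N 4%N) (s12 0%N 2%N 5%N) => E.
  apply: (eq_of_sub0 E). ring.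
have r5 : P 0%N 1%N 3%N * P 2%N 3%N 5%N = - (P 0%N 3%N 5%N * P 1%N 2%N 3%N).
  have := pl 3%N 0%N 1%N 2%N 5%N.
  rewrite (s12 0%N 3%N 1%N) (s23 0%N 1%N 3%N) (s12 2%N 3%N 5%N) (s12 0%N 3%N 2%N)
    (s23 0%N 2%N 3%N) (s12 1%N 3%N 5%N) (s12 0%N 3%N 5%N) (s12 1%N 3%N 2%N)
    (s23 1%N 2%N 3%N) z135 => E.
  apply: (eq_of_sub0 E). ring.
have r6 : P 0%N 1%N 3%N * P 2%N 3%N 4%N = P 0%N 2%N 3%N * P 1%N 3%N 4%N.
  have := pl 3%N 0%N 1%N 2%N 4%N.
  rewrite (s12 0%N 3%N 1%N) (s23 0%N 1%N 3%N) (s12 2%N 3%N 4%N) (s12 0%N 3%N 2%N)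
    (s23 0%N 2%N 3%N) (s12 1%N 3%N 4%N) (s12 0%N 3%N 4%N) (s12 1%N 3%N 2%N)
    (s23 1%N 2%N 3%N) z034 => E.
  apply: (eq_of_sub0 E). ring.
have r7 : P 0%N 1%N 3%N * P 0%N 2%N 4%N = P 0%N 1%N 4%N * P 0%N 2%N 3%N.
  have := pl 0%N 1%N 2%N 3%N 4%N.
  rewrite z012 => E.
  apply: (eq_of_sub0 E). ring.
have r8 : P 0%N 1%N 3%N * P 0%N 2%N 5%N = P 0%N 1%N 5%N * P 0%N 2%N 3%N.
  have := pl 0%N 1%N 2%N 3%N 5%N.
  rewrite z012 => E.
  apply: (eq_of_sub0 E). ring.
pose X := P 0%N 1%N 4%N * P 0%N 3%N 5%N * P 1%N 2%N 3%N.
(* Point 6 is eliminated here: [r1], [r2] and [r3] are the relations that involve it. *)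
have XE : X = P 0%N 1%N 5%N * P 0%N 2%N 3%N * P 1%N 3%N 4%N.
  apply: (mulfI n136); apply: (mulfI n036).
  transitivity (P 0%N 3%N 6%N * (P 0%N 1%N 4%N * P 1%N 3%N 6%N) * P 0%N 3%N 5%N * P 1%N 2%N 3%N).
    by rewrite /X; ring.
  transitivity ((P 0%N 1%N 6%N * P 0%N 3%N 5%N) * (P 0%N 3%N 6%N * P 1%N 2%N 3%N) * P 1%N 3%N 4%N).
    by rewrite r2; ring.
  by rewrite -r1 -r3; ring.
(* The expansion [r4] of the determinant of 2, 4, 5 has two terms which [XE] shows to be equal
   rather than opposite; this is the origin of the factor 2. *)
have key : P 0%N 1%N 3%N ^+ 2 * P 2%N 4%N 5%N = - (2 * X).
  apply: (mulfI n023).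
  transitivity (P 0%N 1%N 3%N ^+ 2 * (P 0%N 2%N 3%N * P 2%N 4%N 5%N)); first by ring.
  transitivity ((P 0%N 1%N 3%N * P 0%N 2%N 4%N) * (P 0%N 1%N 3%N * P 2%N 3%N 5%N)
    - (P 0%N 1%N 3%N * P 0%N 2%N 5%N) * (P 0%N 1%N 3%N * P 2%N 3%N 4%N)).
    by rewrite r4; ring.
  rewrite r5 r6 r7 r8.
  transitivity (- P 0%N 2%N 3%N * (X + P 0%N 1%N 5%N * P 0%N 2%N 3%N * P 1%N 3%N 4%N)).
    by rewrite /X; ring.
  by rewrite -XE; ring.
rewrite -(PE 2 4 5)%N //; have := congr1 (fun z => z == 0) key.
rewrite /= oppr_eq0 /X !mulf_eq0.
by rewrite (negPf n013) (negPf n014) (negPf n035) (negPf n123) /= !orbF => ->.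
Qed.

Lemma fano_not_realizable (F : fieldType) (M : matroid 7) : 2 != 0 :> F ->
  rank M = 3 -> bases M = noncollinear_triples fano_lines -> ~ realizable M F.
Proof.
move=> two0 rM bM rz; case/negP: two0.
rewrite (seven_point_realizable rM bM _ rz) // => a b c abc c7.
have : all (fun a => all (fun b => all (fun c => (a < b < c)%N ==>
    (collinear fano_lines a b c ==
     collinear nonfano_lines a b c || ((a, b, c) == (2, 4, 5))%N))
    (iota 0 7)) (iota 0 7)) (iota 0 7).
  by vm_compute.
have [aI bI cI] : [/\ a \in iota 0 7, b \in iota 0 7 & c \in iota 0 7].
  by rewrite !mem_iota; split; lia.
by move=> /allP/(_ a aI)/allP/(_ b bI)/allP/(_ c cI)/implyP/(_ abc)/eqP.
Qed.

Lemma nonfano_not_realizable (F : fieldType) (M : matroid 7) : 2 = 0 :> F ->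
  rank M = 3 -> bases M = noncollinear_triples nonfano_lines -> ~ realizable M F.
Proof.
move=> two0 rM bM rz; have n245 : collinear nonfano_lines 2 4 5 = false by vm_compute.
have LE a b c : (a < b < c)%N -> (c < 7)%N -> collinear nonfano_lines a b c =
    collinear nonfano_lines a b c || (collinear nonfano_lines 2 4 5 && ((a, b, c) == (2, 4, 5))%N).
  by rewrite n245 orbF.
by have := seven_point_realizable rM bM LE rz; rewrite two0 eqxx n245.
Qed.

(* Over a field of characteristic 2 every Pluecker coordinate of the Fano
   matroid can be taken to be 0 or 1. *)
Lemma fano_initial_point (R : realType) (F : fieldType) (M : matroid 7) : 2 = 0 :> F ->
  rank M = 3 -> bases M = noncollinear_triples fano_lines ->
  @initial_point 7 M R F (coord_ext ([ffun _ => 0] : {ffun matroid_basis M -> R})) (fun=> 1).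
Proof.
move=> two0 rM bM; split=> [b|S i j k l c /and3P[cS ijkl nS] _]; first exact: oner_neq0.
have f0 s : coord_ext ([ffun _ => 0] : {ffun matroid_basis M -> R}) s = 0.
  by rewrite /coord_ext; case: insub => // b; rewrite ffunE.
have [c0|c0] := eqVneq c 0; last first.
  rewrite /three_term_mask /weight_mask !f0 addr0 eq_sym (negPf c0).
  by rewrite !mulr0n subr0 addr0.
have /cards1P[o SE] : #|S| == 1 by move: cS; rewrite rM; lia.
pose nc (a b : 'I_7) := ~~ collinear fano_lines o a b.
have xE a b : a \notin S -> b \notin S -> a != b ->
    coord_ext (fun _ : matroid_basis M => 1 : F) (S :|: [set a; b]%SET) = (nc a b)%:R.
  rewrite SE !inE => ao bo ab; have u : uniq [:: o; a; b].
    by rewrite /= !inE negb_or eq_sym ao eq_sym bo ab.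
  have := in_noncollinear fano_lines u; rewrite -bM -finset.setUA -/(nc a b).
  have [sM <-|sM <-] := boolP (_ \in bases M); last by rewrite coord_ext_out.
  by rewrite (coord_ext_in _ sM).
case/and4P: (nS) => iS jS kS lS.
have [ij ik il [jk jl kl]] : [/\ i != j, i != k, i != l & [/\ j != k, j != l & k != l]].
  by case/andP: ijkl => ? ?; do !split; rewrite -val_eqE /=; lia.
rewrite /three_term_mask /weight_mask !f0 addr0 c0 eqxx !mulr1n !xE //.
rewrite -!natrM !mulnb.
have cond : [&& (k < l)%N, (o : nat) != i, (o : nat) != j, (o : nat) != k & (o : nat) != l].
  case/andP: ijkl => _ ->; move: iS jS kS lS; rewrite SE !inE -!val_eqE /=.
  by rewrite ![_ == val o]eq_sym => -> -> -> ->.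
(* In characteristic 2 signs disappear, so a relation vanishes as soon as an even number of its
   three products is nonzero. *)
have check : all (fun o => all (fun i => all (fun j => (i < j)%N ==> all (fun k => (j < k)%N ==>
    all (fun l => [&& (k < l)%N, o != i, o != j, o != k & o != l] ==>
      ~~ ((~~ collinear fano_lines o i j && ~~ collinear fano_lines o k l) (+)
       (~~ collinear fano_lines o i k && ~~ collinear fano_lines o j l) (+)
       (~~ collinear fano_lines o i l && ~~ collinear fano_lines o j k)))
    (iota 0 7)) (iota 0 7)) (iota 0 7)) (iota 0 7)) (iota 0 7) by vm_compute.
move: check => /allP/(_ _ (seven_iota o))/allP/(_ _ (seven_iota i))/allP/(_ _ (seven_iota j)).
case/andP: ijkl => /andP[ij' jk'] kl' /implyP/(_ ij')/allP/(_ _ (seven_iota k)).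
move=> /implyP/(_ jk')/allP/(_ _ (seven_iota l))/implyP H.
move: (H cond) => {H cond}.
rewrite -/(nc i j) -/(nc k l) -/(nc i k) -/(nc j l) -/(nc i l) -/(nc j k).
have t1 : 1 + 1 = 0 :> F by rewrite -two0.
by case: (_ && _); case: (_ && _); case: (_ && _) => // _;
  rewrite ?subr0 ?sub0r ?addr0 ?add0r ?subrr ?addNr.
Qed.

(** * Inclusions *)

Section Inclusions.
Variables (R : realType) (n : nat) (M : matroid n).

Lemma realizable_eq (N N' : matroid n) (F : fieldType) :
  bases N = bases N' -> realizable N F -> realizable N' F.
Proof.
move=> bNN'; have rNN' : rank N = rank N'.
  have [s sN] : exists s, s \in bases N by apply/set0Pn; exact: bases_neq0.
  by rewrite -(bases_card sN); apply: bases_card; rewrite -bNN'.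
by rewrite /realizable rNN' bNN'.
Qed.

Lemma realizable_cells_Dr (K : fieldType) (v : valuation R K) (F : fieldType) :
  realizable_cells R M F `<=` Dr M v.
Proof.
move=> w wr; apply/exchange_Dr/matroid_subdivision_exchange => C /wr[N CN _].
by exists N.
Qed.

(** The zero functional cuts out the cell whose vertices are the bases of minimal weight. *)
Lemma initial_matroid_realizable (F : fieldType) (w : {ffun matroid_basis M -> R}) :
  realizable_cells R M F w -> exists2 N : matroid n, is_initial_matroid M w N & realizable N F.
Proof.
move=> wr; have [|N] := wr (hull (argmin_bases M (tilt w (fun=> 0)))).
  by apply/regular_subdivisionP; exists (fun=> 0).
rewrite matroid_polytope_hull => /hull_inj bN rN; exists N => // s.
have tE t : tilt w (fun=> 0) t = coord_ext w t by rewrite /tilt big1 ?addr0.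
rewrite -bN; split=> [/argmin_basesP[sM smin]|[b <- bmin]].
  exists (exist _ s sM : matroid_basis M) => // b'.
  by have := smin _ (valP b'); rewrite !tE coord_ext_val coord_ext_in.
apply/argmin_basesP; split=> [|t tM]; first exact: valP.
by rewrite !tE coord_ext_val coord_ext_in.
Qed.

Variables (K : closedFieldType) (v : valuation R K).

Lemma Gr_realizable_cells : Gr M v `<=` realizable_cells R M (residue_field v).
Proof. by move=> w /Gr_initial_point[a]; apply: initial_point_realizable_cells. Qed.

Lemma Gr_realizable (w : {ffun matroid_basis M -> R}) : Gr M v w -> realizable M K.
Proof.
move=> /Gr_torus_point[a [a0 aS]].
have supp s : (coord_ext a s != 0) = (s \in bases M).
  have [sM|sM] := boolP (s \in bases M); last by rewrite coord_ext_out ?eqxx.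
  by rewrite coord_ext_in a0.
exact: pluecker_realizable supp aS.
Qed.

End Inclusions.

Lemma residue_char2 (R : realType) (K : fieldType) (v : valuation R K) :
  v 2 = 1%:E -> 2 = 0 :> residue_field v.
Proof.
move=> v2; have : residue v 2 = 0 by apply/residue_eq0; rewrite v2 ?lte_fin ?lee_fin ?ler01 ?ltr01.
by rewrite -[2]/(1 + 1) residueD ?valuation1 // residue1.
Qed.

Theorem proposition2p9 (R : realType) :
  (forall (n : nat) (M : matroid n) (K : closedFieldType) (v : valuation R K),
     nontrivial_valuation v ->
     [/\ Gr M v `<=` realizable_cells R M (residue_field v),
         realizable_cells R M (residue_field v) `<=` Dr M v
       & Gr M v = Dr M v ->
           ~ (exists (w : {ffun matroid_basis M -> R}) (C : set 'rV[R]_n) (N : matroid n),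
                [/\ matroid_subdivision (regular_subdivision M w),
                    regular_subdivision M w C,
                    C = matroid_polytope R N
                  & ~ realizable N (residue_field v)])
           /\ (forall w, Dr M v w ->
                exists2 N : matroid n,
                  is_initial_matroid M w N & realizable N (residue_field v))])
  /\ (exists (n : nat) (M : matroid n) (K : closedFieldType) (v : valuation R K),
        nontrivial_valuation v /\
        Gr M v `<` realizable_cells R M (residue_field v))
  /\ (exists (n : nat) (M : matroid n) (K : closedFieldType) (v : valuation R K),
        nontrivial_valuation v /\
        realizable_cells R M (residue_field v) `<` Dr M v).
Proof.
split.
  move=> n M K v _; split=> [||GrDr].
  - exact: Gr_realizable_cells.
  - exact: realizable_cells_Dr.
  split=> [[w [C [N [msub wC CN nN]]]]|w]; last first.
    by rewrite -GrDr => /Gr_realizable_cells/initial_matroid_realizable.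
  have : Gr M v w by rewrite GrDr; apply/exchange_Dr/matroid_subdivision_exchange.
  (* The cell [C] determines its bases, so [N] shares them with the realizable [N']. *)
  move=> /Gr_realizable_cells/(_ C wC)[N' CN' rN']; apply: nN.
  apply: realizable_eq rN'; apply: (@hull_inj R).
  by rewrite -!matroid_polytope_hull -CN -CN'.
have [v v2] := algC_dyadic_valuation R.
have vnt : nontrivial_valuation v.
  by exists 2; [rewrite pnatr_eq0 | rewrite v2 => -[] /eqP; rewrite oner_eq0].
have k2 := residue_char2 v2.
split.
  have [M [rM bM]] := exists_fano; exists 7, M, algC, v; split=> //.
  split; first exact: Gr_realizable_cells.
  move=> /(_ [ffun=> 0]) sub; have two0 : 2 != 0 :> algC by rewrite pnatr_eq0.
  apply: (fano_not_realizable two0 rM bM); apply: Gr_realizable; apply: sub.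
  exact: initial_point_realizable_cells (fano_initial_point R k2 rM bM).
have [M [rM bM]] := exists_nonfano; exists 7, M, algC, v; split=> //.
split; first exact: realizable_cells_Dr.
pose w0 : {ffun matroid_basis M -> R} := [ffun=> 0].
have w0E s : coord_ext w0 s = 0.
  by rewrite /coord_ext; case: insub => // b; rewrite ffunE.
move=> /(_ w0) sub.
have /sub/(_ (matroid_polytope R M)) : Dr M v w0.
  by apply: exchange_Dr; apply: (constant_exchange w0E).
(* A constant lift leaves the polytope undivided, so [M] itself would have to be realizable over the
   residue field. *)
have cell : regular_subdivision M w0 (matroid_polytope R M).
  apply/regular_subdivisionP; exists (fun=> 0); rewrite matroid_polytope_hull; congr hull.
  have tE t : tilt w0 (fun=> 0) t = 0 by rewrite /tilt big1 // addr0.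
  by apply/setP => s; apply/idP/argmin_basesP => [sM|[]//]; split=> // t _; rewrite !tE.
move=> /(_ cell)[N]; rewrite !matroid_polytope_hull => /hull_inj bN rN.
apply: (nonfano_not_realizable k2 rM bM).
by apply: realizable_eq rN.
Qed.
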